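(* Let $\alpha>-1$, $n+1+\alpha<c<n+2(1+\alpha)$ and $1\le p,q\le\infty$. Then $K_c^\alpha: L^p_\alpha\to L^q_\alpha$ is bounded if and only if $p,q$ satisfy $$\frac{1+\alpha}{n+2(1+\alpha)-c}<p\le\infty,\qquad \frac1q>\frac1p+\frac{c-(n+1+\alpha)}{1+\alpha}.$$ When $p=\infty$, the second inequality is to be interpreted as $$\frac1q>\frac{c-(n+1+\alpha)}{1+\alpha}.$$
   Context: Let $n\ge 1$ be an integer, $\mathbb{B}_n$ the open unit ball of $\mathbb{C}^n$, $\langle z,w\rangle=\sum_{j=1}^n z_j\overline{w_j}$, and $dv$ the normalized volume measure on $\mathbb{B}_n$, so $v(\mathbb{B}_n)=1$. For $\alpha>-1$ let $dv_\alpha(z)=c_\alpha(1-|z|^2)^\alpha\,dv(z)$ with $c_\alpha=\Gamma(n+\alpha+1)/[n!\,\Gamma(\alpha+1)]$, so that $v_\alpha(\mathbb{B}_n)=1$. For $1\le p<\infty$, $L^p_\alpha=L^p(\mathbb{B}_n,dv_\alpha)$; $L^\infty_\alpha=L^\infty$ is the space of essentially bounded measurable functions on $\mathbb{B}_n$ with the essential supremum norm. For $c\in\mathbb{R}$ and $\alpha>-1$ define $$K_c^\alpha f(z)=\int_{\mathbb{B}_n}\frac{f(w)}{(1-\langle z,w\rangle)^c}\,dv_\alpha(w),$$ where the power is the principal branch ($\operatorname{Re}(1-\langle z,w\rangle)>0$). Convention: $1/\infty=0$. *)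

(* Defs.v *)
From HB Require Import structures.
From mathcomp Require Import all_boot all_order all_algebra.
From mathcomp Require Import all_classical all_reals all_analysis.
From mathcomp Require Import measurable_realfun complex.

Set Implicit Arguments.
Unset Strict Implicit.
Unset Printing Implicit Defensive.
Import Order.TTheory GRing.Theory Num.Theory.
Import numFieldNormedType.Exports.
Import Normc.

Local Open Scope classical_set_scope.
Local Open Scope ring_scope.
Local Open Scope complex_scope.

Definition complex_display : measure_display.
Proof. exact: default_measure_display. Qed.

(* The Borel sigma-algebra of C, transported from R * R. *)
Section measurable_complex.
Context {R : realType}.

Definition complex_pair (z : R[i]) : R * R := (complex.Re z, complex.Im z).

Definition pair_complex (x : R * R) : R[i] := x.1 +i* x.2.

Definition complex_measurable : set (set R[i]) :=
  preimage_set_system setT complex_pair measurable.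

Let sigma_algebra_complex : sigma_algebra setT complex_measurable.
Proof.
by apply: sigma_algebra_preimage; exact: sigma_algebra_measurable.
Qed.

Let complex_measurable0 : complex_measurable set0.
Proof. by case: sigma_algebra_complex. Qed.

Let complex_measurableC A : complex_measurable A -> complex_measurable (~` A).
Proof. by case: sigma_algebra_complex => _ + _ => /[apply]; rewrite setTD. Qed.

Let complex_measurable_bigcup (F : (set R[i])^nat) :
  (forall i, complex_measurable (F i)) -> complex_measurable (\bigcup_i F i).
Proof. by case: sigma_algebra_complex => _ _; exact. Qed.

HB.instance Definition _ := isPointed.Build R[i] 0.
HB.instance Definition _ := isMeasurable.Build complex_display R[i]
  complex_measurable0 complex_measurableC complex_measurable_bigcup.

Lemma measurable_complex_pair : measurable_fun setT complex_pair.
Proof. by move=> _ A mA; exists A. Qed.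

Lemma measurable_pair_complex : measurable_fun setT pair_complex.
Proof.
move=> _ _ [A mA <-]; rewrite !setTI.
by rewrite [X in measurable X](_ : _ = A) //; apply/seteqP; split => -[x y].
Qed.

End measurable_complex.



Definition sigma_finite_of d (T : measurableType d) (R : realType)
    (mu : {measure set T -> \bar R}) (muT : sigma_finite setT mu) :
    {sigma_finite_measure set T -> \bar R} :=
  HB.pack_for (SigmaFiniteMeasure.type T R) (Measure.sort mu)
    (isSFinite.Build _ _ _ _ (sfinite_measure_sigma_finite muT))
    (isSigmaFinite.Build _ _ _ _ muT).

Section sigma_finite_pushforward.
Context d1 d2 (T1 : measurableType d1) (T2 : measurableType d2) (R : realType).
Variables (m : {sigma_finite_measure set T1 -> \bar R}).
Variables (f : T1 -> T2) (g : T2 -> T1).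
Hypotheses (mf : measurable_fun setT f) (mg : measurable_fun setT g).
Hypothesis fK : cancel f g.

Let mu : {measure set T2 -> \bar R} :=
  measure_function_pushforward__canonical__measure_function_Measure m mf.

Let mu_sigma_finite : sigma_finite setT mu.
Proof.
have [F TF mFoo] := sigma_finiteT m; exists (fun i => g @^-1` F i).
  by rewrite -preimage_bigcup -TF preimage_setT.
move=> i; have [mFi Fioo] := mFoo i; split.
  by rewrite -[X in measurable X]setTI; exact: mg.
rewrite /mu /= /pushforward -comp_preimage (_ : g \o f = id) //.
exact/funext.
Qed.

Definition sfpushforward : {sigma_finite_measure set T2 -> \bar R} :=
  sigma_finite_of mu_sigma_finite.

Lemma sfpushforwardE A : sfpushforward A = m (f @^-1` A).
Proof. by []. Qed.

End sigma_finite_pushforward.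

Section sigma_finite_product.
Context d1 d2 (T1 : measurableType d1) (T2 : measurableType d2) (R : realType).
Variables (m1 : {sigma_finite_measure set T1 -> \bar R}).
Variables (m2 : {sigma_finite_measure set T2 -> \bar R}).

Let mu : {measure set (T1 * T2)%type -> \bar R} :=
  [the {measure set (T1 * T2)%type -> \bar R} of (m1 \x m2)%E].

Let mu_sigma_finite : sigma_finite setT mu.
Proof.
have /sigma_finiteP[F [TF ndF Foo]] := sigma_finiteT m1.
have /sigma_finiteP[G [TG ndG Goo]] := sigma_finiteT m2.
exists (fun n => F n `*` G n).
  rewrite -setXTT TF TG predeqE => -[x y]; split.
    move=> [/= [n _ Fnx] [k _ Gky]]; exists (maxn n k) => //; split.
    - by move: x Fnx; exact/subsetPset/ndF/leq_maxl.
    - by move: y Gky; exact/subsetPset/ndG/leq_maxr.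
  by move=> [n _ []/= ? ?]; split; exists n.
move=> k; have [? ?] := Foo k; have [? ?] := Goo k.
split; first exact: measurableX.
by rewrite /mu /= product_measure1E// lte_mul_pinfty// ge0_fin_numE.
Qed.

(* The canonical structure found by the library for [m1 \x m2] is the one that
   requires probability measures, hence this explicit bundling. *)
Definition sfproduct : {sigma_finite_measure set (T1 * T2)%type -> \bar R} :=
  sigma_finite_of mu_sigma_finite.

Lemma sfproductE A : sfproduct A = (m1 \x m2)%E A.
Proof. by []. Qed.

End sigma_finite_product.

Section lebesgue_Cn.
Context {R : realType}.

Lemma complex_pairK : cancel (@complex_pair R) pair_complex.
Proof. by case. Qed.

Lemma pair_complexK : cancel (@pair_complex R) complex_pair.
Proof. by case. Qed.

Definition lebesgue_C : {sigma_finite_measure set R[i] -> \bar R} :=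
  sfpushforward (sfproduct (@lebesgue_measure R) (@lebesgue_measure R))
    measurable_pair_complex measurable_complex_pair pair_complexK.

Definition cons_pair n (x : R[i] * n.-tuple R[i]) : n.+1.-tuple R[i] :=
  [tuple of x.1 :: x.2].

Definition uncons_pair n (z : n.+1.-tuple R[i]) : R[i] * n.-tuple R[i] :=
  (thead z, [tuple of behead z]).

Lemma measurable_cons_pair n : measurable_fun setT (@cons_pair n).
Proof. exact: measurable_cons. Qed.

Lemma measurable_uncons_pair n : measurable_fun setT (@uncons_pair n).
Proof.
apply/measurable_fun_pairP; split; last exact: measurable_behead.
exact: measurable_tnth.
Qed.

Lemma cons_pairK n : cancel (@cons_pair n) (@uncons_pair n).
Proof. by case=> x t; congr (_, _); exact/val_inj. Qed.

(* Lebesgue measure on C^n = R^(2n), as an iterated product. *)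
Fixpoint lebesgue_Cn n : {sigma_finite_measure set (n.-tuple R[i]) -> \bar R} :=
  match n with
  | 0 => \d_ ([tuple] : 0.-tuple R[i])
  | n'.+1 => sfpushforward (sfproduct lebesgue_C (lebesgue_Cn n'))
      (@measurable_cons_pair n') (@measurable_uncons_pair n') (@cons_pairK n')
  end.

End lebesgue_Cn.

Section unit_ball.
Context {R : realType}.
Variable n : nat.
Implicit Types z w : n.-tuple R[i].

Definition inner z w : R[i] := \sum_(j < n) tnth z j * (tnth w j)^*.

Definition normsq z : R := \sum_(j < n) normc (tnth z j) ^+ 2.

Lemma inner_normsq z : inner z z = (normsq z)%:C.
Proof.
rewrite /normsq rmorph_sum; apply: eq_bigr => j _.
case: (tnth z j) => x y; rewrite /= sqr_sqrtr ?addr_ge0 ?sqr_ge0//.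
by simpc; rewrite !expr2 [y * x]mulrC addNr.
Qed.

Definition unit_ball : set (n.-tuple R[i]) := [set z | normsq z < 1].

Lemma measurable_normsq : measurable_fun setT normsq.
Proof.
apply: measurable_sum => j.
have -> : (fun z => normc (tnth z j) ^+ 2) =
    (fun x : R * R => x.1 ^+ 2 + x.2 ^+ 2) \o (complex_pair \o (@tnth n _ ^~ j)).
  apply/funext => z /=; case: (tnth z j) => x y /=.
  by rewrite sqr_sqrtr ?addr_ge0 ?sqr_ge0.
apply: measurableT_comp => /=.
  by apply: measurable_funD; exact: measurable_funX.
apply: measurableT_comp; first exact: measurable_complex_pair.
exact: measurable_tnth.
Qed.

Lemma measurable_unit_ball : measurable unit_ball.
Proof.
rewrite -[X in measurable X]setTI.
have -> : unit_ball = normsq @^-1` `]-oo, 1[%classic.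
  by apply/seteqP; split => z /=; rewrite in_itv.
exact: measurable_normsq.
Qed.

Let inv_volume_ge0 : 0 <= (fine (lebesgue_Cn n unit_ball))^-1.
Proof. by rewrite invr_ge0 fine_ge0. Qed.

(* dv: a measure on C^n concentrated on the unit ball, of total mass 1. *)
Definition normalized_volume : {measure set (n.-tuple R[i]) -> \bar R} :=
  mscale (NngNum inv_volume_ge0) (mrestr (lebesgue_Cn n) measurable_unit_ball).

End unit_ball.
Arguments unit_ball {R} n _.

Section weighted_volume.
Context {R : realType}.
Local Open Scope ereal_scope.

Definition Gamma (s : R) : R :=
  (\int[lebesgue_measure]_(t in `]0%R, +oo[) (t `^ (s - 1) * expR (- t)))%R.

Lemma Gamma_ge0 s : (0 <= Gamma s)%R.
Proof.
by apply: Rintegral_ge0 => t _; rewrite mulr_ge0 ?powR_ge0 ?expR_ge0.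
Qed.

Variables (n : nat) (alpha : R).

Definition c_alpha : R :=
  (Gamma (n%:R + alpha + 1) / (n`!%:R * Gamma (alpha + 1)))%R.

Let weight (z : n.-tuple R[i]) : R := (c_alpha * (1 - normsq z) `^ alpha)%R.

Let weight_ge0 z : (0 <= weight z)%R.
Proof. by rewrite mulr_ge0 ?powR_ge0 ?divr_ge0 ?mulr_ge0 ?Gamma_ge0. Qed.

Let measurable_weight : measurable_fun setT weight.
Proof.
apply: measurable_funM => //.
apply: (measurableT_comp (measurable_powR _)) => //.
by apply: measurable_funB => //; exact: measurable_normsq.
Qed.

(* dv_alpha = c_alpha (1 - `|z|^2)^alpha dv. *)
Definition weighted_volume (A : set (n.-tuple R[i])) : \bar R :=
  \int[normalized_volume n]_(z in A) (c_alpha * (1 - normsq z) `^ alpha)%:E.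

Let weighted_volume0 : weighted_volume set0 = 0.
Proof. exact: integral_set0. Qed.

Let weighted_volume_ge0 A : 0 <= weighted_volume A.
Proof. by apply: integral_ge0 => z _; rewrite lee_fin weight_ge0. Qed.

Let weighted_volume_sigma_additive : semi_sigma_additive weighted_volume.
Proof.
move=> /= F mF tF mUF; rewrite /weighted_volume; apply: cvg_toP.
  apply: ereal_nondecreasing_is_cvgn => k m km.
  apply: lee_sum_nneg_natr => // i _ _; exact: weighted_volume_ge0.
rewrite ge0_integral_bigcup//=.
- by apply: measurable_funTS; apply: measurableT_comp => //.
- by move=> z _; rewrite lee_fin weight_ge0.
Qed.

HB.instance Definition _ := isMeasure.Build _ _ _ weighted_volume
  weighted_volume0 weighted_volume_ge0 weighted_volume_sigma_additive.

End weighted_volume.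
Arguments weighted_volume {R} n alpha A.

Section operator.
Context {R : realType}.

(* The argument of u in ]-pi, pi], for u nonzero. *)
Definition Arg (u : R[i]) : R :=
  let t := acos (complex.Re u / normc u) in
  if 0 <= complex.Im u then t else - t.

(* The principal branch of u^c, for u nonzero. *)
Definition cpowR (u : R[i]) (c : R) : R[i] :=
  (normc u `^ c)%:C * (cos (c * Arg u) +i* sin (c * Arg u)).

Definition Cintegral d (T : measurableType d) (mu : {measure set T -> \bar R})
    (D : set T) (F : T -> R[i]) : R[i] :=
  (\int[mu]_(x in D) complex.Re (F x)) +i* (\int[mu]_(x in D) complex.Im (F x)).

Variables (n : nat) (alpha : R).
Implicit Types (f : n.-tuple R[i] -> R[i]) (p q : \bar R).

(* For z in the ball and f in L^p with p >= 1 this integral is absolutely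
   convergent: `|1 - <z, w>| >= 1 - `|z| > 0 and L^p is contained in L^1.
   Moreover Re (1 - <z, w>) > 0, so the principal branch is analytic there. *)
Definition K_op (c : R) f : n.-tuple R[i] -> R[i] := fun z =>
  Cintegral (weighted_volume n alpha) (unit_ball n)
    (fun w => f w / cpowR (1 - inner z w) c).

(* Functions on the unit ball are total functions on C^n, whose values outside
   the ball are ignored. *)
Definition Lp_norm p f : \bar R :=
  'N[weighted_volume n alpha]_p[(fun z => (normc (f z))%:E) \_ (unit_ball n)]%E.

Definition in_Lp p f : Prop :=
  measurable_fun (unit_ball n) f /\ (Lp_norm p f < +oo)%E.

Definition bounded_Lp_Lq p q
    (T : (n.-tuple R[i] -> R[i]) -> n.-tuple R[i] -> R[i]) : Prop :=
  exists C : R, forall f, in_Lp p f ->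
    in_Lp q (T f) /\ (Lp_norm q (T f) <= C%:E * Lp_norm p f)%E.

End operator.
Arguments K_op {R} n alpha c f z.

(* Main.v *)
(* Write N = n+1+alpha, s = (c-N)/(1+alpha), V(z) = 1-|z|^2, D = |1-<z,w>|. The
   first condition on p follows from the second one, 1/q > 1/p + s, since q >= 1.

   Sufficiency. Hoelder's inequality and the bound of the integral of D^-b for
   b < N give |Kf| <= C V^-t I^(1/p), where I is the average of |f|^p against
   D^(tau-N) and t = c-N+tau. Young's inequality with exponents p/q and r/q,
   1/r = 1/q - 1/p, reduces the L^q norm to the integrals of I and of V^-(tr),
   and tr < 1+alpha for tau small. The integral of D^-b is estimated by
   Tonelli's theorem in the real coordinates, after bounding D and V from below
   by differences of coordinates, which leaves integrable powers |t|^-theta.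

   Necessity. For h = 4^-m, cut a piece of the shell h <= V < 2h into O(h^-n)
   cells E on which (1-<z,w>)^-c has real part >= const * h^-c. For a step
   function with random signs on the cells of M consecutive shells, averaging
   over the signs leaves only the interaction of each cell with itself, so that
   boundedness yields M (k h^-u)^q <= (C M^(1/p))^q for all M and all large m,
   with u = (1+alpha)(1/p + s - 1/q). If u > 0 let m go to infinity; if u = 0
   then q < p and M goes to infinity. The case q = oo follows from finite q. *)
Require Import Defs.
From mathcomp Require Import all_boot all_order all_algebra.
From mathcomp Require Import all_classical all_reals all_analysis.
From mathcomp Require Import measurable_realfun ess_sup_inf complex.
From mathcomp Require Import ring lra.

Set Implicit Arguments.
Unset Strict Implicit.
Unset Printing Implicit Defensive.
Import Order.TTheory GRing.Theory Num.Theory.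
Import numFieldNormedType.Exports.
Import Normc.

Local Open Scope classical_set_scope.
Local Open Scope ring_scope.

(** * Singular integrals over the unit ball *)

(** Tonelli's theorem in fixed real coordinates takes the place of unitary invariance and polar
    coordinates. The exponents are shared out so that each real coordinate receives |t|^-theta for
    one common theta < 1. A tangential complex coordinate of z - w is O(D^(1/2)), so one D^-theta
    pays for its two real parts; one more D^-theta goes to the direction in which 1 - <z, w>
    vanishes linearly, and V^-theta to the direction that crosses the sphere. These n + 1 factors
    cover D^-b V^alpha because b - alpha < n + 1. For necessity, the phase of (1-<z,w>)^-c may turn
    by a large angle when c is large, so that for a positive test function remote cells could cancel
    the local contribution. Random signs remove the remote cells whatever their phases. A cell has
    sides of order h^(1/2), but Im <z, w> must be controlled at scale h, since the phase is small
    only if the imaginary part is small against the real part, which is of order h. At the endpoint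
    u = 0 one shell gives no contradiction; M disjoint shells of L^p norm 1 have norm M^(1/p)
    together, while the images grow like M^(1/q). *)

Section spike.
Context {R : realType}.
Implicit Types (theta t x r : R).
Local Notation mu := (@lebesgue_measure R).

(* A dyadic majorant of [`|t|^-theta] on [-1, 1], infinite at [t = 0] where
   [powR] has a junk value. *)
Definition spike theta t : \bar R :=
  (\sum_(k <oo) ((2 `^ theta) ^+ k * (`|t| <= 2^-1 ^+ k)%R%:R)%:E)%E.

Let spike_term_ge0 theta t k :
  (0 <= ((2 `^ theta) ^+ k * (`|t| <= 2^-1 ^+ k)%R%:R)%:E)%E.
Proof. by rewrite lee_fin mulr_ge0// exprn_ge0// powR_ge0. Qed.

Lemma spike_ge0 theta t : (0 <= spike theta t)%E.
Proof. by apply: nneseries_ge0 => k _ _; exact: spike_term_ge0. Qed.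

Lemma spike_ge_term theta t k : `|t| <= 2^-1 ^+ k ->
  (((2 `^ theta) ^+ k)%:E <= spike theta t)%E.
Proof.
move=> tk; rewrite /spike (@nneseriesD1 _ _ k)//=.
rewrite tk mulr1 leeDl//; apply: nneseries_ge0 => i _ _.
exact: spike_term_ge0.
Qed.

Lemma spike_ge1 theta t : `|t| <= 1 -> (1 <= spike theta t)%E.
Proof. by move=> t1; have := @spike_ge_term theta t 0; rewrite !expr0; exact. Qed.

(** The term k with 2^-(k+1) < x <= 2^-k already suffices. The bound is stated for any x above |t|,
    because x will be D or V and t a multiple of a difference of coordinates. *)
Lemma powRN_le_spike theta t x : 0 <= theta -> 0 < x <= 1 -> `|t| <= x ->
  ((x `^ (- theta))%:E <= (2 `^ theta)%:E * spike theta t)%E.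
Proof.
move=> th0 /andP[x0 x1] tx.
have [k /andP[kx xk]] : exists k, 2^-1 ^+ k.+1 < x <= 2^-1 ^+ k.
  have ex : exists k, 2^-1 ^+ k.+1 < x.
    have h1 : `|2^-1 : R| < 1 by rewrite ger0_norm; lra.
    have /cvgrPdist_lt/(_ x x0)[N _ /(_ N.+1 (leqnSn _))] := cvg_expr h1.
    rewrite /= sub0r normrN ger0_norm ?exprn_ge0 ?invr_ge0// => hN.
    by exists N.
  case: (ex_minnP ex) => -[|k] kx kmin; first by exists 0%N; rewrite kx.
  exists k.+1; rewrite kx leNgt/=; apply/negP => /kmin.
  by rewrite ltnn.
apply: le_trans (lee_wpmul2l _ (spike_ge_term theta (le_trans tx xk))); last first.
  by rewrite lee_fin powR_ge0.
rewrite -EFinM lee_fin -exprS -(powR_mulrn _ (powR_ge0 _ _)) -powRrM mulrC.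
rewrite powRrM powR_mulrn// -[- theta]mulN1r powRrM (powR_inv1 (ltW x0)).
apply: ge0_ler_powR; rewrite ?nnegrE ?invr_ge0 ?exprn_ge0 ?(ltW x0)//.
by rewrite -[leRHS]invrK -exprVn lef_pV2 ?posrE ?exprn_gt0 ?invr_gt0// ltW.
Qed.

Let measurable_spike_term theta k : measurable_fun setT
  (fun t => ((2 `^ theta) ^+ k * (`|t| <= 2^-1 ^+ k)%R%:R)%:E).
Proof.
apply/measurable_EFinP; apply: measurable_funM => //.
rewrite (_ : (fun _ => _) = \1_[set t : R | `|t| <= 2^-1 ^+ k]); last first.
  by apply/funext => t; rewrite indicE mem_setE.
by apply: measurable_indic; rewrite -[X in measurable X]setTI;
  apply: measurable_fun_le => //; exact: measurableT_comp.
Qed.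

Lemma measurable_spike theta : measurable_fun setT (spike theta).
Proof.
apply: ge0_emeasurable_sum => [k t _ _|k _]; first exact: spike_term_ge0.
exact: measurable_spike_term.
Qed.

Lemma measurable_spike_affine theta c x :
  measurable_fun setT (fun t => spike theta (c * (t - x))).
Proof.
apply: (measurableT_comp (measurable_spike theta)).
by apply: measurable_funM => //; exact: measurable_funB.
Qed.

(** Term k is 2^(k theta) times the indicator of an interval of length 2 * 2^-k / c, so the
    integrals form a geometric series of ratio 2^(theta - 1) < 1. Uniformity in the centre [x] is
    what lets the centre depend on the remaining coordinates later. *)
Lemma integral_spike theta : theta < 1 -> exists2 K : R, 0 <= K &
  forall c x, 0 < c -> (\int[mu]_t spike theta (c * (t - x)) <= (K / c)%:E)%E.
Proof.
move=> th1; pose r := 2 `^ theta / 2 : R.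
have r0 : 0 < r by rewrite divr_gt0// powR_gt0.
have r1 : r < 1.
  rewrite /r -[X in _ / X]powRr1// -powRB ?pnatr_eq0 ?implybT// /powR pnatr_eq0.
  by rewrite expR_lt1 nmulr_rlt0 ?subr_lt0// ln_gt0// ltr1n.
exists (2 / (1 - r)); first by rewrite divr_ge0// subr_ge0 ltW.
move=> c x c0; rewrite /spike integral_nneseries//; last first.
  move=> k; have := measurableT_comp (measurable_spike_term theta k).
  by apply; apply: measurable_funM => //; exact: measurable_funB.
apply: (@le_trans _ _ (\sum_(k <oo) (geometric (2 / c) r k)%:E)%E).
  apply: lee_nneseries => [k _ _|k _]; first exact: integral_ge0.
  rewrite [X in (X <= _)%E](_ : _ = \int[mu]_t (((2 `^ theta) ^+ k)%:E *
     (\1_(`[x - 2^-1 ^+ k / c, x + 2^-1 ^+ k / c] : set R) t)%:E)%E)%E; last first.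
    apply: eq_integral => t _; rewrite -EFinM indicE mem_setE in_itv/=.
    congr (_ * (nat_of_bool _)%:R)%:E; rewrite normrM (gtr0_norm c0).
    by rewrite [leLHS]mulrC -ler_pdivlMr// ler_distl.
  rewrite ge0_integralZl//=; last first.
    by apply/measurable_EFinP; exact: measurable_indic.
  rewrite integral_indic// setIT [X in (_ * X)%E]lebesgue_measure_itv/= lte_fin.
  have h : 0 < 2^-1 ^+ k / c by rewrite divr_gt0// exprn_gt0// invr_gt0.
  rewrite ifT; last by lra.
  rewrite -EFinB -EFinM lee_fin /r expr_div_n.
  rewrite le_eqVlt; apply/orP; left; apply/eqP.
  by rewrite exprVn; field; rewrite (gt_eqF c0)/= expf_neq0.
apply: lime_le.
  apply: is_cvg_nneseries => k _ _.
  by rewrite lee_fin geometric_ge0// ?divr_ge0// ltW.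
apply: nearW => k; rewrite sumEFin lee_fin.
rewrite [leRHS]mulrAC; apply: geometric_le_lim => //.
- by rewrite divr_ge0// ltW.
- by rewrite ger0_norm// ltW.
Qed.

End spike.

(** * Positivity of the Gamma function *)

Section Gamma_pos.
Context {R : realType}.
Local Notation mu := (@lebesgue_measure R).

Let measurable_Gamma_integrand (s : R) :
  measurable_fun setT (fun t : R => (t `^ (s - 1) * expR (- t))%R).
Proof.
apply: measurable_funM => //; apply: measurableT_comp => //.
Qed.

Let Gamma_integrand_bound (s : R) : 0 < s -> exists2 C : R, 0 <= C &
  forall t, 0 < t -> ((t `^ (s - 1) * expR (- t))%:E <=
   (2 `^ (Num.max (1 - s) 0)%R)%:E * spike (Num.max (1 - s) 0)%R t +
   C%:E * (exponential_pdf 2^-1 t)%:E)%E.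
Proof.
(* From t^(k+1) <= 2^(k+1) (k+1)! exp(t/2); the leading 2 cancels the factor 1/2 of the exponential
   density of rate 1/2. *)
move=> s0; pose k := Num.bound `|s|; pose C := 2 * (2 ^+ k.+1 * (k.+1)`!%:R) : R.
have C0 : 0 <= C by rewrite /C -natrX -!natrM ler0n.
exists C => //.
move=> t t0; set th := Num.max _ _.
have th0 : 0 <= th by rewrite le_max lexx orbT.
have [t1|/ltW t1] := leP t 1.
  apply: (@le_trans _ _ ((2 `^ th)%:E * spike th t)%E); last first.
    by apply: leeDl; rewrite mule_ge0// lee_fin ?exponential_pdf_ge0.
  apply: le_trans (@powRN_le_spike _ th t t th0 _ _); last 2 first.
    by rewrite t0.
    by rewrite ger0_norm ?(ltW t0).
  rewrite lee_fin -[leRHS]mulr1 ler_pM// ?powR_ge0 ?expR_ge0//.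
    by apply: ger_powR; rewrite ?t0// lerNl opprB le_max lexx.
  by rewrite -expR0 ler_expR oppr_le0 ltW.
rewrite -[leLHS]add0e leeD//.
  by rewrite mule_ge0 ?spike_ge0// lee_fin powR_ge0.
rewrite exponential_pdfE ?(ltW t0)// -EFinM lee_fin.
have st : t `^ (s - 1) <= t ^+ k.+1.
  rewrite -powR_mulrn ?(ltW t0)//; apply: ler_powR => //.
  rewrite lerBlDr -natr1 -addrA (le_trans (ler_norm _))//.
  by rewrite (le_trans (ltW (archi_boundP _)))// lerDl.
have et : t ^+ k.+1 <= 2 ^+ k.+1 * (k.+1)`!%:R * expR (t / 2).
  have t2 : 0 <= t / 2 by rewrite divr_ge0// ltW.
  have := expR_ge1Dxn k t2; rewrite expr_div_n => h.
  rewrite -mulrA -ler_pdivrMl ?exprn_gt0// mulrC -ler_pdivrMl ?ltr0n ?fact_gt0//.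
  by rewrite [leLHS]mulrC (le_trans _ h)// lerDr.
apply: (le_trans (ler_wpM2r (expR_ge0 _) (le_trans st et))).
rewrite -[leLHS]mulrA -expRD le_eqVlt; apply/orP; left; apply/eqP.
rewrite /C (_ : t / 2 + - t = - 2^-1 * t); last by lra.
by field.
Qed.

(** [Gamma] is a real-valued integral that would be 0 if the integral diverged, so positivity
    includes a proof of convergence: a spike majorizes the integrand near 0 and an exponential
    density at infinity. *)
Lemma Gamma_gt0 (s : R) : 0 < s -> 0 < Gamma s.
Proof.
move=> s0; rewrite /Gamma/= /Rintegral fine_gt0//; apply/andP; split; last first.
  have [C C0 hC] := Gamma_integrand_bound s0.
  have [K K0 hK] : exists2 K : R, 0 <= K &
      forall c x, 0 < c -> (\int[mu]_t spike (Num.max (1 - s) 0)%R (c * (t - x)) <= (K / c)%:E)%E.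
    apply: integral_spike; rewrite gt_max ltr01 andbT; lra.
  have msp : measurable_fun setT (spike (R:=R) (Num.max (1 - s) 0)%R).
    exact: measurable_spike.
  have mex : measurable_fun setT (fun t : R => (exponential_pdf 2^-1 t)%:E).
    by apply/measurable_EFinP; apply: measurable_exponential_pdf.
  pose G := fun t : R => ((2 `^ (Num.max (1 - s) 0)%R)%:E * spike (Num.max (1 - s) 0)%R t +
   C%:E * (exponential_pdf 2^-1 t)%:E)%E.
  have mG : measurable_fun setT G.
    by apply: emeasurable_funD; exact: measurable_funeM.
  have G0 x : (0 <= G x)%E.
    by rewrite adde_ge0// mule_ge0 ?spike_ge0 ?lee_fin ?powR_ge0 ?exponential_pdf_ge0.
  apply: (@le_lt_trans _ _ (\int[mu]_(t in `]0%R, +oo[) G t)%E).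
    apply: ge0_le_integral => //.
    - by move=> t _; rewrite lee_fin mulr_ge0 ?powR_ge0 ?expR_ge0.
    - by apply/measurable_EFinP; apply: measurable_funTS; exact: measurable_Gamma_integrand.
    - exact: measurable_funTS.
    - by move=> t; rewrite /= in_itv/= andbT; exact: hC.
  apply: (@le_lt_trans _ _ (\int[mu]_t G t)%E).
    by apply: ge0_subset_integral.
  rewrite ge0_integralD//; last 4 first.
  - by move=> t _; rewrite mule_ge0 ?spike_ge0 ?lee_fin ?powR_ge0.
  - exact: measurable_funeM.
  - by move=> t _; rewrite mule_ge0 ?lee_fin ?exponential_pdf_ge0.
  - exact: measurable_funeM.
  rewrite ge0_integralZl//=; last by move=> *; exact: spike_ge0.
  rewrite ge0_integralZl//=; last by move=> *; rewrite lee_fin exponential_pdf_ge0.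
  rewrite integral_exponential_pdf// mule1 lte_add_pinfty ?ltry//.
  apply: (@le_lt_trans _ _ ((2 `^ (Num.max (1 - s) 0)%R)%:E * K%:E)%E); last first.
    by rewrite -EFinM ltry.
  rewrite lee_wpmul2l ?lee_fin ?powR_ge0//.
  have := hK 1 0 ltr01; rewrite divr1.
  by under eq_integral do rewrite mul1r subr0.
(* A lower bound of the integrand on [1, 2]; which term of the minimum counts depends on the sign of
   s - 1. *)
pose c := Num.min 1 (2 `^ (s - 1)) * expR (- 2) : R.
have c0 : 0 < c by rewrite mulr_gt0 ?expR_gt0// lt_min ltr01 powR_gt0.
apply: (@lt_le_trans _ _ (\int[mu]_(t in `[1%R, 2%R]) c%:E)%E).
  rewrite integral_cst// [X in (_ * X)%E]lebesgue_measure_itv/= lte_fin ltr1n/=.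
  by rewrite -EFinB -EFinM lte_fin mulr_gt0//; lra.
apply: (@le_trans _ _ (\int[mu]_(t in `[1%R, 2%R]) (t `^ (s - 1) * expR (- t))%:E)%E).
  apply: ge0_le_integral => //.
  - by move=> t _; rewrite lee_fin ltW.
  - by apply/measurable_EFinP; apply: measurable_funTS; exact: measurable_Gamma_integrand.
  - move=> t; rewrite /= in_itv/= => /andP[t1 t2]; rewrite lee_fin ler_pM//.
    + rewrite ge_min; have [s1|/ltW s1] := leP 0 (s - 1).
        by apply/orP; left; rewrite -[leLHS](powRr0 t); exact: ler_powR.
      apply/orP; right; have t0 : 0 < t by exact: lt_le_trans t1.
      rewrite -[s - 1]opprK powRN (powRN t) lef_pV2 ?posrE ?powR_gt0//.
      by apply: ge0_ler_powR; rewrite ?nnegrE ?oppr_ge0// ltW.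
    + by rewrite ler_expR lerN2.
apply: ge0_subset_integral => //.
- by apply/measurable_EFinP; apply: measurable_funTS; exact: measurable_Gamma_integrand.
- by move=> t _; rewrite lee_fin mulr_ge0 ?powR_ge0 ?expR_ge0.
- by move=> t /=; rewrite !in_itv/= andbT => /andP[t1 _]; exact: lt_le_trans t1.
Qed.

End Gamma_pos.

(** * Tonelli's theorem on C and C^n *)

Section iterated_integrals.
Local Open Scope ereal_scope.
Local Open Scope complex_scope.

Lemma ge0_integral_sfpushforward d1 d2 (T1 : measurableType d1)
    (T2 : measurableType d2) (R : realType)
    (m : {sigma_finite_measure set T1 -> \bar R}) (f : T1 -> T2) (g : T2 -> T1)
    (mf : measurable_fun setT f) (mg : measurable_fun setT g)
    (fK : cancel f g) (h : T2 -> \bar R) :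
  measurable_fun setT h -> (forall y, 0 <= h y) ->
  \int[sfpushforward m mf mg fK]_y h y = \int[m]_x h (f x).
Proof.
move=> mh h0; rewrite -[RHS](@ge0_integral_pushforward _ _ _ _ _ f mf m setT)//.
Qed.

Lemma ge0_integral_sfproduct1 d1 d2 (T1 : measurableType d1)
    (T2 : measurableType d2) (R : realType)
    (m1 : {sigma_finite_measure set T1 -> \bar R})
    (m2 : {sigma_finite_measure set T2 -> \bar R}) (h : T1 * T2 -> \bar R) :
  measurable_fun setT h -> (forall y, 0 <= h y) ->
  \int[sfproduct m1 m2]_z h z = \int[m1]_x \int[m2]_y h (x, y).
Proof.
move=> mh h0; rewrite -[RHS](@fubini_tonelli1 _ _ _ _ _ m1 m2 h)//.
Qed.

Lemma ge0_integral_sfproduct2 d1 d2 (T1 : measurableType d1)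
    (T2 : measurableType d2) (R : realType)
    (m1 : {sigma_finite_measure set T1 -> \bar R})
    (m2 : {sigma_finite_measure set T2 -> \bar R}) (h : T1 * T2 -> \bar R) :
  measurable_fun setT h -> (forall y, 0 <= h y) ->
  \int[sfproduct m1 m2]_z h z = \int[m2]_y \int[m1]_x h (x, y).
Proof.
by move=> mh h0; rewrite ge0_integral_sfproduct1// fubini_tonelli.
Qed.

Context {R : realType}.
Local Notation mu := (@lebesgue_measure R).

Lemma ge0_integral_lebesgue_C1 (h : R[i] -> \bar R) :
  measurable_fun setT h -> (forall z, 0 <= h z) ->
  \int[lebesgue_C]_z h z = \int[mu]_x \int[mu]_y h (x +i* y).
Proof.
move=> mh h0; rewrite ge0_integral_sfpushforward// ge0_integral_sfproduct1//.
by apply: measurableT_comp => //; exact: measurable_pair_complex.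
Qed.

Lemma ge0_integral_lebesgue_C2 (h : R[i] -> \bar R) :
  measurable_fun setT h -> (forall z, 0 <= h z) ->
  \int[lebesgue_C]_z h z = \int[mu]_y \int[mu]_x h (x +i* y).
Proof.
move=> mh h0; rewrite ge0_integral_sfpushforward// ge0_integral_sfproduct2//.
by apply: measurableT_comp => //; exact: measurable_pair_complex.
Qed.

Lemma ge0_integral_lebesgue_CnS1 n (h : n.+1.-tuple R[i] -> \bar R) :
  measurable_fun setT h -> (forall z, 0 <= h z) ->
  \int[lebesgue_Cn n.+1]_z h z =
  \int[lebesgue_C]_x \int[lebesgue_Cn n]_t h (cons_pair (x, t)).
Proof.
move=> mh h0; rewrite ge0_integral_sfpushforward// ge0_integral_sfproduct1//.
by apply: measurableT_comp => //; exact: measurable_cons_pair.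
Qed.

Lemma ge0_integral_lebesgue_CnS2 n (h : n.+1.-tuple R[i] -> \bar R) :
  measurable_fun setT h -> (forall z, 0 <= h z) ->
  \int[lebesgue_Cn n.+1]_z h z =
  \int[lebesgue_Cn n]_t \int[lebesgue_C]_x h (cons_pair (x, t)).
Proof.
move=> mh h0; rewrite ge0_integral_sfpushforward// ge0_integral_sfproduct2//.
by apply: measurableT_comp => //; exact: measurable_cons_pair.
Qed.

Lemma ge0_integral_lebesgue_C0 (h : 0.-tuple R[i] -> \bar R) :
  measurable_fun setT h -> (forall z, 0 <= h z) ->
  \int[lebesgue_Cn 0]_z h z = h [tuple].
Proof.
by move=> mh h0; rewrite /lebesgue_Cn/= integral_dirac// diracT mul1e.
Qed.

End iterated_integrals.

Section coordinatewise_integration.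
Context {R : realType}.
Local Open Scope ereal_scope.

Definition set_coord n (z : n.-tuple R[i]) (j : 'I_n) (x : R[i]) :=
  [tuple if i == j then x else tnth z i | i < n].

Lemma measurable_set_coord n (z : n.-tuple R[i]) j :
  measurable_fun setT (set_coord z j).
Proof.
apply/measurable_fun_tnthP => i; rewrite /set_coord.
rewrite [X in measurable_fun _ X](_ : _ =
    fun x => if i == j then x else tnth z i); last first.
  by apply/funext => x /=; rewrite tnth_mktuple.
by case: (i == j); [exact: measurable_id|exact: measurable_cst].
Qed.

Lemma set_coord_cons0 n x y (t : n.-tuple R[i]) :
  set_coord (cons_pair (y, t)) ord0 x = cons_pair (x, t).
Proof.
apply: eq_from_tnth => i; rewrite tnth_mktuple.
case: (unliftP ord0 i) => [k ->|->]; last by rewrite eqxx.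
by rewrite eq_sym (negbTE (neq_lift _ _)) !tnthS.
Qed.

Lemma set_coord_consS n x y (t : n.-tuple R[i]) (j : 'I_n) :
  set_coord (cons_pair (y, t)) (lift ord0 j) x = cons_pair (y, set_coord t j x).
Proof.
apply: eq_from_tnth => i; rewrite tnth_mktuple.
case: (unliftP ord0 i) => [k ->|->]; last by rewrite (negbTE (neq_lift _ _)).
by rewrite (inj_eq lift_inj) !tnthS tnth_mktuple.
Qed.

Lemma emeasurable_prod d (T : measurableType d) (D : set T) (I : Type)
    (s : seq I) (P : pred I) (h : I -> T -> \bar R) :
  (forall i, measurable_fun D (h i)) ->
  measurable_fun D (fun x => \prod_(i <- s | P i) h i x).
Proof.
move=> mh; elim: s => [|i s ih].
  by under eq_fun do rewrite big_nil; exact: measurable_cst.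
under eq_fun do rewrite big_cons.
by case: (P i) => //; exact: emeasurable_funM.
Qed.

Lemma measurable_prod_tnth n (P : pred 'I_n) (f : 'I_n -> R[i] -> \bar R) :
  (forall i, measurable_fun setT (f i)) ->
  measurable_fun setT (fun z : n.-tuple R[i] => \prod_(i < n | P i) f i (tnth z i)).
Proof.
move=> mf; apply: emeasurable_prod => i.
by apply: measurableT_comp => //; exact: measurable_tnth.
Qed.

Lemma big_ord_recl_neq0 n (f : 'I_n.+1 -> \bar R) :
  \prod_(i < n.+1 | i != ord0) f i = \prod_(i < n) f (lift ord0 i).
Proof.
by rewrite big_mkcond big_ord_recl/= mul1e; apply: eq_bigr.
Qed.

Lemma big_ord_recl_neq_lift n (f : 'I_n.+1 -> \bar R) (j : 'I_n) :
  \prod_(i < n.+1 | i != lift ord0 j) f i =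
  f ord0 * \prod_(i < n | i != j) f (lift ord0 i).
Proof.
by rewrite big_mkcond big_ord_recl/= [in RHS]big_mkcond.
Qed.

Lemma integral_lebesgue_Cn_prod n (g : 'I_n -> R[i] -> \bar R) :
  (forall i, measurable_fun setT (g i)) -> (forall i x, 0 <= g i x) ->
  \int[lebesgue_Cn n]_z (\prod_(i < n) g i (tnth z i)) =
  \prod_(i < n) \int[lebesgue_C]_x g i x.
Proof.
elim: n g => [|n ih] g mg g0.
  rewrite ge0_integral_lebesgue_C0 ?big_ord0// => [|z]; last by rewrite big_ord0.
  exact: measurable_prod_tnth.
have mprod := measurable_prod_tnth.
rewrite ge0_integral_lebesgue_CnS1//; [|exact: mprod|by move=> z; exact: prode_ge0].
rewrite big_ord_recl -ih//.
transitivity (\int[lebesgue_C]_x (g ord0 x *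
    \int[lebesgue_Cn n]_t \prod_(i < n) g (lift ord0 i) (tnth t i))).
  apply: eq_integral => x _.
  rewrite -ge0_integralZl//; last 2 first.
    by apply: (mprod _ xpredT (fun i => g (lift ord0 i))).
    by move=> t _; exact: prode_ge0.
  apply: eq_integral => t _; rewrite big_ord_recl.
  by under eq_bigr do rewrite tnthS.
by rewrite ge0_integralZr//; apply: integral_ge0 => t _; exact: prode_ge0.
Qed.

(** This is Tonelli's theorem with the coordinate [j] integrated first, wherever it stands in the
    iterated product. The induction peels off leading coordinates until [j] is the head. *)
Lemma le_integral_lebesgue_Cn_coord n (j : 'I_n) (F : n.-tuple R[i] -> \bar R)
    (g : 'I_n -> R[i] -> \bar R) (K : \bar R) :
  measurable_fun setT F -> (forall z, 0 <= F z) -> 0 <= K ->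
  (forall i, measurable_fun setT (g i)) -> (forall i x, 0 <= g i x) ->
  (forall z, \int[lebesgue_C]_x F (set_coord z j x) <=
     K * \prod_(i < n | i != j) g i (tnth z i)) ->
  \int[lebesgue_Cn n]_z F z <=
  K * \prod_(i < n | i != j) \int[lebesgue_C]_x g i x.
Proof.
elim: n j F g K => [[]//|n ih] j F g K mF F0 K0 mg g0.
case: (unliftP ord0 j) => [k ->|->] hF; last first.
  rewrite ge0_integral_lebesgue_CnS2// big_ord_recl_neq0.
  rewrite -integral_lebesgue_Cn_prod// -ge0_integralZl//; last 2 first.
  - by apply: (@measurable_prod_tnth n xpredT (fun i => g (lift ord0 i))).
  - by move=> t _; apply: prode_ge0.
  apply: ge0_le_integral => //.
  - by move=> t _; apply: integral_ge0.
  - apply: (@measurable_fun_fubini_tonelli_G _ _ _ _ _ lebesgue_C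
      (fun x => F (cons_pair x))) => //.
    by apply: measurableT_comp => //; exact: measurable_cons_pair.
  - by apply: measurable_funeM; apply: (@measurable_prod_tnth n xpredT (fun i => g (lift ord0 i))).
  - move=> t _; have := hF (cons_pair (0%R, t)).
    under eq_integral do rewrite set_coord_cons0.
    by rewrite big_ord_recl_neq0; under eq_bigr do rewrite tnthS.
rewrite ge0_integral_lebesgue_CnS1// big_ord_recl_neq_lift.
have P0 : 0 <= \prod_(i < n | i != k) \int[lebesgue_C]_x g (lift ord0 i) x.
  by apply: prode_ge0 => i _; exact: integral_ge0.
rewrite [leRHS]muleCA -ge0_integralZr//; last exact: mule_ge0.
apply: ge0_le_integral => //.
- by move=> t _; apply: integral_ge0.
- apply: (@measurable_fun_fubini_tonelli_F _ _ _ _ _ (lebesgue_Cn n)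
    (fun x => F (cons_pair x))) => //.
  by apply: measurableT_comp => //; exact: measurable_cons_pair.
- by apply: emeasurable_funM => //; exact: measurable_cst.
(* With the leading coordinate frozen at [x], its factor [g ord0 x] joins the constant [K] of the
   induction hypothesis. *)
move=> x _; rewrite [leRHS]muleA; apply: ih => //.
- apply: measurableT_comp => //; apply: measurable_cons => //; exact: measurable_id.
- by rewrite mule_ge0.
move=> t; have := hF (cons_pair (x, t)).
under eq_integral do rewrite set_coord_consS.
rewrite big_ord_recl_neq_lift muleCA -muleA.
by under eq_bigr do rewrite tnthS.
Qed.

End coordinatewise_integration.

(** * Geometry of 1 - <z, w> on the ball *)

Section ball_geometry.
Context {R : realType}.
Local Open Scope complex_scope.
Implicit Types (x y u : R[i]) (b : bool).

(** The boolean index lets the 2n real coordinates of C^n be treated uniformly, and [~~ b] names the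
    other part of the same complex coordinate. *)
Definition part b x : R := if b then complex.Re x else complex.Im x.

Lemma partD b x y : part b (x + y) = part b x + part b y.
Proof. by case: b; case: x y => [a c] [d e]. Qed.

Lemma partB b x y : part b (x - y) = part b x - part b y.
Proof. by case: b; case: x y => [a c] [d e]. Qed.

Lemma normc_sqr x : normc x ^+ 2 = part true x ^+ 2 + part false x ^+ 2.
Proof. by case: x => a c /=; rewrite sqr_sqrtr// addr_ge0 ?sqr_ge0. Qed.

Lemma normc_ge0 x : 0 <= normc x.
Proof. by case: x => a c; rewrite sqrtr_ge0. Qed.

Lemma part_le_normc b x : `|part b x| <= normc x.
Proof.
rewrite -(ler_pXn2r (n := 2)) ?nnegrE ?normc_ge0// normc_sqr real_normK ?num_real//.
by case: b; rewrite ?lerDl ?lerDr sqr_ge0.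
Qed.

Lemma normc_le_part x : normc x <= `|part true x| + `|part false x|.
Proof.
rewrite -(ler_pXn2r (n := 2)) ?nnegrE ?normc_ge0 ?addr_ge0// normc_sqr sqrrD.
by rewrite !real_normK ?num_real// lerD2r lerDl mulrn_wge0.
Qed.

Variable n : nat.
Implicit Types z w a : n.-tuple R[i].

Definition distsq z w : R := \sum_(i < n) normc (tnth z i - tnth w i) ^+ 2.

Lemma part_sum b (I : Type) (s : seq I) (P : pred I) (F : I -> R[i]) :
  part b (\sum_(i <- s | P i) F i) = \sum_(i <- s | P i) part b (F i).
Proof. by apply: big_morph; [exact: partD|case: b]. Qed.

Lemma Re_inner z w : complex.Re (inner z w) =
  \sum_(i < n) (part true (tnth z i) * part true (tnth w i) +
                part false (tnth z i) * part false (tnth w i)).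
Proof.
rewrite -[LHS]/(part true _) part_sum; apply: eq_bigr => i _.
by case: (tnth z i) (tnth w i) => [a c] [d e]/=; rewrite mulrN opprK.
Qed.

Lemma Im_inner z w : complex.Im (inner z w) =
  \sum_(i < n) (part false (tnth z i) * part true (tnth w i) -
                part true (tnth z i) * part false (tnth w i)).
Proof.
rewrite -[LHS]/(part false _) part_sum; apply: eq_bigr => i _.
by case: (tnth z i) (tnth w i) => [a c] [d e]/=; rewrite mulrN addrC.
Qed.

Lemma distsqE z w :
  distsq z w = normsq z + normsq w - complex.Re (inner z w) *+ 2.
Proof.
rewrite Re_inner -sumrMnl -!big_split -sumrB /=; apply: eq_bigr => i _.
by rewrite !normc_sqr !partB; ring.
Qed.

Lemma normsq_ge0 z : 0 <= normsq z.
Proof. by apply: sumr_ge0 => i _; exact: sqr_ge0. Qed.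

Lemma distsq_ge0 z w : 0 <= distsq z w.
Proof. by apply: sumr_ge0 => i _; exact: sqr_ge0. Qed.

Lemma part_le_distsq b z w i :
  (part b (tnth z i) - part b (tnth w i)) ^+ 2 <= distsq z w.
Proof.
rewrite -partB -real_normK ?num_real// /distsq (bigD1 i)//=.
apply: (le_trans (y := normc (tnth z i - tnth w i) ^+ 2)).
  by rewrite ler_pXn2r ?nnegrE ?normc_ge0// part_le_normc.
by rewrite lerDl sumr_ge0// => j _; exact: sqr_ge0.
Qed.

Lemma part_le_normsq b z i : part b (tnth z i) ^+ 2 <= normsq z.
Proof.
rewrite -real_normK ?num_real// /normsq (bigD1 i)//=.
apply: (le_trans (y := normc (tnth z i) ^+ 2)).
  by rewrite ler_pXn2r ?nnegrE ?normc_ge0// part_le_normc.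
by rewrite lerDl sumr_ge0// => j _; exact: sqr_ge0.
Qed.

(** By polarization. All three summands are nonnegative on the ball, hence each of |z - w|^2, V(z),
    V(w) is at most 2 D. *)
Lemma Re_1B_inner z w : complex.Re (1 - inner z w) =
  (distsq z w + (1 - normsq z) + (1 - normsq w)) / 2.
Proof.
rewrite -[LHS]/(part true _) partB distsqE /=.
by rewrite -mulr_natr; field.
Qed.

Lemma Re_innerC z w : complex.Re (inner z w) = complex.Re (inner w z).
Proof. by rewrite !Re_inner; apply: eq_bigr => i _; ring. Qed.

Lemma Im_innerC z w : complex.Im (inner z w) = - complex.Im (inner w z).
Proof. by rewrite !Im_inner -sumrN; apply: eq_bigr => i _; ring. Qed.

Lemma normc_1B_innerC z w : normc (1 - inner z w) = normc (1 - inner w z).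
Proof.
apply/eqP; rewrite -(eqrXn2 (n := 2)) ?normc_ge0// !normc_sqr !partB /=.
by rewrite Re_innerC Im_innerC !sub0r opprK sqrrN.
Qed.

Lemma Re_1B_inner_le_normc z w : complex.Re (1 - inner z w) <= normc (1 - inner z w).
Proof. exact: le_trans (ler_norm _) (part_le_normc true _). Qed.

Section in_ball.
Variables z w : n.-tuple R[i].
Hypotheses (zB : unit_ball n z) (wB : unit_ball n w).
Local Notation D := (normc (1 - inner z w)).

Lemma distsq_le_normc : distsq z w <= 2 * D.
Proof.
have := Re_1B_inner_le_normc z w; rewrite Re_1B_inner.
by move: zB wB; rewrite /unit_ball /= => ? ?; lra.
Qed.

Lemma onemB_normsq_le_normc : 1 - normsq z <= 2 * D.
Proof.
have := Re_1B_inner_le_normc z w; rewrite Re_1B_inner.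
by have := distsq_ge0 z w; move: zB wB; rewrite /unit_ball /= => ? ?; lra.
Qed.

Lemma normc_1B_inner_gt0 : 0 < D.
Proof.
by have := onemB_normsq_le_normc; move: zB; rewrite /unit_ball /= => ? ?; lra.
Qed.

Lemma normc_inner_le1 : normc (inner z w) <= 1.
Proof.
apply: (@le_trans _ _ ((normsq z + normsq w) / 2)); last first.
  by move: zB wB; rewrite /unit_ball /= => ? ?; lra.
rewrite /normsq -big_split mulr_suml /=.
apply: (big_ind2 (fun u (r : R) => normc u <= r)) => [|u r v t ur vt|i _].
- by rewrite normc0.
- by rewrite (le_trans (le_normcD _ _))// lerD.
have -> (x : R[i]) (y : R[i]) : normc (x * y^*) = normc x * normc y.
  by rewrite normcM; congr (_ * _); case: y => a c /=; rewrite sqrrN.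
have := sqr_ge0 (normc (tnth z i) - normc (tnth w i)); lra.
Qed.

Lemma normc_1B_inner_le2 : D <= 2.
Proof.
have := le_normcD 1 (- inner z w); rewrite normcN normc1.
by move=> /le_trans; apply; rewrite -[leRHS](@natrD _ 1 1) lerD2l normc_inner_le1.
Qed.

End in_ball.

End ball_geometry.

Section measurability.
Context {R : realType}.
Local Open Scope complex_scope.

Lemma measurable_part b : measurable_fun setT (@part R b).
Proof.
have m := @measurable_complex_pair R.
case: b.
  by rewrite (_ : part true = fst \o (@complex_pair R))//; exact: measurableT_comp.
by rewrite (_ : part false = snd \o (@complex_pair R))//; exact: measurableT_comp.
Qed.

Lemma measurable_fun_part d (T : measurableType d) (D : set T) (f : T -> R[i]) b :
  measurable_fun D f -> measurable_fun D (part b \o f).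
Proof. exact: measurableT_comp (measurable_part b). Qed.

Lemma measurable_complexP d (T : measurableType d) (f : T -> R[i]) :
  measurable_fun setT f <-> (forall b, measurable_fun setT (part b \o f)).
Proof.
split=> [mf b|mf]; first exact: measurable_fun_part.
rewrite (_ : f = (@pair_complex R) \o (fun x => (part true (f x), part false (f x)))).
  apply: (measurableT_comp (@measurable_pair_complex R)).
  by apply: measurable_fun_pair; [exact: mf true|exact: mf false].
by apply/funext => x /=; case: (f x).
Qed.

Lemma measurable_normc : measurable_fun setT (@normc R).
Proof.
rewrite (_ : @normc R = fun x => Num.sqrt (part true x ^+ 2 + part false x ^+ 2)).
  apply: (@measurableT_comp _ _ _ _ _ _ (@Num.sqrt R)).
    by apply: continuous_measurable_fun; exact: sqrt_continuous.
  by apply: measurable_funD; apply: measurable_funX; exact: measurable_part.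
by apply/funext => -[].
Qed.

Variable n : nat.
Let CC := (n.-tuple R[i] * n.-tuple R[i])%type.

Lemma measurable_inner : measurable_fun setT (fun zw : CC => inner zw.1 zw.2).
Proof.
have m1 b i : measurable_fun setT (fun zw : CC => part b (tnth zw.1 i)).
  apply: (measurableT_comp (measurable_part b)).
  by apply: (measurableT_comp (measurable_tnth i)).
have m2 b i : measurable_fun setT (fun zw : CC => part b (tnth zw.2 i)).
  apply: (measurableT_comp (measurable_part b)).
  by apply: (measurableT_comp (measurable_tnth i)).
apply/measurable_complexP => -[].
  rewrite (_ : _ \o _ = fun zw : CC => \sum_(i < n)
    (part true (tnth zw.1 i) * part true (tnth zw.2 i) +
     part false (tnth zw.1 i) * part false (tnth zw.2 i))).
    by apply: measurable_sum => i; apply: measurable_funD; exact: measurable_funM.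
  by apply/funext => -[z w] /=; exact: Re_inner.
rewrite (_ : _ \o _ = fun zw : CC => \sum_(i < n)
    (part false (tnth zw.1 i) * part true (tnth zw.2 i) -
     part true (tnth zw.1 i) * part false (tnth zw.2 i))).
  by apply: measurable_sum => i; apply: measurable_funB; exact: measurable_funM.
by apply/funext => -[z w] /=; exact: Im_inner.
Qed.

Lemma measurable_1B_inner : measurable_fun setT (fun zw : CC => 1 - inner zw.1 zw.2).
Proof.
apply/measurable_complexP => b.
rewrite (_ : _ \o _ = fun zw : CC => part b 1 - part b (inner zw.1 zw.2)).
  by apply: measurable_funB => //; exact: measurable_fun_part measurable_inner.
by apply/funext => zw /=; rewrite partB.
Qed.

Lemma measurable_normc_1B_inner :
  measurable_fun setT (fun zw : CC => normc (1 - inner zw.1 zw.2)).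
Proof. exact: measurableT_comp measurable_normc measurable_1B_inner. Qed.

Lemma measurable_normc_1B_inner1 w :
  measurable_fun setT (fun z : n.-tuple R[i] => normc (1 - inner z w)).
Proof.
apply: (measurableT_comp measurable_normc_1B_inner (g := fun z => (z, w))).
exact: measurable_pair2.
Qed.

End measurability.

(** * Negative powers of D and V bounded by spikes of coordinates *)

Section pointwise_bounds.
Context {R : realType}.
Implicit Types theta c d x y V : R.

Lemma powRN_le x y theta : 0 <= theta -> 0 < x -> x <= y ->
  y `^ (- theta) <= x `^ (- theta).
Proof.
move=> th0 x0 xy; have y0 := lt_le_trans x0 xy.
rewrite (powRN y) (powRN x) lef_pV2 ?posrE ?powR_gt0//.
by apply: ge0_ler_powR; rewrite ?nnegrE// ltW.
Qed.

(* Here [V + x ^+ 2 <= 1] and [V = r ^+ 2 - x ^+ 2] with [r] the radius of the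
   slice of the ball. *)
Lemma slice_weight_le_spike theta (c1 : R) c x V : 0 <= theta -> 0 < V ->
  V + x ^+ 2 <= 1 -> 0 < c -> c <= c1 -> c <= 2^-1 ->
  c1 <= `|x| \/ 2^-1 <= V ->
  ((V `^ (- theta))%:E <= (2 `^ theta)%:E *
     (spike theta (c * (x - Num.sqrt (V + x ^+ 2))) +
      spike theta (c * (x - - Num.sqrt (V + x ^+ 2)))))%E.
Proof.
move=> th0 V0 V1 c0 cc1 c12; set r := Num.sqrt _.
have r0 : 0 <= r by exact: sqrtr_ge0.
have r2 : r ^+ 2 = V + x ^+ 2 by rewrite sqr_sqrtr// addr_ge0 ?sqr_ge0// ltW.
have Vle1 : V <= 1 by have := sqr_ge0 x; lra.
have xr : `|x| <= r.
  by rewrite -(ler_pXn2r (n := 2)) ?nnegrE// real_normK ?num_real// r2 lerDr ltW.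
have r1 : r <= 1 by rewrite -(ler_pXn2r (n := 2)) ?nnegrE// r2 expr1n.
have p0 : 0 <= 2 `^ theta :> R by exact: powR_ge0.
case=> [c1x|hV].
  (* V factors as (r - |x|)(r + |x|) and the second factor is at least [c1], so V dominates a
     multiple of the distance from x to the nearer end of the slice. *)
  have cV : c * (r - `|x|) <= V.
    have -> : V = (r - `|x|) * (r + `|x|).
      by rewrite -subr_sqr r2 real_normK ?num_real// addrK.
    by rewrite mulrC ler_wpM2l ?subr_ge0// (le_trans cc1)// (le_trans c1x)// lerDr.
  have : (`|c * (x - r)| <= V) \/ (`|c * (x - - r)| <= V).
    rewrite !normrM (gtr0_norm c0) opprK.
    have [x0|x0] := leP 0 x; [left|right].
      by rewrite (ger0_norm x0) in xr cV *; rewrite distrC ger0_norm ?subr_ge0.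
    rewrite (ltr0_norm x0) in xr cV *; rewrite ger0_norm; last lra.
    by rewrite addrC; move: cV; rewrite opprK.
  case=> hx; have := powRN_le_spike th0 _ hx; rewrite V0 Vle1 => /(_ isT) /le_trans;
    apply; rewrite lee_wpmul2l ?lee_fin// ?leeDl ?leeDr// spike_ge0//.
apply: (@le_trans _ _ ((2 `^ theta)%:E * 1)%E).
  rewrite mule1 lee_fin.
  apply: le_trans (powRN_le th0 _ hV) _; first by lra.
  by rewrite -[2^-1 as X in X `^ _]powR_inv1// -powRrM mulN1r opprK.
rewrite lee_wpmul2l ?lee_fin//.
apply: (@le_trans _ _ (spike theta (c * (x - r)))); last by rewrite leeDl// spike_ge0.
apply: spike_ge1; rewrite normrM (gtr0_norm c0).
have : `|x - r| <= 2 by rewrite ler_norml; move: xr; rewrite ler_norml => /andP[]; lra.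
by move=> h; rewrite (le_trans (ler_wpM2l (ltW c0) h))//; lra.
Qed.

(** With r = sqrt (d / 2), d^-theta <= r^-theta * r^-theta and both |c x| and |c y| are at most r:
    each of the two real coordinates takes one factor. *)
Lemma tangential_le_spike theta c d x y : 0 <= theta -> 0 < d -> d <= 2 ->
  0 < c -> c <= 2^-1 -> x ^+ 2 <= 2 * d -> y ^+ 2 <= 2 * d ->
  ((d `^ (- theta))%:E <= (2 `^ theta * 2 `^ theta)%:E *
     (spike theta (c * x) * spike theta (c * y)))%E.
Proof.
move=> th0 d0 d2 c0 c12 xd yd; set r := Num.sqrt (d / 2).
have r0 : 0 < r by rewrite sqrtr_gt0 divr_gt0.
have r2 : r ^+ 2 = d / 2 by rewrite sqr_sqrtr// divr_ge0// ltW.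
have r1 : r <= 1.
  by rewrite -(ler_pXn2r (n := 2)) ?nnegrE ?(ltW r0)// r2 expr1n; lra.
have cr t : t ^+ 2 <= 2 * d -> `|c * t| <= r.
  move=> td; rewrite -(ler_pXn2r (n := 2)) ?nnegrE ?(ltW r0)//.
  rewrite real_normK ?num_real// r2 exprMn.
  have c2 : c ^+ 2 <= 4^-1.
    have -> : 4^-1 = 2^-1 ^+ 2 :> R by field.
    by rewrite ler_pXn2r ?nnegrE// ltW.
  by apply: (le_trans (ler_pM (sqr_ge0 _) (sqr_ge0 _) c2 td)); lra.
have rr : d `^ (- theta) <= r `^ (- theta) * r `^ (- theta).
  rewrite -powRM ?(ltW r0)// -expr2; apply: powRN_le => //.
    by rewrite exprn_gt0.
  by rewrite r2; lra.
have hr : 0 < r <= 1 by rewrite r0.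
have := powRN_le_spike th0 hr (cr _ xd); have := powRN_le_spike th0 hr (cr _ yd).
move=> hy hx; apply: (@le_trans _ _ ((r `^ (- theta))%:E * (r `^ (- theta))%:E)%E).
  by rewrite -EFinM lee_fin.
apply: (le_trans (lee_pmul _ _ hx hy)); rewrite ?lee_fin ?powR_ge0//.
by rewrite EFinM muleACA.
Qed.

(** Below [del] the spike at [y0] is used. Above it d^-theta is bounded by a constant, and the spike
    centred at 0 is at least 1. *)
Lemma normal_le_spike theta c d (del y0 : R) y : 0 <= theta -> 0 < d ->
  0 < del -> del <= 1 -> `|c * y| <= 1 -> (d < del -> `|c * (y - y0)| <= d) ->
  ((d `^ (- theta))%:E <= (del `^ (- theta) + 2 `^ theta)%:E *
     (spike theta (c * (y - y0)) + spike theta (c * (y - 0))))%E.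
Proof.
move=> th0 d0 del0 del1 cy h; rewrite subr0.
have [ddel|ddel] := ltP d del.
  have := powRN_le_spike th0 _ (h ddel); rewrite d0 (le_trans (ltW ddel) del1).
  move=> /(_ isT)/le_trans; apply; apply: lee_pmul => //.
  - exact: spike_ge0.
  - by rewrite lee_fin lerDr powR_ge0.
  - by rewrite leeDl// spike_ge0.
apply: (@le_trans _ _ ((del `^ (- theta) + 2 `^ theta)%:E * 1)%E).
  by rewrite mule1 lee_fin (le_trans (powRN_le th0 del0 ddel))// lerDl powR_ge0.
rewrite lee_wpmul2l ?lee_fin ?addr_ge0 ?powR_ge0//.
by rewrite (le_trans (spike_ge1 theta cy))// leeDr// spike_ge0.
Qed.

End pointwise_bounds.

(** * Slices of the ball along one complex coordinate *)

Section slices.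
Context {R : realType}.
Local Open Scope complex_scope.
Variable n : nat.
Implicit Types (z w : n.-tuple R[i]) (j : 'I_n) (b : bool) (x : R[i]) (theta : R).

Definition inner_off j z w : R[i] :=
  \sum_(i < n | i != j) tnth z i * (tnth w i)^*.

Definition normsq_off j z : R := \sum_(i < n | i != j) normc (tnth z i) ^+ 2.

(** As a function of z_j, 1 - <z, w> is affine, with zero (1 - inner_off) / conj w_j = (1 -
    inner_off) w_j / |w_j|^2. This is one real coordinate of that zero. *)
Definition slice_center b j z w : R :=
  part b ((1 - inner_off j z w) * tnth w j) / normc (tnth w j) ^+ 2.

(** This is where the real line in direction ([j], [b]) leaves the ball. Only [part (~~ b) x]
    enters, so it is constant while [part b x] is integrated. *)
Definition slice_radius b j z x : R :=
  Num.sqrt (1 - normsq_off j z - part (~~ b) x ^+ 2).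

Lemma slice_center_set_coord b j z w x :
  slice_center b j (set_coord z j x) w = slice_center b j z w.
Proof.
congr (part _ ((1 - _) * _) / _); apply: eq_bigr => i ij.
by rewrite tnth_mktuple (negbTE ij).
Qed.

Lemma slice_radius_set_coord b j z x y :
  slice_radius b j (set_coord z j x) y = slice_radius b j z y.
Proof.
congr (Num.sqrt (1 - _ - _)); apply: eq_bigr => i ij.
by rewrite tnth_mktuple (negbTE ij).
Qed.

Lemma slice_radiusE b j z : slice_radius b j z (tnth z j) =
  Num.sqrt ((1 - normsq z) + part b (tnth z j) ^+ 2).
Proof.
rewrite /slice_radius /normsq (bigD1 j)//= normc_sqr; congr Num.sqrt.
by rewrite /normsq_off; case: b => /=; ring.
Qed.

(** Multiplying 1 - <z, w> by w_j turns the coefficient of z_j into the real number -|w_j|^2, which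
    separates the real and imaginary parts of z_j. For w_j = 0 the division by zero is harmless, the
    left side being 0. *)
Lemma slice_center_dist b j z w :
  normc (tnth w j) * `|part b (tnth z j) - slice_center b j z w| <=
  normc (1 - inner z w).
Proof.
have [->|w0] := eqVneq (normc (tnth w j)) 0; first by rewrite mul0r normc_ge0.
have w0' : 0 < normc (tnth w j) by rewrite lt_def w0 normc_ge0.
have : `|part b ((1 - inner z w) * tnth w j)| <= normc (1 - inner z w) * normc (tnth w j).
  by rewrite -normcM part_le_normc.
have -> : part b ((1 - inner z w) * tnth w j) =
    part b ((1 - inner_off j z w) * tnth w j) -
    part b (tnth z j) * normc (tnth w j) ^+ 2.
  rewrite /inner (bigD1 j)//= -/(inner_off j z w) opprD addrA addrAC mulrBl partB.
  congr (_ - _); rewrite normc_sqr.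
  by case: (tnth z j) (tnth w j) => [a e] [f g]; case: b => /=; ring.
rewrite -ler_pdivrMr//; apply: le_trans.
rewrite ler_pdivlMr// mulrAC -expr2 -[X in X * _]ger0_norm ?sqr_ge0// -normrM.
rewrite distrC mulrBr le_eqVlt; apply/orP; left; apply/eqP; congr `|_|.
by rewrite /slice_center [X in X - _]mulrC; congr (_ - _); rewrite mulrC divfK// expf_neq0.
Qed.

Definition tangential theta c (w x : R[i]) : \bar R :=
  (spike theta (c * (part true x - part true w)) *
   spike theta (c * (part false x - part false w)))%E.

(** [part (~~ b)] carries the linear vanishing of 1 - <z, w>, with the extra spike at 0 for D
    bounded below; [part b] carries V, which vanishes at both ends of the slice. *)
Definition transversal theta c b j z w x : \bar R :=
  ((spike theta (c * (part (~~ b) x - slice_center (~~ b) j z w)) +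
    spike theta (c * (part (~~ b) x - 0))) *
   (spike theta (c * (part b x - slice_radius b j z x)) +
    spike theta (c * (part b x - - slice_radius b j z x))))%E.

Lemma tangential_ge0 theta c (w x : R[i]) : (0 <= tangential theta c w x)%E.
Proof. by rewrite mule_ge0 ?spike_ge0. Qed.

Lemma transversal_ge0 theta c b j z w x : (0 <= transversal theta c b j z w x)%E.
Proof. by rewrite mule_ge0 ?adde_ge0 ?spike_ge0. Qed.

Lemma measurable_tangential theta c (w : R[i]) :
  measurable_fun setT (tangential theta c w).
Proof.
have m b : measurable_fun setT (fun x : R[i] => spike theta (c * (part b x - part b w))).
  exact: (measurableT_comp (measurable_spike_affine theta c _) (measurable_part b)).
exact: emeasurable_funM.
Qed.

Lemma measurable_transversal theta c b j z w :
  measurable_fun setT (transversal theta c b j z w).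
Proof.
have mr : measurable_fun setT (fun x => slice_radius b j z x).
  apply: (@measurableT_comp _ _ _ _ _ _ (@Num.sqrt R)).
    by apply: continuous_measurable_fun; exact: sqrt_continuous.
  by apply: measurable_funB => //; apply: measurable_funX; exact: measurable_part.
have mp : forall b, measurable_fun setT (part (R:=R) b) := @measurable_part R.
apply: emeasurable_funM; apply: emeasurable_funD.
- exact: (measurableT_comp (measurable_spike_affine theta c _) (mp (~~ b))).
- exact: (measurableT_comp (measurable_spike_affine theta c _) (mp (~~ b))).
- apply: (measurableT_comp (measurable_spike theta)).
  by apply: measurable_funM => //; exact: measurable_funB.
- apply: (measurableT_comp (measurable_spike theta)).
  apply: measurable_funM => //; apply: measurable_funB => //.
  exact: measurableT_comp mr.
Qed.

(** [part b] has to be the inner variable, because the centres of its spikes depend on the other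
    part; hence both orders of Tonelli's theorem occur. *)
Lemma integral_lebesgue_C_le b (h : R -> \bar R) (k : R -> R -> \bar R)
    (F : R[i] -> \bar R) (A B : \bar R) :
  measurable_fun setT F -> measurable_fun setT h ->
  (forall y, measurable_fun setT (k y)) ->
  (forall y, 0 <= h y)%E -> (forall y (x : R), 0 <= k y x)%E -> (0 <= B)%E ->
  (forall x : R[i], F x = h (part (~~ b) x) * k (part (~~ b) x) (part b x))%E ->
  (\int[@lebesgue_measure R]_y h y <= A)%E ->
  (forall y, \int[@lebesgue_measure R]_x k y x <= B)%E ->
  (\int[lebesgue_C]_x F x <= A * B)%E.
Proof.
move=> mF mh mk h0 k0 B0 FE hA kB.
have F0 x : (0 <= F x)%E by rewrite FE mule_ge0.
have mpair := measurableT_comp mF (@measurable_pair_complex R).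
apply: (@le_trans _ _ (\int[@lebesgue_measure R]_y (h y * B))%E); last first.
  by rewrite ge0_integralZr// lee_wpmul2r.
have mhB : measurable_fun setT (fun y => h y * B)%E.
  by apply: emeasurable_funM => //; exact: measurable_cst.
case: b FE => FE.
  rewrite ge0_integral_lebesgue_C2//; apply: ge0_le_integral => //.
  - by move=> y _; apply: integral_ge0.
  - by apply: (@measurable_fun_fubini_tonelli_G _ _ _ _ _
      (@lebesgue_measure R) (F \o @pair_complex R)) => // x; exact: F0.
  - move=> y _; rewrite (_ : (\int[_]_x _ = h y * \int[@lebesgue_measure R]_x k y x)%E).
      by rewrite lee_wpmul2l.
    transitivity (\int[@lebesgue_measure R]_x (h y * k y x))%E.
      by apply: eq_integral => x _; rewrite FE.
    by apply: ge0_integralZl => //; exact: mk.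
rewrite ge0_integral_lebesgue_C1//; apply: ge0_le_integral => //.
- by move=> y _; apply: integral_ge0.
- by apply: (@measurable_fun_fubini_tonelli_F _ _ _ _ _
      (@lebesgue_measure R) (F \o @pair_complex R)) => // x; exact: F0.
- move=> y _; rewrite (_ : (\int[_]_x _ = h y * \int[@lebesgue_measure R]_x k y x)%E).
    by rewrite lee_wpmul2l.
  transitivity (\int[@lebesgue_measure R]_x (h y * k y x))%E.
    by apply: eq_integral => x _; rewrite FE.
  by apply: ge0_integralZl => //; exact: mk.
Qed.

Lemma integral_tangential theta : theta < 1 -> exists2 K : R, 0 <= K &
  forall c (w : R[i]), 0 < c ->
  (\int[lebesgue_C]_x tangential theta c w x <= ((K / c) ^+ 2)%:E)%E.
Proof.
move=> th1; have [K K0 hK] := integral_spike th1; exists K => // c w c0.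
rewrite expr2 EFinM; apply: (@integral_lebesgue_C_le false
  (fun y => spike theta (c * (y - part true w)))
  (fun _ t => spike theta (c * (t - part false w)))) => //.
- exact: measurable_tangential.
- exact: measurable_spike_affine.
- by move=> _; exact: measurable_spike_affine.
- by move=> y; exact: spike_ge0.
- by move=> _ y; exact: spike_ge0.
- by rewrite lee_fin divr_ge0// ltW.
- exact: hK.
- by move=> _; exact: hK.
Qed.

Lemma integral_transversal theta : theta < 1 -> exists2 K : R, 0 <= K &
  forall c b j z w, 0 < c ->
  (\int[lebesgue_C]_x transversal theta c b j z w x <= ((K / c) ^+ 2)%:E)%E.
Proof.
move=> th1; have [K K0 hK] := integral_spike th1.
exists (2 * K); first by rewrite mulr_ge0.
move=> c b j z w c0.
have h2 (x y : R) : (\int[@lebesgue_measure R]_t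
    (spike theta (c * (t - x)) + spike theta (c * (t - y))) <= (2 * K / c)%:E)%E.
  rewrite ge0_integralD//; last 4 first.
  - by move=> t _; exact: spike_ge0.
  - exact: measurable_spike_affine.
  - by move=> t _; exact: spike_ge0.
  - exact: measurable_spike_affine.
  by rewrite -mulrA mulr_natl mulr2n EFinD leeD// hK.
rewrite expr2 EFinM; apply: (@integral_lebesgue_C_le b
  (fun y => spike theta (c * (y - slice_center (~~ b) j z w)) + spike theta (c * (y - 0)))%E
  (fun y t => spike theta (c * (t - Num.sqrt (1 - normsq_off j z - y ^+ 2))) +
     spike theta (c * (t - - Num.sqrt (1 - normsq_off j z - y ^+ 2))))%E) => //.
- exact: measurable_transversal.
- by apply: emeasurable_funD; exact: measurable_spike_affine.
- by move=> y; apply: emeasurable_funD; exact: measurable_spike_affine.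
- by move=> y; rewrite adde_ge0 ?spike_ge0.
- by move=> y x; rewrite adde_ge0 ?spike_ge0.
- by rewrite lee_fin divr_ge0 ?(ltW c0)// mulr_ge0.
Qed.

End slices.

Lemma lee_prod (R : realDomainType) (I : Type) (s : seq I) (P : pred I)
    (f g : I -> \bar R) :
  (forall i, P i -> (0 <= f i <= g i)%E) ->
  (\prod_(i <- s | P i) f i <= \prod_(i <- s | P i) g i)%E.
Proof.
move=> h; suff /andP[] : (0 <= \prod_(i <- s | P i) f i <= \prod_(i <- s | P i) g i)%E by [].
apply: (big_ind2 (fun x y => 0 <= x <= y)%E) => [|x y u v /andP[x0 xy] /andP[u0 uv]|//].
  by rewrite lee01 lexx.
by rewrite mule_ge0//= lee_pmul.
Qed.

(** * The integral of the singular kernel *)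

Section singular_kernel.
Context {R : realType}.
Variable n : nat.
Implicit Types (z w : n.-tuple R[i]) (j : 'I_n) (b : bool) (theta : R).
Local Notation D z w := (normc (1 - inner z w)).

(* If [b < n + 1 + alpha], then [D^-b (1 - |z|^2)^alpha] is at most a constant
   times this kernel for some [theta < 1]. *)
Definition singular_kernel theta z w : R :=
  (D z w `^ (- theta)) ^+ n * (1 - normsq z) `^ (- theta).

Lemma singular_kernel_ge0 theta z w : 0 <= singular_kernel theta z w.
Proof. by rewrite mulr_ge0 ?exprn_ge0 ?powR_ge0. Qed.

Lemma measurable_singular_kernel theta w :
  measurable_fun setT (fun z => singular_kernel theta z w).
Proof.
apply: measurable_funM.
  apply: measurable_funX; apply: (measurableT_comp (measurable_powR _)).
  exact: measurable_normc_1B_inner1.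
apply: (measurableT_comp (measurable_powR _)).
by apply: measurable_funB => //; exact: measurable_normsq.
Qed.

(* A lower bound for the largest real coordinate of a point of norm at least
   [sqrt (1 / 2)]. *)
Let c1 : R := Num.sqrt (4 * n%:R)^-1.
(** If D < [del], then V <= 2 D < 1/2, so a big coordinate of z is at least [c1] in absolute value,
    and |z - w| <= c1 / 2, so the same coordinate of w is at least c1 / 2. Then |w_j| >= [c], as
    [slice_center_dist] requires. *)
Let c : R := c1 / 4.
Let del : R := c1 ^+ 2 / 8.

Definition big_coord b j z : bool := (c1 <= `|part b (tnth z j)|) || (2^-1 <= 1 - normsq z).

Hypothesis n_gt0 : (0 < n)%N.

Let c1_sqr : c1 ^+ 2 = (4 * n%:R)^-1.
Proof. by rewrite sqr_sqrtr// invr_ge0 mulr_ge0. Qed.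

Let c1_sqr_le : 4 * c1 ^+ 2 <= 1.
Proof.
rewrite c1_sqr invfM mulrA divff ?pnatr_eq0// mul1r invf_le1 ?ltr0n//.
by rewrite ler1n.
Qed.

Let c1_gt0 : 0 < c1.
Proof. by rewrite sqrtr_gt0 invr_gt0 mulr_gt0 ?ltr0n. Qed.

Let c1_le : 2 * c1 <= 1.
Proof.
rewrite -(ler_pXn2r (n := 2)) ?nnegrE ?mulr_ge0 ?(ltW c1_gt0)// exprMn expr1n.
by apply: le_trans c1_sqr_le; rewrite -natrX.
Qed.

(** If all 2n real coordinates are below [c1], then |z|^2 <= 2 n c1^2 = 1/2 and the second
    alternative holds. *)
Lemma exists_big_coord z : exists b j, big_coord b j z.
Proof.
apply/not_existsP => h.
have lt_c1 b j : part b (tnth z j) ^+ 2 < c1 ^+ 2.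
  rewrite -real_normK ?num_real// ltr_pXn2r ?nnegrE ?(ltW c1_gt0)//.
  rewrite ltNge; apply/negP => hc; apply: (h b); exists j.
  by rewrite /big_coord hc.
have : normsq z <= \sum_(j < n) (c1 ^+ 2 + c1 ^+ 2).
  by apply: ler_sum => j _; rewrite normc_sqr ltW// ltrD.
rewrite sumr_const card_ord -mulr_natr c1_sqr => hz.
apply: (h true); exists (Ordinal n_gt0); apply/orP; right.
have n0 : n%:R != 0 :> R by rewrite pnatr_eq0 -lt0n.
have : ((4 * n%:R)^-1 + (4 * n%:R)^-1) * n%:R = 2^-1 :> R by field.
by move: hz => /[swap] ->; lra.
Qed.

(** Of the n factors D^-theta, one goes to each complex coordinate other than [j] and the last one
    to [part (~~ b)] of coordinate [j]; V^-theta goes to [part b]. *)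
Lemma singular_kernel_le theta b j z w : 0 <= theta ->
  unit_ball n z -> unit_ball n w -> big_coord b j z ->
  ((singular_kernel theta z w)%:E <=
   ((del `^ (- theta) + 2 `^ theta) * 2 `^ theta)%:E *
   \prod_(i < n | i != j) ((2 `^ theta * 2 `^ theta)%:E *
      tangential theta c (tnth w i) (tnth z i)) *
   transversal theta c b j z w (tnth z j))%E.
Proof.
move=> th0 zB wB; rewrite /big_coord -/c1.
have cE : c = c1 / 4 by []; have delE : del = c1 ^+ 2 / 8 by [].
have c1le := c1_le; have c1sqr := c1_sqr_le; have c10 := c1_gt0.
clear c1_sqr; clearbody c del c1 => hb.
have D0 := normc_1B_inner_gt0 zB wB; have D2 := normc_1B_inner_le2 zB wB.
have V0 : 0 < 1 - normsq z by rewrite subr_gt0.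
have VD := onemB_normsq_le_normc zB wB.
have dD := distsq_le_normc zB wB.
have c0 : 0 < c by rewrite cE divr_gt0.
have cc1 : c <= c1 by rewrite cE; lra.
have c2 : c <= 2^-1 by lra.
have hX (i : 'I_n) : ((D z w `^ (- theta))%:E <= (2 `^ theta * 2 `^ theta)%:E *
    tangential theta c (tnth w i) (tnth z i))%E.
  by apply: tangential_le_spike => //; apply: le_trans dD; exact: part_le_distsq.
have part1 b' i (z' : n.-tuple R[i]) : unit_ball n z' -> `|part b' (tnth z' i)| <= 1.
  move=> zB'; rewrite -(ler_pXn2r (n := 2)) ?nnegrE// real_normK ?num_real//.
  by rewrite expr1n (le_trans (part_le_normsq b' z' i))// ltW.
have hV : (((1 - normsq z) `^ (- theta))%:E <= (2 `^ theta)%:E *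
    (spike theta (c * (part b (tnth z j) - slice_radius b j z (tnth z j))) +
     spike theta (c * (part b (tnth z j) - - slice_radius b j z (tnth z j)))))%E.
  rewrite slice_radiusE; apply: (slice_weight_le_spike (c1 := c1)) => //.
    by rewrite -addrA gerDl addrC subr_le0 part_le_normsq.
  by apply/orP.
have hY : ((D z w `^ (- theta))%:E <= (del `^ (- theta) + 2 `^ theta)%:E *
    (spike theta (c * (part (~~ b) (tnth z j) - slice_center (~~ b) j z w)) +
     spike theta (c * (part (~~ b) (tnth z j) - 0))))%E.
  apply: normal_le_spike => //.
  - by rewrite delE divr_gt0// exprn_gt0.
  - by lra.
  - by rewrite normrM (gtr0_norm c0) mulr_ile1// ?(ltW c0)// ?part1//; lra.
  move=> Ddel; have cb : c1 <= `|part b (tnth z j)|.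
    by case/orP: hb => //; lra.
  have : c1 / 2 <= `|part b (tnth w j)|.
    have : `|part b (tnth z j) - part b (tnth w j)| <= c1 / 2.
      rewrite -(ler_pXn2r (n := 2)) ?nnegrE ?divr_ge0 ?(ltW c1_gt0)//.
      rewrite real_normK ?num_real// (le_trans (part_le_distsq b z w j))//.
      by rewrite (le_trans dD)// expr_div_n; lra.
    by have := lerB_dist (part b (tnth z j)) (part b (tnth w j)); lra.
  move=> /le_trans/(_ (part_le_normc b (tnth w j))) cw.
  apply: le_trans (slice_center_dist (~~ b) j z w).
  by rewrite normrM (gtr0_norm c0) ler_wpM2r//; lra.
have -> : ((singular_kernel theta z w)%:E = (\prod_(i < n | i != j) (D z w `^ (- theta))%:E) *
    ((D z w `^ (- theta))%:E * ((1 - normsq z) `^ (- theta))%:E))%E.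
  rewrite prodEFin -!EFinM; congr EFin; rewrite /singular_kernel.
  have powE (x : R) : x ^+ n = x * \prod_(i < n | i != j) x.
    by rewrite -[in LHS](card_ord n) -prodr_const (bigD1 j).
  by rewrite powE mulrCA mulrA.
rewrite /transversal [leRHS]muleAC [leRHS]muleC.
rewrite (EFinM (del `^ (- theta) + 2 `^ theta)) [X in (_ <= _ * X)%E]muleACA.
apply: lee_pmul.
- by rewrite prode_ge0// => i _; rewrite lee_fin powR_ge0.
- by rewrite -EFinM lee_fin mulr_ge0// powR_ge0.
- by apply: lee_prod => i _; rewrite lee_fin powR_ge0 hX.
- by apply: lee_pmul; rewrite ?lee_fin ?powR_ge0.
Qed.

(** The suitable direction (b, j) varies with z, so the ball is covered by the 2n sets [E b j], each
    integrated with coordinate [j] innermost. Overlaps only increase the sum. *)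
Theorem singular_kernel_integral theta : 0 <= theta -> theta < 1 ->
  exists2 C : R, 0 <= C & forall w, unit_ball n w ->
  (\int[lebesgue_Cn n]_(z in unit_ball n) (singular_kernel theta z w)%:E <= C%:E)%E.
Proof.
move=> th0 th1; have [K1 K10 hK1] := @integral_tangential R theta th1.
have [K2 K20 hK2] := @integral_transversal R n theta th1.
pose A := (del `^ (- theta) + 2 `^ theta) * 2 `^ theta * (K2 / c) ^+ 2.
pose B := 2 `^ theta * 2 `^ theta * (K1 / c) ^+ 2.
have A0 : 0 <= A.
  by apply: mulr_ge0 (sqr_ge0 _); rewrite mulr_ge0 ?addr_ge0 ?powR_ge0.
have B0 : 0 <= B by apply: mulr_ge0 (sqr_ge0 _); rewrite mulr_ge0 ?powR_ge0.
have c0 : 0 < c by rewrite divr_gt0.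
exists (\sum_(b : bool) \sum_(j < n) A * \prod_(i < n | i != j) B).
  by do 2 apply: sumr_ge0 => ? _; rewrite mulr_ge0// prodr_ge0.
move=> w wB; pose E b j := [set z | big_coord b j z].
have mE b j : measurable (E b j).
  have -> : E b j = [set z | c1 <= `|part b (tnth z j)|] `|` [set z | 2^-1 <= 1 - normsq z].
    by apply/seteqP; split => z /orP.
  apply: measurableU; rewrite -[X in measurable X]setTI; apply: measurable_fun_le => //.
    apply: measurableT_comp => //; apply: measurableT_comp; last exact: measurable_tnth.
    exact: measurable_part.
  by apply: measurable_funB => //; exact: measurable_normsq.
pose F b j z := ((singular_kernel theta z w)%:E * (\1_(unit_ball n `&` E b j) z)%:E)%E.
have F0 b j z : (0 <= F b j z)%E.
  by rewrite mule_ge0// lee_fin singular_kernel_ge0.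
have mF b j : measurable_fun setT (F b j).
  apply: emeasurable_funM; apply/measurable_EFinP.
    exact: measurable_singular_kernel.
  by apply: measurable_indic; apply: measurableI => //; exact: measurable_unit_ball.
apply: (@le_trans _ _ (\int[lebesgue_Cn n]_z \sum_(b : bool) \sum_(j < n) F b j z)%E).
  rewrite integral_mkcond; apply: ge0_le_integral => //.
  - by move=> z _; apply: erestrict_ge0 => ? _; rewrite lee_fin singular_kernel_ge0.
  - have mk : measurable_fun (unit_ball n) (fun z => (singular_kernel theta z w)%:E).
      by apply: measurable_funTS; apply/measurable_EFinP; exact: measurable_singular_kernel.
    by move: mk => /(measurable_restrictT _ (@measurable_unit_ball R n)).
  - by apply: emeasurable_sum => b; exact: emeasurable_sum.
  move=> z _; rewrite patchE; case: ifPn => [/set_mem zB|_]; last first.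
    by apply: sume_ge0 => b _; apply: sume_ge0.
  have [b [j hbj]] := exists_big_coord z.
  rewrite (bigD1 b)//= (bigD1 j)//=.
  apply: (@le_trans _ _ (F b j z)).
    by rewrite /F indicE mem_set ?mule1.
  rewrite -addeA leeDl// adde_ge0//; apply: sume_ge0 => // b' _.
  by apply: sume_ge0.
rewrite ge0_integral_sum//; last 2 first.
- by move=> b; apply: emeasurable_sum.
- by move=> b z _; apply: sume_ge0.
rewrite -sumEFin; apply: lee_sum => b _.
rewrite ge0_integral_sum// -sumEFin; apply: lee_sum => j _.
rewrite EFinM -prodEFin.
pose g i x := ((2 `^ theta * 2 `^ theta)%:E * tangential theta c (tnth w i) x)%E.
have mg i : measurable_fun setT (g i).
  by apply: measurable_funeM; exact: measurable_tangential.
have g0 i x : (0 <= g i x)%E.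
  by rewrite mule_ge0 ?tangential_ge0// lee_fin mulr_ge0 ?powR_ge0.
apply: (@le_trans _ _ (A%:E * \prod_(i < n | i != j) \int[lebesgue_C]_x g i x)%E).
  apply: le_integral_lebesgue_Cn_coord => // z.
  pose G := (\prod_(i < n | i != j) g i (tnth z i))%E.
  have G0 : (0 <= G)%E by apply: prode_ge0.
  pose a := ((del `^ (- theta) + 2 `^ theta) * 2 `^ theta)%:E.
  have a0 : (0 <= a)%E by rewrite lee_fin mulr_ge0 ?addr_ge0 ?powR_ge0.
  apply: (@le_trans _ _ (\int[lebesgue_C]_x (a * G * transversal theta c b j z w x))%E).
    apply: ge0_le_integral => //.
    - by apply: (measurableT_comp (mF b j)); exact: measurable_set_coord.
    - by apply: measurable_funeM; exact: measurable_transversal.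
    - move=> x _; rewrite /F indicE; have [zx|_] := boolP (_ \in _); last first.
        by rewrite mule0 mule_ge0 ?transversal_ge0// mule_ge0.
      rewrite mule1; have [zB bz] := set_mem zx.
      apply: (le_trans (singular_kernel_le th0 zB wB bz)).
      rewrite tnth_mktuple eqxx /transversal slice_center_set_coord.
      rewrite !slice_radius_set_coord le_eqVlt; apply/orP; left; apply/eqP.
      congr (_ * _ * _)%E; apply: eq_bigr => i ij.
      by rewrite tnth_mktuple (negbTE ij).
  rewrite [leLHS]ge0_integralZl//; last 3 first.
  - exact: measurable_transversal.
  - by move=> x _; exact: transversal_ge0.
  - by rewrite mule_ge0.
  rewrite [leRHS](_ : _ = a * G * ((K2 / c) ^+ 2)%:E)%E; last first.
    by rewrite /A EFinM muleAC.
  by rewrite lee_wpmul2l ?mule_ge0// hK2.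
rewrite lee_wpmul2l ?lee_fin//; apply: lee_prod => i _.
apply/andP; split; first exact: integral_ge0.
rewrite [leLHS]ge0_integralZl//; last 2 first.
- exact: measurable_tangential.
- by move=> x _; exact: tangential_ge0.
by rewrite /B [leRHS]EFinM lee_wpmul2l ?hK1// lee_fin mulr_ge0 ?powR_ge0.
Qed.

End singular_kernel.

(** * Lower bounds for volumes of balls and shells *)

Section lebesgue_lower_bounds.
Context {R : realType}.
Local Open Scope complex_scope.
Local Notation mu := (@lebesgue_measure R).

Lemma lebesgue_measure_cc (a b : R) : a <= b -> mu `[a, b]%classic = (b - a)%:E.
Proof.
rewrite le_eqVlt => /predU1P[->|ab]; rewrite lebesgue_measure_itv/= lte_fin.
  by rewrite ltxx subrr.
by rewrite ab EFinB.
Qed.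

Lemma measurable_lt_preimage d (T : measurableType d) (f : T -> R) (r : R) :
  measurable_fun setT f -> measurable [set x | f x < r].
Proof.
move=> mf; rewrite -[X in measurable X]setTI.
rewrite (_ : mkset _ = f @^-1` `]-oo, r[); first exact: mf.
by apply/seteqP; split => z /=; rewrite in_itv.
Qed.

Lemma measurable_disk (r : R) : measurable [set x : R[i] | normc x ^+ 2 < r].
Proof.
apply: measurable_lt_preimage; apply: measurable_funX; exact: measurable_normc.
Qed.

Lemma lebesgue_C_disk_gt0 (r : R) : 0 < r ->
  (0 < @lebesgue_C R [set x | (normc x ^+ 2 < r)%R])%E.
Proof.
move=> r0; pose s := Num.sqrt (r / 4).
have s0 : 0 < s by rewrite sqrtr_gt0 divr_gt0.
have s2 : s ^+ 2 = r / 4 by rewrite sqr_sqrtr// ltW// divr_gt0.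
have m1 : measurable (`[0, s]%classic `*` `[0, s]%classic : set (R * R)).
  by apply: measurableX.
apply: (@lt_le_trans _ _ ((mu \x mu)%E (`[0, s]%classic `*` `[0, s]%classic))).
  rewrite product_measure1E// [X in (X * _)%E]lebesgue_measure_cc ?ltW//.
  rewrite [X in (_ * X)%E]lebesgue_measure_cc ?(ltW s0)//.
  by rewrite -EFinM lte_fin subr0 mulr_gt0.
rewrite /lebesgue_C sfpushforwardE sfproductE; apply: le_measure; rewrite ?inE//.
  rewrite -[X in measurable X]setTI; apply: measurable_pair_complex => //.
  exact: measurable_disk.
move=> [x y] /= []; rewrite !in_itv/= => /andP[x0 xs] /andP[y0 ys].
rewrite sqr_sqrtr ?addr_ge0 ?sqr_ge0//.
have : x ^+ 2 <= s ^+ 2 by rewrite ler_pXn2r ?nnegrE// ltW.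
have : y ^+ 2 <= s ^+ 2 by rewrite ler_pXn2r ?nnegrE// ltW.
by rewrite s2; lra.
Qed.

Lemma measurable_normsq_lt n (r : R) : measurable [set z : n.-tuple R[i] | normsq z < r].
Proof. by apply: measurable_lt_preimage; exact: measurable_normsq. Qed.

Lemma normsq_cons n (x : R[i]) (t : n.-tuple R[i]) :
  normsq (cons_pair (x, t)) = normc x ^+ 2 + normsq t.
Proof. by rewrite /normsq big_ord_recl; congr (_ + _); apply: eq_bigr => i _; rewrite tnthS. Qed.

Lemma lebesgue_Cn_ball_gt0 n (r : R) : 0 < r ->
  (0 < @lebesgue_Cn R n [set z | (normsq z < r)%R])%E.
Proof.
elim: n r => [|n ih] r r0.
  rewrite /lebesgue_Cn/= diracE mem_set ?lte01// /normsq /=.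
  by rewrite big_ord0.
have r2 : 0 < r / 2 by rewrite divr_gt0.
have mC := measurable_disk (r / 2).
apply: (@lt_le_trans _ _ ((@lebesgue_C R \x @lebesgue_Cn R n)%E
    ([set x | normc x ^+ 2 < r / 2] `*` [set z | normsq z < r / 2]))).
  rewrite product_measure1E//; last exact: measurable_normsq_lt.
  by rewrite mule_gt0// ?ih// lebesgue_C_disk_gt0.
rewrite [leRHS]sfpushforwardE sfproductE; apply: le_measure; rewrite ?inE//.
- by apply: measurableX => //; exact: measurable_normsq_lt.
- rewrite -[X in measurable X]setTI; apply: measurable_cons_pair => //.
  exact: measurable_normsq_lt.
move=> [x t] [/= xr tr]; by rewrite /= normsq_cons; lra.
Qed.

(** The condition Re z_0 >= 1/2 keeps to a piece of the shell on which Re z_0 is determined, up to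
    O(h), by the other real coordinates. *)
Definition level_set n (h : R) : set (n.+1.-tuple R[i]) :=
  [set z | 2^-1 <= complex.Re (tnth z ord0) /\ h <= 1 - normsq z < 2 * h].

Lemma measurable_level_set n h : measurable (@level_set n h).
Proof.
have mV : measurable_fun setT (fun z : n.+1.-tuple R[i] => 1 - normsq z).
  by apply: measurable_funB => //; exact: measurable_normsq.
have -> : @level_set n h = [set z | 2^-1 <= complex.Re (tnth z ord0)] `&`
    ([set z | h <= 1 - normsq z] `&` [set z | 1 - normsq z < 2 * h]).
  apply/seteqP; split => z [/= z0]; first by move=> /andP[].
  by move=> [h1 h2]; split => //; apply/andP.
apply: measurableI; [|apply: measurableI; last exact: measurable_lt_preimage].
  rewrite -[X in measurable X]setTI; apply: measurable_fun_le => //.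
  by apply: measurableT_comp (measurable_part true) _; exact: measurable_tnth.
by rewrite -[X in measurable X]setTI; apply: measurable_fun_le.
Qed.

(** Between [a] and [b] the quantity 1 - x^2 - u runs over [h, 3h/2], which stays strictly below 2h.
    The length follows from (b - a)(b + a) = h/2 and a + b <= 2. *)
Lemma sqrt_interval (u h : R) : 0 < h -> h <= 8^-1 -> 0 <= u -> u <= 4^-1 ->
  exists a b : R, [/\ h / 4 <= b - a, a <= b & forall x, x \in `[a, b] ->
    2^-1 <= x /\ h <= 1 - x ^+ 2 - u < 2 * h].
Proof.
move=> h0 h8 u0 u4.
have [A0 B1] : 4^-1 <= 1 - u - 3 / 2 * h /\ 0 <= 1 - u - h by split; lra.
pose a := Num.sqrt (1 - u - 3 / 2 * h); pose b := Num.sqrt (1 - u - h).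
exists a, b.
have a0 : 0 <= a by exact: sqrtr_ge0.
have b0 : 0 <= b by exact: sqrtr_ge0.
have a2 : a ^+ 2 = 1 - u - 3 / 2 * h by rewrite sqr_sqrtr// (le_trans _ A0)// invr_ge0.
have b2 : b ^+ 2 = 1 - u - h by rewrite sqr_sqrtr.
have ab : a <= b by rewrite -(ler_pXn2r (n := 2)) ?nnegrE// a2 b2; lra.
have ha : 2^-1 <= a.
  rewrite -(ler_pXn2r (n := 2)) ?nnegrE// a2; apply: le_trans A0.
  by rewrite exprVn -natrX.
split => //; first last.
  move=> x; rewrite in_itv/= => /andP[ax xb]; split; first exact: le_trans ax.
  have x0 : 0 <= x by exact: le_trans ax.
  have : a ^+ 2 <= x ^+ 2 by rewrite ler_pXn2r ?nnegrE.
  have : x ^+ 2 <= b ^+ 2 by rewrite ler_pXn2r ?nnegrE.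
  by rewrite a2 b2 => ? ?; apply/andP; split; lra.
have b1 : b <= 1 by rewrite -(ler_pXn2r (n := 2)) ?nnegrE// b2 expr1n; lra.
have : (b - a) * (b + a) = h / 2 by rewrite -subr_sqr b2 a2; lra.
have : (b - a) * (b + a) <= (b - a) * 2 by rewrite ler_wpM2l ?subr_ge0//; lra.
by move=> /[swap] ->; lra.
Qed.

Lemma measurable_level_slice (u h : R) : measurable
  [set x : R[i] | (2^-1 <= complex.Re x)%R /\ (h <= 1 - normc x ^+ 2 - u < 2 * h)%R].
Proof.
have mV : measurable_fun setT (fun x : R[i] => 1 - normc x ^+ 2 - u).
  apply: measurable_funB => //; apply: measurable_funB => //.
  by apply: measurable_funX; exact: measurable_normc.
rewrite (_ : mkset _ = [set x | 2^-1 <= complex.Re x] `&`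
    ([set x | h <= 1 - normc x ^+ 2 - u] `&` [set x | 1 - normc x ^+ 2 - u < 2 * h])); last first.
  apply/seteqP; split => x [/= x0]; first by move=> /andP[].
  by move=> [h1 h2]; split => //; apply/andP.
apply: measurableI; [|apply: measurableI; last exact: measurable_lt_preimage].
  rewrite -[X in measurable X]setTI; apply: measurable_fun_le => //.
  exact: (measurable_part true).
by rewrite -[X in measurable X]setTI; apply: measurable_fun_le.
Qed.

Lemma lebesgue_C_level_slice (u h : R) : 0 < h -> h <= 8^-1 -> 0 <= u -> u <= 8^-1 ->
  ((h / 16)%:E <= @lebesgue_C R
    [set x | (2^-1 <= complex.Re x)%R /\ (h <= 1 - normc x ^+ 2 - u < 2 * h)%R])%E.
Proof.
move=> h0 h8 u0 u8; set A := mkset _.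
have mA : measurable A by exact: measurable_level_slice.
have -> : lebesgue_C A = (\int[lebesgue_C]_x (\1_A x)%:E)%E.
  by rewrite integral_indic// setIT.
have m1A : measurable_fun setT (fun x : R[i] => (\1_A x : R)%:E).
  by apply/measurable_EFinP; exact: measurable_indic.
rewrite ge0_integral_lebesgue_C2//.
apply: (@le_trans _ _ (\int[mu]_(y in `[0%R, 4^-1%R]) (h / 4)%:E)%E).
  rewrite integral_cst// [X in (_ * X)%E]lebesgue_measure_cc ?invr_ge0//.
  by rewrite -EFinM lee_fin subr0; lra.
have mG : measurable_fun setT (fun y : R => \int[mu]_x (\1_A (x +i* y) : R)%:E)%E.
  apply: (@measurable_fun_fubini_tonelli_G _ _ _ _ _ mu
     ((fun x => (\1_A x)%:E) \o @pair_complex R)) => //.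
    by apply: measurableT_comp => //; exact: measurable_pair_complex.
  by move=> x; rewrite /= lee_fin.
have G0 y : (0 <= \int[mu]_x (\1_A (x +i* y) : R)%:E)%E.
  by apply: integral_ge0 => x _; rewrite lee_fin.
apply: (@le_trans _ _ (\int[mu]_(y in `[0%R, 4^-1%R]) \int[mu]_x (\1_A (x +i* y))%:E)%E).
  apply: ge0_le_integral => //.
  - by move=> y _; rewrite lee_fin divr_ge0// ltW.
  - exact: measurable_funTS.
  move=> y; rewrite /= in_itv/= => /andP[y0 y1].
  have yy : y ^+ 2 <= 16^-1.
    have -> : 16^-1 = 4^-1 ^+ 2 :> R by rewrite exprVn -natrX.
    by rewrite ler_pXn2r ?nnegrE// invr_ge0.
  have uy : u + y ^+ 2 <= 4^-1 by lra.
  have [a [b [hab ab hx]]] := sqrt_interval h0 h8 (addr_ge0 u0 (sqr_ge0 y)) uy.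
  apply: (@le_trans _ _ (\int[mu]_x (\1_(`[a, b] : set R) x)%:E)%E).
    rewrite integral_indic// setIT [leRHS]lebesgue_measure_cc//.
  apply: ge0_le_integral => //.
  - by apply/measurable_EFinP; exact: measurable_indic.
  - by apply: (measurableT_comp m1A (measurableT_comp (@measurable_pair_complex R)
      (pair2_measurable y))).
  move=> x _; rewrite !indicE lee_fin.
  have [xab|_] := boolP (x \in (`[a, b]%classic : set R)); last by [].
  rewrite mem_set ?lexx//; have [x0 x1] := hx _ (set_mem xab).
  split => //=; rewrite sqr_sqrtr ?addr_ge0 ?sqr_ge0//.
  by rewrite (_ : 1 - (x ^+ 2 + y ^+ 2) - u = 1 - x ^+ 2 - (u + y ^+ 2)) //; ring.
by apply: ge0_subset_integral.
Qed.

(** Over each t with |t|^2 < 1/8 the slice in z_0 has area at least h / 16; integrate over that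
    ball. *)
Lemma lebesgue_Cn_level_set n : exists2 k : R, 0 < k &
  forall h, 0 < h -> h <= 8^-1 -> ((k * h)%:E <= lebesgue_Cn n.+1 (level_set h))%E.
Proof.
pose B := [set t : n.-tuple R[i] | normsq t < 8^-1].
have mB : measurable B by exact: measurable_normsq_lt.
have [v v0 vB] : exists2 v : R, 0 < v & (v%:E <= lebesgue_Cn n B)%E.
  have : (0 < lebesgue_Cn n B)%E by apply: lebesgue_Cn_ball_gt0; rewrite invr_gt0.
  case: (lebesgue_Cn n B) => [v v0|_|//]; first by exists v.
  (* If the volume were infinite, any positive constant would do. *)
  by exists 1; rewrite ?leey.
exists (v / 16); first by rewrite divr_gt0.
move=> h h0 h8; have mL := @measurable_level_set n h.
have -> : lebesgue_Cn n.+1 (level_set h) =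
    (\int[lebesgue_Cn n.+1]_z (\1_(@level_set n h) z)%:E)%E.
  by rewrite integral_indic// setIT.
have m1L : measurable_fun setT (fun z => (\1_(@level_set n h) z : R)%:E).
  by apply/measurable_EFinP; exact: measurable_indic.
rewrite ge0_integral_lebesgue_CnS2//.
have mG : measurable_fun setT
    (fun t => \int[lebesgue_C]_x (\1_(@level_set n h) (cons_pair (x, t)) : R)%:E)%E.
  apply: (@measurable_fun_fubini_tonelli_G _ _ _ _ _ lebesgue_C
     ((fun x => (\1_(@level_set n h) x)%:E) \o @cons_pair R n)) => //.
    by apply: measurableT_comp => //; exact: measurable_cons_pair.
  by move=> x; rewrite /= lee_fin.
apply: (@le_trans _ _ (\int[lebesgue_Cn n]_(t in B) (h / 16)%:E)%E).
  rewrite integral_cst//.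
  apply: (@le_trans _ _ ((h / 16)%:E * v%:E)%E).
    by rewrite -EFinM lee_fin; lra.
  by rewrite lee_wpmul2l// lee_fin divr_ge0// ltW.
apply: (@le_trans _ _ (\int[lebesgue_Cn n]_(t in B)
    \int[lebesgue_C]_x (\1_(@level_set n h) (cons_pair (x, t)))%:E)%E).
  apply: ge0_le_integral => //.
  - by move=> t _; rewrite lee_fin divr_ge0// ltW.
  - exact: measurable_funTS.
  move=> t Bt; apply: (le_trans (lebesgue_C_level_slice h0 h8 (normsq_ge0 t) (ltW Bt))).
  rewrite -[leLHS]mul1e -[leLHS]integral_cst; last exact: measurable_level_slice.
  rewrite integral_mkcond le_eqVlt; apply/orP; left; apply/eqP.
  apply: eq_integral => x _; rewrite patchE indicE /level_set.
  rewrite (_ : (x \in _) = (cons_pair (x, t) \in @level_set n h)).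
    by case: ifP.
  have e : 1 - normsq (cons_pair (x, t)) = 1 - normc x ^+ 2 - normsq t.
    by rewrite normsq_cons opprD addrA.
  by apply/idP/idP => /set_mem [h1]; [rewrite -e|rewrite e] => h2; apply/mem_set.
apply: ge0_subset_integral => //.
by move=> t _; apply: integral_ge0.
Qed.

End lebesgue_lower_bounds.

(** * Integration against a density *)

Section density.
Context d (T : measurableType d) (R : realType).
Variables (m nu : {measure set T -> \bar R}) (w : T -> R).
Hypothesis mw : measurable_fun setT w.
Hypothesis w0 : forall x, 0 <= w x.
Local Open Scope ereal_scope.
Hypothesis nuE : forall A, measurable A -> nu A = \int[m]_(x in A) (w x)%:E.

Import HBNNSimple.

Lemma ge0_integral_density E (f : T -> \bar R) : (forall x, 0 <= f x) ->
    measurable E -> measurable_fun E f ->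
  \int[nu]_(x in E) f x = \int[m]_(x in E) (f x * (w x)%:E).
Proof.
move=> f0 mE mf; pose h := nnsfun_approx mE mf.
have mwE : measurable_fun E (EFin \o w).
  by apply: measurable_funTS; exact/measurable_EFinP.
have mh n : measurable_fun E (EFin \o h n).
  by apply/measurable_funTS/measurable_EFinP.
have -> : \int[nu]_(x in E) f x = limn (fun n => \int[nu]_(x in E) (EFin \o h n) x).
  rewrite -monotone_convergence//.
  - apply: eq_integral => x /[!inE] Ex; apply/esym/cvg_lim => //.
    exact: cvg_nnsfun_approx.
  - by move=> n x Ex //=; rewrite lee_fin.
  - by move=> x Ex a b ab; rewrite lee_fin; exact/lefP/nd_nnsfun_approx.
have -> : \int[m]_(x in E) (f x * (w x)%:E) =
    limn (fun n => \int[m]_(x in E) ((EFin \o h n) x * (w x)%:E)).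
  rewrite -monotone_convergence//.
  - apply: eq_integral => x /[!inE] Ex; apply/esym/cvg_lim => //.
    by apply: cvgeZr => //; exact: cvg_nnsfun_approx.
  - by move=> n; exact: emeasurable_funM.
  - by move=> n x Ex; rewrite mule_ge0//= lee_fin.
  - move=> x Ex a b ab; rewrite lee_wpmul2r ?lee_fin//.
    exact/lefP/nd_nnsfun_approx.
suff suf n : \int[nu]_(x in E) (EFin \o h n) x =
    \int[m]_(x in E) ((EFin \o h n) x * (w x)%:E).
  by under eq_fun do rewrite suf.
have indich r : measurable_fun E (fun x => (r * \1_(h n @^-1` [set r]) x)%:E).
  by apply: (measurable_comp measurableT) => //; exact: measurable_funM.
transitivity (\int[nu]_(x in E)
   (\sum_(y \in range (h n)) (y * \1_(h n @^-1` [set y]) x)%:E)).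
  by apply: eq_integral => t tE; rewrite /= fimfunE -fsumEFin.
rewrite ge0_integral_fsum//; last by move=> y x Ex; exact: nnfun_muleindic_ge0.
transitivity (\int[m]_(x in E) (\sum_(y \in range (h n))
    (y * \1_(h n @^-1` [set y]) x)%:E * (w x)%:E)); last first.
  apply: eq_integral => x xE.
  rewrite -ge0_mule_fsuml => [|y]; last exact: nnfun_muleindic_ge0.
  by rewrite fsumEFin // -(fimfunE _ x).
rewrite ge0_integral_fsum//; last 2 first.
  - by move=> y; exact: emeasurable_funM.
  - by move=> y x Ex; apply: mule_ge0; [exact: nnfun_muleindic_ge0|rewrite lee_fin].
apply: eq_fsbigr => r rhn.
under eq_integral do rewrite EFinM.
rewrite integralZl_indic_nnsfun => //.
under [RHS]eq_integral do rewrite EFinM -muleA.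
rewrite [RHS]ge0_integralZl//.
- under [in RHS]eq_integral do rewrite muleC.
  rewrite [in RHS](eq_integral ((EFin \o w) \_ (h n @^-1` [set r]))); last first.
    by move=> x xE; rewrite epatch_indic.
  by rewrite integral_indic// -integral_mkcondr -nuE 1?setIC//; exact: measurableI.
- by apply: emeasurable_funM => //; exact/measurable_EFinP.
- by move=> t Et; rewrite mule_ge0 ?lee_fin.
- by move: rhn; rewrite inE => -[t _ <-]; rewrite lee_fin.
Qed.

End density.

(** * The weighted volume in terms of Lebesgue measure *)

Section weighted_volume_facts.
Context {R : realType}.
Variables (n : nat) (alpha : R).
Hypotheses (n_gt0 : (0 < n)%N) (alpha_gtN1 : -1 < alpha).
Local Notation vol := (@lebesgue_Cn R n).
Local Notation B := (@unit_ball R n).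
Local Notation wv := (weighted_volume n alpha).

Lemma lebesgue_Cn_unit_ball : (0 < vol B < +oo)%E.
Proof.
apply/andP; split; first exact: lebesgue_Cn_ball_gt0.
(* For theta = 0 the singular kernel is the constant 1, so its integral is the volume of the
   ball. *)
have [C C0 hC] := @singular_kernel_integral R n n_gt0 0 (lexx 0) ltr01.
have B0 : B [tuple 0 | i < n].
  rewrite /unit_ball /= /normsq big1// => i _.
  by rewrite tnth_mktuple normc0 expr0n.
apply: le_lt_trans (ltry C); apply: le_trans (hC _ B0).
under eq_integral do rewrite /singular_kernel oppr0 !powRr0 expr1n mulr1.
by rewrite integral_cst ?mul1e//; exact: measurable_unit_ball.
Qed.

Lemma c_alpha_gt0 : 0 < c_alpha n alpha.
Proof.
have a1 : 0 < alpha + 1 by have := alpha_gtN1; lra.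
rewrite divr_gt0 ?mulr_gt0 ?Gamma_gt0 ?ltr0n ?fact_gt0//.
by rewrite -addrA ltr_wpDl.
Qed.

Definition wv_cst : R := c_alpha n alpha / fine (vol B).

Lemma wv_cst_gt0 : 0 < wv_cst.
Proof. by rewrite divr_gt0 ?c_alpha_gt0// fine_gt0// lebesgue_Cn_unit_ball. Qed.

Lemma ge0_integral_weighted_volume E (f : n.-tuple R[i] -> \bar R) :
  (forall z, 0 <= f z)%E -> measurable E -> measurable_fun setT f ->
  (\int[wv]_(z in E) f z =
   \int[vol]_(z in E `&` B) (f z * (wv_cst * (1 - normsq z) `^ alpha)%:E))%E.
Proof.
move=> f0 mE mf; have mB := @measurable_unit_ball R n.
pose k := (fine (vol B))^-1.
have k0 : 0 <= k by rewrite invr_ge0 fine_ge0.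
have mV : measurable_fun setT (fun z : n.-tuple R[i] => (1 - normsq z) `^ alpha).
  apply: (measurableT_comp (measurable_powR _)).
  by apply: measurable_funB => //; exact: measurable_normsq.
have normE A g : (forall z, 0 <= g z)%E -> measurable A -> measurable_fun setT g ->
    (\int[normalized_volume n]_(z in A) g z =
     \int[vol]_(z in A) (g z * (k * \1_B z)%:E))%E.
  move=> g0 mA mg; apply: ge0_integral_density => //.
  - by apply: measurable_funM => //; exact: measurable_indic.
  - by move=> z; rewrite mulr_ge0.
  - move=> A' mA'; rewrite /normalized_volume /= /mscale /= /mrestr.
    under eq_integral do rewrite EFinM.
    rewrite ge0_integralZl//; last first.
      by apply/measurable_EFinP/measurable_funTS; exact: measurable_indic.
    by rewrite integral_indic// setIC.
  - exact: measurable_funTS.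
rewrite (@ge0_integral_density _ _ _ vol wv
  (fun z => wv_cst * (1 - normsq z) `^ alpha * \1_B z))//.
- rewrite integral_mkcondr; apply: eq_integral => z _; rewrite patchE.
  rewrite indicE; case: ifPn => _; first by rewrite mulr1.
  by rewrite mulr0 mule0.
- by apply: measurable_funM; [apply: measurable_funM => //|exact: measurable_indic].
- move=> z; apply: mulr_ge0 => //; apply: mulr_ge0; last exact: powR_ge0.
  exact: ltW wv_cst_gt0.
- move=> A mA; rewrite -[LHS]/(\int[normalized_volume n]_(z in A)
    (c_alpha n alpha * (1 - normsq z) `^ alpha)%:E)%E normE//; last 2 first.
  + by move=> z; rewrite lee_fin mulr_ge0 ?powR_ge0// ltW// c_alpha_gt0.
  + by apply/measurable_EFinP; apply: measurable_funM.
  apply: eq_integral => z _; rewrite -EFinM; congr EFin.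
  by rewrite /wv_cst -/k; ring.
- exact: measurable_funTS.
Qed.

End weighted_volume_facts.

(** * Integrals of powers of D and of V *)

Section kernel_estimates.
Context {R : realType}.
Variables (n : nat) (alpha : R).
Hypotheses (n_gt0 : (0 < n)%N) (alpha_gtN1 : -1 < alpha).
Implicit Types (z w : n.-tuple R[i]) (b e theta : R).
Local Notation B := (@unit_ball R n).
Local Notation wv := (weighted_volume n alpha).
Local Notation D z w := (normc (1 - inner z w)).

Let integral_le_singular theta (A : R) : 0 <= theta -> theta < 1 -> 0 <= A ->
  exists2 C : R, 0 <= C & forall w (g : n.-tuple R[i] -> R), B w ->
    measurable_fun setT g -> (forall z, 0 <= g z) ->
    (forall z, B z -> g z * (1 - normsq z) `^ alpha <= A * singular_kernel theta z w) ->
    (\int[wv]_(z in B) (g z)%:E <= C%:E)%E.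
Proof.
move=> th0 th1 A0; have [C C0 hC] := singular_kernel_integral n_gt0 th0 th1.
have k0 := wv_cst_gt0 n_gt0 alpha_gtN1.
exists (wv_cst n alpha * A * C); first exact: mulr_ge0 (mulr_ge0 (ltW k0) A0) C0.
move=> w g wB mg g0 hg; have mB := @measurable_unit_ball R n.
have msk := measurable_singular_kernel theta w.
rewrite ge0_integral_weighted_volume//; last exact/measurable_EFinP.
rewrite setIid; apply: (@le_trans _ _ (\int[lebesgue_Cn n]_(z in B)
   ((wv_cst n alpha * A)%:E * (singular_kernel theta z w)%:E))%E).
  apply: ge0_le_integral => //.
  - move=> z _; rewrite -EFinM lee_fin; apply: mulr_ge0 => //.
    by apply: mulr_ge0; [exact: ltW|exact: powR_ge0].
  - apply: measurable_funTS; apply: emeasurable_funM; apply/measurable_EFinP => //.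
    apply: measurable_funM => //; apply: (measurableT_comp (measurable_powR _)).
    by apply: measurable_funB => //; exact: measurable_normsq.
  - by apply: measurable_funTS; apply: measurable_funeM; exact/measurable_EFinP.
  - move=> z zB; rewrite -!EFinM lee_fin [leLHS]mulrCA -[leRHS]mulrA.
    by apply: ler_wpM2l; [exact: ltW|exact: hg].
rewrite ge0_integralZl//; last 3 first.
- by apply: measurable_funTS; exact/measurable_EFinP.
- by move=> z _; rewrite lee_fin singular_kernel_ge0.
- by rewrite lee_fin mulr_ge0// ltW.
by rewrite [leRHS]EFinM lee_wpmul2l ?hC// lee_fin mulr_ge0// ltW.
Qed.

Lemma kernel_integral b : b < n%:R + 1 + alpha -> exists2 C : R, 0 <= C &
  forall w, B w -> (\int[wv]_(z in B) (D z w `^ (- b))%:E <= C%:E)%E.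
Proof.
(* The three lower bounds for [theta]: the first leaves a nonnegative power of D, bounded since D <=
   2; the second allows V^(alpha + theta) <= (2 D)^(alpha + theta); the third is required by the
   singular kernel. All are below 1 because b < n + 1 + alpha and alpha > -1. *)
move=> hb; pose theta := Num.max (Num.max ((b - alpha) / (n%:R + 1)) (- alpha)) 0.
have n1 : 0 < n%:R + 1 :> R by rewrite ltr_wpDl.
have th0 : 0 <= theta by rewrite le_max lexx orbT.
have th1 : theta < 1.
  have := alpha_gtN1.
  by rewrite !gt_max ltr01 andbT ltr_pdivrMr// mul1r => ?; apply/andP; split; lra.
have tha : 0 <= alpha + theta by rewrite -lerBlDl sub0r !le_max lexx orbT.
have thb : 0 <= - b + alpha + theta + n%:R * theta.
  have : (b - alpha) / (n%:R + 1) <= theta by rewrite !le_max lexx.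
  by rewrite ler_pdivrMr//; lra.
set e := - b + alpha + theta + n%:R * theta in thb.
have [C C0 hC] := @integral_le_singular theta (2 `^ (alpha + theta) * 2 `^ e) th0 th1
  (mulr_ge0 (powR_ge0 _ _) (powR_ge0 _ _)).
exists C => // w wB; apply: (hC w) => // [|z|z zB]; last 2 first.
- exact: powR_ge0.
- have D0 := normc_1B_inner_gt0 zB wB; have D2 := normc_1B_inner_le2 zB wB.
  have V0 : 0 < 1 - normsq z by rewrite subr_gt0.
  have VD := onemB_normsq_le_normc zB wB.
  have -> : alpha = (alpha + theta) - theta by rewrite addrK.
  rewrite powRD ?(gt_eqF V0) ?implybT// mulrA addrK.
  have hV : (1 - normsq z) `^ (alpha + theta) <= 2 `^ (alpha + theta) * D z w `^ (alpha + theta).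
    rewrite -powRM ?(ltW D0)//; apply: ge0_ler_powR => //; rewrite nnegrE ltW// mulr_gt0//.
  rewrite /singular_kernel mulrA ler_wpM2r ?powR_ge0//.
  apply: (le_trans (ler_wpM2l (powR_ge0 _ _) hV)).
  rewrite mulrCA -mulrA ler_wpM2l ?powR_ge0// -powR_mulrn ?powR_ge0// -powRrM.
  rewrite -powRD ?(gt_eqF D0) ?implybT//.
  have -> : - b + (alpha + theta) = e + - theta * n%:R by rewrite /e; ring.
  rewrite powRD ?(gt_eqF D0) ?implybT// ler_wpM2r ?powR_ge0//.
  by apply: ge0_ler_powR => //; rewrite nnegrE// ltW.
by apply: (measurableT_comp (measurable_powR _)); exact: measurable_normc_1B_inner1.
Qed.

(** Take the origin for w: then D = 1 and the singular kernel reduces to a power of V. *)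
Lemma weight_integral e : e < 1 + alpha -> exists2 C : R, 0 <= C &
  (\int[wv]_(z in B) ((1 - normsq z) `^ (- e))%:E <= C%:E)%E.
Proof.
move=> he; pose theta := Num.max (e - alpha) 0.
have th0 : 0 <= theta by rewrite le_max lexx orbT.
have th1 : theta < 1 by rewrite gt_max ltr01 andbT; lra.
have [C C0 hC] := @integral_le_singular theta 1 th0 th1 ler01.
exists C => //; pose o : n.-tuple R[i] := [tuple 0 | i < n].
have oB : B o.
  rewrite /unit_ball /= /normsq big1// => i _.
  by rewrite tnth_mktuple normc0 expr0n.
apply: (hC o) => // [|z|z zB]; last 2 first.
- exact: powR_ge0.
- have V0 : 0 < 1 - normsq z by rewrite subr_gt0.
  have V1 : 1 - normsq z <= 1 by have := normsq_ge0 z; lra.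
  have -> : singular_kernel theta z o = (1 - normsq z) `^ (- theta).
    rewrite /singular_kernel (_ : inner z o = 0); last first.
      by apply: big1 => i _; rewrite tnth_mktuple rmorph0 mulr0.
    by rewrite subr0 normc1 powR1 expr1n mul1r.
  rewrite mul1r -powRD ?(gt_eqF V0) ?implybT//.
  apply: ger_powR; first by rewrite V0.
  by rewrite addrC lerNl opprB le_max lexx.
apply: (measurableT_comp (measurable_powR _)).
by apply: measurable_funB => //; exact: measurable_normsq.
Qed.

Lemma weighted_volume_setT : wv setT = wv B.
Proof.
have mB := @measurable_unit_ball R n.
have e A : measurable A -> wv A = (\int[wv]_(z in A) 1)%E.
  by move=> mA; rewrite integral_cst// mul1e.
by rewrite !e// !ge0_integral_weighted_volume// setTI setIid.
Qed.

Lemma weighted_volume_lty : (wv setT < +oo)%E.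
Proof.
have mB := @measurable_unit_ball R n.
have [|C C0 hC] := @weight_integral 0; first by have := alpha_gtN1; lra.
rewrite weighted_volume_setT; apply: le_lt_trans (ltry C); apply: le_trans hC.
rewrite oppr0; under eq_integral do rewrite powRr0.
by rewrite integral_cst// mul1e.
Qed.

Lemma weighted_volume_sigma_finite : sigma_finite setT wv.
Proof.
exists (fun=> setT); first by rewrite bigcup_const.
by move=> _; split => //; exact: weighted_volume_lty.
Qed.

End kernel_estimates.

(** * The operator on measurable functions *)

Section complex_power.
Context {R : realType}.
Local Open Scope complex_scope.
Implicit Types (u : R[i]) (c : R).

Lemma Arg_atan u : 0 < complex.Re u -> Arg u = atan (complex.Im u / complex.Re u).
Proof.
case: u => x y /= x0; rewrite /Arg /=.
have -> : x / Num.sqrt (x ^+ 2 + y ^+ 2) = cos (atan (y / x)).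
  rewrite cos_atan; have -> : x ^+ 2 + y ^+ 2 = x ^+ 2 * (1 + (y / x) ^+ 2).
    by field; rewrite gt_eqF.
  rewrite sqrtrM ?sqr_ge0// sqrtr_sqr gtr0_norm// invfM mulrA divff ?gt_eqF//.
  by rewrite mul1r.
have [p1 p2] := (@atan_gtNpi2 R (y / x), @atan_ltpi2 R (y / x)).
have pi0 := @pi_gt0 R.
have [y0|y0] := leP 0 y.
  rewrite cosK// in_itv/=; apply/andP; split; last lra.
  by rewrite -(@atan0 R) le_atan// divr_ge0// ltW.
rewrite cosKN ?opprK//; apply/andP; split; first lra.
by rewrite -(@atan0 R) le_atan// pmulr_lle0 ?invr_gt0// ltW.
Qed.

(** For Re u > 0, [pow_re] and [- pow_im] are the real and imaginary parts of u^-c. They are total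
    functions built from measurable ones; elsewhere their values are arbitrary. *)
Definition pow_re c u : R :=
  normc u `^ (- c) * cos (c * atan (complex.Im u * complex.Re u `^ (-1))).

Definition pow_im c u : R :=
  normc u `^ (- c) * sin (c * atan (complex.Im u * complex.Re u `^ (-1))).

Lemma normc_gt0_Re u : 0 < complex.Re u -> 0 < normc u.
Proof.
by move=> u0; apply: (lt_le_trans u0); exact: le_trans (ler_norm _) (part_le_normc true u).
Qed.

Lemma inv_cpowR c u : 0 < complex.Re u ->
  (cpowR u c)^-1 = pow_re c u +i* - pow_im c u.
Proof.
move=> u0; have r0 := normc_gt0_Re u0.
have p0 : normc u `^ c != 0 by rewrite gt_eqF// powR_gt0.
rewrite /pow_re /pow_im powR_inv1 ?(ltW u0)// -Arg_atan// powRN /cpowR.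
set t := c * Arg u; set p := normc u `^ c.
have -> : p%:C * (cos t +i* sin t) = (p * cos t) +i* (p * sin t) by simpc.
have inv_ReIm (a b : R) : (a +i* b)^-1 = (a / (a ^+ 2 + b ^+ 2)) +i* - (b / (a ^+ 2 + b ^+ 2)).
  by [].
rewrite inv_ReIm !exprMn -mulrDr cos2Dsin2 mulr1.
by apply/eqP; rewrite eq_complex /=; apply/andP; split; apply/eqP; field.
Qed.

Lemma pow_normE c u : pow_re c u ^+ 2 + pow_im c u ^+ 2 = (normc u `^ (- c)) ^+ 2.
Proof. by rewrite !exprMn -mulrDr cos2Dsin2 mulr1. Qed.

Lemma normc_inv_cpowR c u : 0 < complex.Re u -> normc (cpowR u c)^-1 = normc u `^ (- c).
Proof.
move=> u0; rewrite inv_cpowR//= sqrrN pow_normE sqrtr_sqr ger0_norm//.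
exact: powR_ge0.
Qed.

Let measurable_pow_arg c :
  measurable_fun setT (fun u => c * atan (complex.Im u * complex.Re u `^ (-1))).
Proof.
apply: measurable_funM => //; apply: (@measurableT_comp _ _ _ _ _ _ (@atan R)).
  by apply: continuous_measurable_fun => x; exact: continuous_atan.
apply: measurable_funM; first exact: (measurable_part false).
by apply: (measurableT_comp (measurable_powR _)); exact: (measurable_part true).
Qed.

Let measurable_normc_powR c : measurable_fun setT (fun u => normc u `^ (- c)).
Proof. by apply: (measurableT_comp (measurable_powR _)); exact: measurable_normc. Qed.

Lemma measurable_pow_re c : measurable_fun setT (pow_re c).
Proof.
apply: measurable_funM => //; apply: (@measurableT_comp _ _ _ _ _ _ (@cos R)) => //.
by apply: continuous_measurable_fun; exact: continuous_cos.
Qed.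

Lemma measurable_pow_im c : measurable_fun setT (pow_im c).
Proof.
apply: measurable_funM => //; apply: (@measurableT_comp _ _ _ _ _ _ (@sin R)) => //.
by apply: continuous_measurable_fun; exact: continuous_sin.
Qed.

End complex_power.

Section operator_facts.
Context {R : realType}.
Local Open Scope complex_scope.
Variables (n : nat) (alpha c : R).
Hypotheses (n_gt0 : (0 < n)%N) (alpha_gtN1 : -1 < alpha).
Implicit Types (z w : n.-tuple R[i]) (f : n.-tuple R[i] -> R[i]) (b : bool).
Local Notation B := (@unit_ball R n).
Local Notation wv := (weighted_volume n alpha).
Local Notation D z w := (normc (1 - inner z w)).

Lemma Re_1B_inner_gt0 z w : B z -> B w -> 0 < complex.Re (1 - inner z w).
Proof.
move=> zB wB; rewrite Re_1B_inner.
by have := distsq_ge0 z w; move: zB wB; rewrite /unit_ball /= => ? ?; lra.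
Qed.

Lemma K_opE f b z : part b (K_op n alpha c f z) =
  (\int[wv]_(w in B) part b (f w / cpowR (1 - inner z w) c))%R.
Proof. by case: b. Qed.

Let fB f b := (part b \o f) \_ B.

(** On B x B this is part [b] of the integrand. The zero extension of f makes it jointly measurable
    on the whole space, where Tonelli's theorem is applied. *)
Let G f b (zw : n.-tuple R[i] * n.-tuple R[i]) : R :=
  fB f b zw.2 * pow_re c (1 - inner zw.1 zw.2) +
  (if b then 1 else -1) * (fB f (~~ b) zw.2 * pow_im c (1 - inner zw.1 zw.2)).

Let GE f b z w : B z -> B w -> part b (f w / cpowR (1 - inner z w) c) = G f b (z, w).
Proof.
move=> zB wB; rewrite /G /fB /= !patchE mem_set//= inv_cpowR ?Re_1B_inner_gt0//.
by case: (f w) => x y; case: b => /=; ring.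
Qed.

Let measurable_fB f b : measurable_fun B f -> measurable_fun setT (fB f b).
Proof.
move=> mf; apply/(measurable_restrictT _ (@measurable_unit_ball R n)).
exact: measurable_fun_part.
Qed.

Let measurable_G f b : measurable_fun B f -> measurable_fun setT (G f b).
Proof.
move=> mf.
have mre := measurableT_comp (measurable_pow_re c) (@measurable_1B_inner R n).
have mim := measurableT_comp (measurable_pow_im c) (@measurable_1B_inner R n).
have mfb b' : measurable_fun setT (fun zw : n.-tuple R[i] * n.-tuple R[i] => fB f b' zw.2).
  exact: measurableT_comp (measurable_fB b' mf) measurable_snd.
by apply: measurable_funD; [|apply: measurable_funM => //]; exact: measurable_funM.
Qed.

Lemma measurable_integrand f b z : B z -> measurable_fun B f ->
  measurable_fun B (fun w => part b (f w / cpowR (1 - inner z w) c)).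
Proof.
move=> zB mf; apply: (@eq_measurable_fun _ _ _ _ _ (fun w => G f b (z, w))).
  by move=> w /set_mem wB; rewrite GE.
by apply: measurable_funTS; apply: (measurable_fun_pair2 z (measurable_G b mf)).
Qed.

(** The integrals of the positive and of the negative part are measurable in z by Tonelli's theorem,
    with no integrability of f; [fine] of their difference is then measurable as well. *)
Lemma measurable_K_op f : measurable_fun B f -> measurable_fun B (K_op n alpha c f).
Proof.
move=> mf; have mB := @measurable_unit_ball R n.
pose wvs := sigma_finite_of (weighted_volume_sigma_finite n_gt0 alpha_gtN1).
pose k b z := fine (\int[wvs]_w (G f b (z, w))%:E).
have mGE b : measurable_fun setT (EFin \o G f b).
  by apply/measurable_EFinP; exact: measurable_G.
have mk b : measurable_fun setT (k b).
  apply: (@measurableT_comp _ _ _ _ _ _ (@fine R)); first exact: fine_measurable.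
  rewrite (_ : (fun z => _) = (fun z =>
     \int[wvs]_w (EFin \o G f b)^\+ (z, w) - \int[wvs]_w (EFin \o G f b)^\- (z, w)))%E.
    apply: emeasurable_funB.
      apply: (@measurable_fun_fubini_tonelli_F _ _ _ _ _ wvs ((EFin \o G f b)^\+)%E) => //.
      exact: measurable_funepos.
    apply: (@measurable_fun_fubini_tonelli_F _ _ _ _ _ wvs ((EFin \o G f b)^\-)%E) => //.
    exact: measurable_funeneg.
  apply/funext => z; rewrite [LHS]integralE.
  by congr (_ - _)%E; apply: eq_integral => w _; rewrite !(funeposE, funenegE).
apply: (@eq_measurable_fun _ _ _ _ _ (fun z => k true z +i* k false z)); last first.
  by apply: measurable_funTS; apply/measurable_complexP => -[];
    [exact: (mk true)|exact: (mk false)].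
move=> z /set_mem zB.
have kE b : part b (K_op n alpha c f z) = k b z.
  rewrite K_opE /k /Rintegral; congr fine.
  transitivity (\int[wv]_(w in B) (G f b (z, w))%:E)%E.
    by apply: eq_integral => w /set_mem wB; rewrite GE.
  rewrite integral_mkcond; apply: eq_integral => w _; rewrite patchE.
  case: ifPn => // /negPf wB.
  by rewrite /G /fB /= !patchE wB !mul0r mulr0 addr0.
by rewrite -!kE; case: (K_op n alpha c f z).
Qed.

Lemma normc_K_op_le f z : B z -> measurable_fun B f ->
  ((normc (K_op n alpha c f z))%:E <=
   2%:E * \int[wv]_(w in B) (normc (f w) * D z w `^ (- c))%:E)%E.
Proof.
move=> zB mf.
have mfz b := measurable_integrand b zB mf.
have hb b : (`|part b (K_op n alpha c f z)|%:E <=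
    \int[wv]_(w in B) (normc (f w) * D z w `^ (- c))%:E)%E.
  rewrite K_opE.
  apply: (@le_trans _ _ `| \int[wv]_(w in B) (part b (f w / cpowR (1 - inner z w) c))%:E|%E).
    (* An infinite integral becomes 0 under [fine], so the bound persists. *)
    rewrite /Rintegral; by case: (\int[_]_(_ in _) _)%E => [r| |] //=; rewrite normr0 ?leey.
  have mB := @measurable_unit_ball R n.
  apply: le_trans (le_abse_integral _ mB _) _; first exact/measurable_EFinP.
  apply: ge0_le_integral => //.
  - by apply: measurableT_comp => //; exact/measurable_EFinP.
  - apply/measurable_EFinP; apply: measurable_funM.
      exact: measurableT_comp (@measurable_normc R) mf.
    apply: measurable_funTS; apply: (measurableT_comp (measurable_powR _)).
    exact: (measurable_fun_pair2 z (@measurable_normc_1B_inner R n)).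
  - move=> w wB; rewrite lee_fin (le_trans (part_le_normc _ _))// normcM.
    by rewrite normc_inv_cpowR// Re_1B_inner_gt0.
apply: (@le_trans _ _ (`|part true (K_op n alpha c f z)| +
   `|part false (K_op n alpha c f z)|)%:E).
  by rewrite lee_fin normc_le_part.
by rewrite EFinD mule_natl mule2n leeD.
Qed.

End operator_facts.

(** * Sufficiency *)

Section sufficiency.
Context {R : realType}.
Variables (n : nat) (alpha c : R).
Hypotheses (n_gt0 : (0 < n)%N) (alpha_gtN1 : -1 < alpha).
Implicit Types (z w : n.-tuple R[i]) (f : n.-tuple R[i] -> R[i]) (p e : R).
Local Notation B := (@unit_ball R n).
Local Notation wv := (weighted_volume n alpha).
Local Notation D z w := (normc (1 - inner z w)).
Local Notation N := (n%:R + 1 + alpha).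

Lemma Lp_normE (p : R) f : 0 < p ->
  (Lp_norm alpha p%:E f = (\int[wv]_(z in B) (normc (f z) `^ p)%:E) `^ p^-1)%E.
Proof.
move=> p0; rewrite /Lp_norm unlock; congr (_ `^ _)%E.
rewrite [RHS]integral_mkcond; apply: eq_integral => z _.
rewrite !patchE; case: ifPn => _.
  by rewrite gee0_abs ?lee_fin ?normc_ge0// poweR_EFin.
by rewrite abse0 poweR_EFin powR0// gt_eqF.
Qed.

Let wvs := sigma_finite_of (weighted_volume_sigma_finite n_gt0 alpha_gtN1).

Let mB := @measurable_unit_ball R n.

Let measurable_D_powR (e : R) :
  measurable_fun setT (fun zw : n.-tuple R[i] * n.-tuple R[i] => D zw.1 zw.2 `^ e).
Proof.
by apply: (measurableT_comp (measurable_powR _)); exact: measurable_normc_1B_inner.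
Qed.

Let measurable_normc_fB f : measurable_fun B f ->
  measurable_fun setT ((@normc R \o f) \_ B : n.-tuple R[i] -> R).
Proof.
move=> mf; apply/(measurable_restrictT _ mB).
exact: measurableT_comp (@measurable_normc R) mf.
Qed.

Definition averaged_power (p e : R) f z : \bar R :=
  (\int[wv]_(w in B) (normc (f w) `^ p * D z w `^ (- e))%:E)%E.

Lemma averaged_power_ge0 p e f z : (0 <= averaged_power p e f z)%E.
Proof. by apply: integral_ge0 => w _; rewrite lee_fin mulr_ge0 ?powR_ge0. Qed.

Let averaged_powerE p e f z : 0 < p -> averaged_power p e f z =
  (\int[wvs]_w ((((@normc R \o f) \_ B) w `^ p * D z w `^ (- e))%:E))%E.
Proof.
move=> p0; rewrite /averaged_power integral_mkcond; apply: eq_integral => w _.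
rewrite !patchE; case: ifPn => // _.
by rewrite powR0 ?mul0r// gt_eqF.
Qed.

Let measurable_joint p e f : measurable_fun B f -> measurable_fun setT
  (fun zw : n.-tuple R[i] * n.-tuple R[i] =>
    (((@normc R \o f) \_ B) zw.2 `^ p * D zw.1 zw.2 `^ (- e))%:E).
Proof.
move=> mf; apply/measurable_EFinP; apply: measurable_funM => //.
apply: (measurableT_comp (measurable_powR _)).
exact: measurableT_comp (measurable_normc_fB mf) measurable_snd.
Qed.

Lemma measurable_averaged_power p e f : 0 < p -> measurable_fun B f ->
  measurable_fun setT (averaged_power p e f).
Proof.
move=> p0 mf; have /funext -> := fun z => averaged_powerE e f z p0.
apply: (@measurable_fun_fubini_tonelli_F _ _ _ _ _ wvs (fun zw =>
  (((@normc R \o f) \_ B) zw.2 `^ p * D zw.1 zw.2 `^ (- e))%:E)).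
  exact: measurable_joint.
by move=> zw; rewrite lee_fin mulr_ge0 ?powR_ge0.
Qed.

(** Exchange the integrals: the inner one, over z, is bounded uniformly in w by
    [kernel_integral]. *)
Lemma integral_averaged_power p e : 0 < p -> e < N -> exists2 C : R, 0 <= C &
  forall f, measurable_fun B f ->
  (\int[wv]_(z in B) averaged_power p e f z <=
   C%:E * \int[wv]_(w in B) (normc (f w) `^ p)%:E)%E.
Proof.
move=> p0 eN; have [C C0 hC] := kernel_integral n_gt0 alpha_gtN1 eN.
exists C => // f mf; pose g := (@normc R \o f) \_ B.
have mg := measurable_normc_fB mf.
pose F zw := (g zw.2 `^ p * D zw.1 zw.2 `^ (- e) * \1_B zw.1)%:E.
have mF : measurable_fun setT F.
  apply/measurable_EFinP; apply: measurable_funM.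
    by apply/measurable_EFinP; exact: measurable_joint.
  by apply: (measurableT_comp _ measurable_fst); exact: measurable_indic.
have F0 zw : (0 <= F zw)%E by rewrite lee_fin !mulr_ge0 ?powR_ge0.
have -> : (\int[wv]_(z in B) averaged_power p e f z =
    \int[wvs]_z \int[wvs]_w F (z, w))%E.
  rewrite integral_mkcond; apply: eq_integral => z _; rewrite patchE.
  case: ifPn => [zB|/negPf zB].
    rewrite averaged_powerE//; apply: eq_integral => w _.
    by rewrite /F /= indicE zB mulr1.
  rewrite integral0_eq// => w _.
  by rewrite /F /= indicE zB mulr0.
rewrite fubini_tonelli//.
apply: (@le_trans _ _ (\int[wvs]_w ((g w `^ p)%:E * C%:E))%E).
  apply: ge0_le_integral => //.
  - by move=> w _; apply: integral_ge0.
  - exact: (@measurable_fun_fubini_tonelli_G _ _ _ _ _ wvs F).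
  - apply: emeasurable_funM => //; apply/measurable_EFinP.
    exact: measurableT_comp (measurable_powR _) mg.
  - move=> w _; rewrite /F /g /= patchE; case: ifPn => [/set_mem wB|_]; last first.
      rewrite powR0 ?gt_eqF// mul0e; rewrite integral0_eq// => z _.
      by rewrite !mul0r.
    apply: (@le_trans _ _ ((normc (f w) `^ p)%:E *
       \int[wv]_(z in B) (D z w `^ (- e))%:E)%E); last first.
      by rewrite lee_wpmul2l ?lee_fin ?powR_ge0// hC.
    rewrite -ge0_integralZl//; last 3 first.
    + apply: measurable_funTS; apply/measurable_EFinP.
      exact: (measurable_fun_pair1 w (measurable_D_powR (- e))).
    + by move=> z _; rewrite lee_fin powR_ge0.
    + by rewrite lee_fin powR_ge0.
    rewrite [leRHS]integral_mkcond le_eqVlt; apply/orP; left; apply/eqP.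
    apply: eq_integral => z _; rewrite patchE indicE.
    by case: ifPn => _; rewrite ?mulr1 ?mulr0// EFinM.
rewrite ge0_integralZr//; last 2 first.
- by apply/measurable_EFinP; exact: measurableT_comp (measurable_powR _) mg.
- by move=> w _; rewrite lee_fin powR_ge0.
rewrite muleC lee_wpmul2l ?lee_fin// [leRHS]integral_mkcond le_eqVlt; apply/orP; left.
apply/eqP; apply: eq_integral => w _; rewrite /g !patchE; case: ifPn => // _.
by rewrite powR0// gt_eqF.
Qed.

(** Hoelder's inequality for |f| D^(-e/p) and D^-k2 with k2 = c - e/p. Here k2 p' = t p' + e: the
    part t p' is estimated by D >= V/2, and the remaining D^-e is integrable since e < N. *)
Lemma normc_K_op_le_power (p tau : R) : 1 < p -> 0 < tau -> N < c -> exists2 C : R, 0 <= C &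
  forall f z, measurable_fun B f -> B z ->
  ((normc (K_op n alpha c f z))%:E <=
   (C * (1 - normsq z) `^ (- (c - N + tau)))%:E *
   averaged_power p (N - tau) f z `^ p^-1)%E.
Proof.
move=> p1 tau0 Nc; set e := N - tau; set t := c - N + tau.
have p0 : 0 < p by lra.
have t0 : 0 <= t by rewrite /t; lra.
have [|C0 C00 hC0] := @kernel_integral R n alpha n_gt0 alpha_gtN1 e; first by rewrite /e; lra.
pose p' := (1 - p^-1)^-1.
have pV1 : p^-1 < 1 by rewrite invf_lt1.
have p'0 : 0 < p' by rewrite invr_gt0 subr_gt0.
have pp' : p^-1 + p'^-1 = 1 by rewrite invrK addrC subrK.
pose k2 := c - e / p.
have k2p' : k2 * p' = t * p' + e.
  have -> : k2 = t + e * (1 - p^-1) by rewrite /k2 /t /e; ring.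
  by rewrite mulrDl -mulrA divff ?mulr1// gt_eqF// subr_gt0.
exists (2 * (2 `^ t * C0 `^ p'^-1)).
  by rewrite !mulr_ge0 ?powR_ge0.
move=> f z mf zB; have V0 : 0 < 1 - normsq z by rewrite subr_gt0.
have mDz a : measurable_fun setT (fun w => D z w `^ a).
  apply: (measurableT_comp (measurable_powR _)).
  exact: (measurable_fun_pair2 z (@measurable_normc_1B_inner R n)).
apply: le_trans (normc_K_op_le alpha c zB mf) _.
rewrite -mulrA EFinM -muleA lee_wpmul2l ?lee_fin//.
pose F1 w := ((@normc R \o f) \_ B) w * D z w `^ (- (e / p)).
pose F2 w := \1_B w * D z w `^ (- k2) : R.
have mF1 : measurable_fun setT F1 by apply: measurable_funM => //; exact: measurable_normc_fB.
have mF2 : measurable_fun setT F2 by apply: measurable_funM => //; exact: measurable_indic.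
have H := hoelder wv mF1 mF2 p0 p'0 pp'.
have -> : (\int[wv]_(w in B) (normc (f w) * D z w `^ (- c))%:E)%E =
    'N[wv]_1[EFin \o (F1 \* F2)%R]%E.
  rewrite Lnorm1 [LHS]integral_mkcond; apply: eq_integral => w _; rewrite patchE /F1 /F2 /=.
  rewrite patchE indicE; case: ifPn => [/set_mem wB|_]; last by rewrite !mul0r normr0.
  rewrite mul1r -mulrA -powRD; last by rewrite (gt_eqF (normc_1B_inner_gt0 zB wB)) ?implybT.
  have -> : - (e / p) + - k2 = - c by rewrite /k2; ring.
  by rewrite ger0_norm// mulr_ge0 ?powR_ge0// normc_ge0.
apply: (le_trans H); rewrite muleC.
apply: lee_pmul; rewrite ?Lnorm_ge0//; last first.
  rewrite unlock le_eqVlt; apply/orP; left; apply/eqP; congr (_ `^ _)%E.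
  rewrite [RHS]integral_mkcond; apply: eq_integral => w _.
  rewrite patchE /F1 /= patchE; case: ifPn => [_|_]; last first.
    by rewrite mul0r normr0 powR0 ?gt_eqF.
  rewrite normrM ger0_norm ?normc_ge0// ger0_norm ?powR_ge0// powRM ?normc_ge0 ?powR_ge0//.
  by rewrite -powRrM mulNr divfK ?gt_eqF.
rewrite unlock; have -> : (\int[wv]_x (`|(EFin \o F2) x| `^ p') =
    \int[wv]_(w in B) (D z w `^ (- (k2 * p')))%:E)%E.
  rewrite [RHS]integral_mkcond; apply: eq_integral => w _.
  rewrite patchE /F2 /= indicE; case: ifPn => [_|_]; last first.
    by rewrite mul0r normr0 powR0 ?gt_eqF.
  by rewrite mul1r ger0_norm ?powR_ge0// -powRrM mulNr.
have hI : (\int[wv]_(w in B) (D z w `^ (- (k2 * p')))%:E <=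
    (((1 - normsq z) / 2) `^ (- (t * p')) * C0)%:E)%E.
  apply: (@le_trans _ _ (\int[wv]_(w in B)
      ((((1 - normsq z) / 2) `^ (- (t * p')))%:E * (D w z `^ (- e))%:E))%E).
    apply: ge0_le_integral => //.
    - by move=> w _; rewrite lee_fin powR_ge0.
    - by apply/measurable_EFinP; exact: measurable_funTS.
    - apply: measurable_funeM; apply/measurable_EFinP; apply: measurable_funTS.
      by apply: (measurableT_comp (measurable_powR _)); exact: measurable_normc_1B_inner1.
    - move=> w wB; have D0 := normc_1B_inner_gt0 zB wB.
      rewrite -EFinM lee_fin k2p' opprD powRD; last by rewrite (gt_eqF D0) implybT.
      rewrite [D w z]normc_1B_innerC ler_wpM2r ?powR_ge0//.
      apply: powRN_le; [exact: (mulr_ge0 t0 (ltW p'0))|by rewrite divr_gt0|].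
      by rewrite ler_pdivrMr// mulrC onemB_normsq_le_normc.
  rewrite ge0_integralZl//; last 3 first.
  - apply/measurable_EFinP; apply: measurable_funTS.
    by apply: (measurableT_comp (measurable_powR _)); exact: measurable_normc_1B_inner1.
  - by move=> w _; rewrite lee_fin powR_ge0.
  - by rewrite lee_fin powR_ge0.
  by rewrite EFinM lee_wpmul2l ?lee_fin ?powR_ge0// hC0.
have p'V : 0 <= p'^-1 by rewrite invr_ge0 ltW.
apply: le_trans (gt0_ler_poweR p'V _ _ hI) _.
- by rewrite in_itv /= leey andbT integral_ge0// => w _; rewrite lee_fin powR_ge0.
- by rewrite in_itv /= leey andbT lee_fin mulr_ge0// powR_ge0.
rewrite poweR_EFin lee_fin powRM ?powR_ge0// -powRrM mulNr mulfK ?gt_eqF//.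
rewrite mulrAC ler_wpM2r ?powR_ge0//.
rewrite powRM ?invr_ge0 ?(ltW V0)// [leLHS]mulrC ler_wpM2r ?powR_ge0//.
by rewrite -powR_inv1// -powRrM mulN1r opprK.
Qed.

Lemma integral_K_op_le (p q : R) : N < c -> 1 <= q ->
  p^-1 + (c - N) / (1 + alpha) < q^-1 -> 0 < p -> exists2 M : R, 0 <= M &
  forall f A, measurable_fun B f -> 0 < A ->
  (\int[wv]_(z in B) (normc (f z) `^ p)%:E <= A%:E)%E ->
  (\int[wv]_(z in B) (normc (K_op n alpha c f z) `^ q)%:E <= (M * A `^ (q / p))%:E)%E.
Proof.
move=> Nc q1 hpq p0; have a1 : 0 < 1 + alpha by have := alpha_gtN1; lra.
have q0 : 0 < q by lra.
have s0 : 0 < (c - N) / (1 + alpha) by rewrite divr_gt0// subr_gt0.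
have p1 : 1 < p.
  rewrite -[p]invrK invf_gt1 ?invr_gt0//; apply: (@lt_le_trans _ _ q^-1); first lra.
  by rewrite invf_le1.
pose r := (q^-1 - p^-1)^-1.
have r0 : 0 < r by rewrite invr_gt0; lra.
have rq : p^-1 + r^-1 = q^-1 by rewrite invrK; ring.
(* This makes t = c - N + tau the midpoint of c - N and (1 + alpha) / r, whence tau > 0 and t r < 1
   + alpha. *)
pose tau := ((1 + alpha) / r - (c - N)) / 2.
have hr : (c - N) < (1 + alpha) / r.
  by rewrite -ltr_pdivrMl// mulrC invrK; lra.
have tau0 : 0 < tau by rewrite divr_gt0// subr_gt0.
set t := c - N + tau.
have t0 : 0 < t by rewrite /t; lra.
have tr : t * r < 1 + alpha by rewrite -ltr_pdivlMr// /t /tau; lra.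
have [C1 C10 hC1] := normc_K_op_le_power p1 tau0 Nc.
have [|C2 C20 hC2] := @integral_averaged_power p (N - tau) p0; first lra.
have [C3 C30 hC3] := @weight_integral R n alpha n_gt0 alpha_gtN1 _ tr.
(* The summand 1 keeps the constant positive, so that an infinite [I z] makes the right side
   infinite. *)
pose k := (C1 + 1) `^ q; have k0 : 0 < k by rewrite powR_gt0//; lra.
exists (k * (C2 + C3)); first exact: mulr_ge0 (ltW k0) (addr_ge0 C20 C30).
move=> f A mf A0 fA; pose I := averaged_power p (N - tau) f.
have I0 z : (0 <= I z)%E := averaged_power_ge0 _ _ _ _.
have mI : measurable_fun setT I := measurable_averaged_power (N - tau) p0 mf.
set kA := k * A `^ (q / p); have kA0 : 0 < kA by exact: mulr_gt0 k0 (powR_gt0 _ A0).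
have mV : measurable_fun setT (fun z : n.-tuple R[i] => (1 - normsq z) `^ (- (t * r))).
  apply: (measurableT_comp (measurable_powR _)).
  by apply: measurable_funB => //; exact: measurable_normsq.
have pointwise z : B z -> ((normc (K_op n alpha c f z) `^ q)%:E <=
    kA%:E * ((A^-1)%:E * I z + ((1 - normsq z) `^ (- (t * r)))%:E))%E.
  move=> zB; have V0 : 0 < 1 - normsq z by rewrite subr_gt0.
  have := hC1 f z mf zB; rewrite -/t -/(I z); have := I0 z.
  case: (I z) => [i i0| _ _|//]; last first.
    by rewrite gt0_muley ?lte_fin ?invr_gt0// addye// gt0_muley ?leey.
  rewrite poweR_EFin -!EFinM !lee_fin => hK.
  apply: (@le_trans _ _ (((C1 + 1) * (1 - normsq z) `^ (- t) * i `^ p^-1) `^ q)).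
    apply: ge0_ler_powR; rewrite ?nnegrE ?(ltW q0) ?normc_ge0//.
      by rewrite mulr_ge0 ?powR_ge0// mulr_ge0 ?powR_ge0//; lra.
    apply: le_trans hK _; apply: ler_wpM2r; rewrite ?powR_ge0//.
    by apply: ler_wpM2r; rewrite ?powR_ge0//; lra.
  rewrite powRM ?mulr_ge0 ?powR_ge0//; last lra.
  rewrite powRM ?powR_ge0//; last lra.
  rewrite -/k -mulrA /kA -mulrA; apply: ler_wpM2l; first exact: ltW.
  (* Normalizing by A before Young's inequality makes both of its terms integrate to O(1);
     homogeneity then restores the factor A^(q/p). *)
  have -> : i = A * (A^-1 * i) by rewrite mulrA divff ?mul1r// gt_eqF.
  set x := A^-1 * i; have x0 : 0 <= x by rewrite mulr_ge0// invr_ge0 ltW.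
  rewrite -!powRrM powRM ?(ltW A0)// [p^-1 * q]mulrC mulrCA.
  apply: ler_wpM2l; first exact: powR_ge0.
  have := @conjugate_powR _ (x `^ (q / p)) ((1 - normsq z) `^ (- t * q)) (p / q) (r / q)
    (powR_ge0 _ _) (powR_ge0 _ _) (divr_gt0 p0 q0) (divr_gt0 r0 q0).
  rewrite -!powRrM !invf_div -mulrDr rq divff ?gt_eqF// => /(_ erefl).
  have -> : q / p * (p / q) = 1 by field; rewrite !gt_eqF.
  have -> : - t * q * (r / q) = - (t * r) by field; rewrite gt_eqF.
  rewrite powRr1// => h; rewrite [A^-1 * _]mulrA mulVf ?gt_eqF// mul1r [leLHS]mulrC.
  apply: le_trans h _.
  have qp1 : q / p <= 1 by rewrite ler_pdivrMr// mul1r -lef_pV2 ?posrE//; lra.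
  have qr1 : q / r <= 1 by rewrite ler_pdivrMr// mul1r -lef_pV2 ?posrE//;
    have := p0; rewrite -invr_gt0; lra.
  apply: lerD; first by rewrite -[leRHS]mulr1 ler_wpM2l.
  by rewrite -[leRHS]mulr1 ler_wpM2l// powR_ge0.
apply: (@le_trans _ _ (\int[wv]_(z in B)
    (kA%:E * ((A^-1)%:E * I z + ((1 - normsq z) `^ (- (t * r)))%:E)))%E).
  apply: ge0_le_integral => //.
  - by move=> z _; rewrite lee_fin powR_ge0.
  - apply/measurable_EFinP; apply: (measurableT_comp (measurable_powR _)).
    apply: (measurableT_comp (@measurable_normc R)).
    exact: measurable_K_op.
  - apply: measurable_funTS; apply: measurable_funeM; apply: emeasurable_funD.
      exact: measurable_funeM.
    exact/measurable_EFinP.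
have AV0 : 0 <= A^-1 by rewrite invr_ge0 ltW.
rewrite ge0_integralZl//; last 3 first.
- apply: measurable_funTS; apply: emeasurable_funD; first exact: measurable_funeM.
  exact/measurable_EFinP.
- by move=> z _; rewrite adde_ge0 ?mule_ge0 ?lee_fin ?powR_ge0.
- by rewrite lee_fin ltW.
rewrite ge0_integralD//; last 4 first.
- by move=> z _; rewrite mule_ge0.
- by apply: measurable_funTS; exact: measurable_funeM.
- by move=> z _; rewrite lee_fin powR_ge0.
- by apply: measurable_funTS; exact/measurable_EFinP.
rewrite ge0_integralZl//; last exact: measurable_funTS.
have h2 : ((A^-1)%:E * \int[wv]_(z in B) I z <= C2%:E)%E.
  apply: (@le_trans _ _ ((A^-1)%:E * (C2%:E * A%:E))%E).
    apply: lee_wpmul2l; first by rewrite lee_fin.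
    by apply: le_trans (hC2 f mf) _; rewrite lee_wpmul2l ?lee_fin.
  by rewrite -!EFinM lee_fin mulrCA mulVf ?gt_eqF// mulr1.
apply: le_trans (lee_wpmul2l _ (leeD h2 hC3)) _; first by rewrite lee_fin ltW.
by rewrite -EFinD -EFinM lee_fin /kA mulrAC.
Qed.

Lemma Lp_norm_le (p b : R) f : 0 < p -> 0 <= b ->
  (Lp_norm alpha p%:E f <= b%:E)%E <->
  (\int[wv]_(z in B) (normc (f z) `^ p)%:E <= (b `^ p)%:E)%E.
Proof.
move=> p0 b0; rewrite Lp_normE//; set J := integral _ _ _.
have J0 : (0 <= J)%E by apply: integral_ge0 => z _; rewrite lee_fin powR_ge0.
have pK x : (0 <= x)%E -> ((x `^ p^-1) `^ p = x)%E.
  by move=> x0; rewrite -poweRrM mulVf ?gt_eqF// poweRe1.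
split => h.
  rewrite -[J]pK// -poweR_EFin; apply: gt0_ler_poweR => //; first exact: ltW.
    by rewrite in_itv /= leey poweR_ge0.
  by rewrite in_itv /= leey lee_fin b0.
have -> : b%:E = (((b `^ p)%:E) `^ p^-1)%E.
  by rewrite poweR_EFin -powRrM divff ?gt_eqF// powRr1.
apply: gt0_ler_poweR => //; first by rewrite invr_ge0 ltW.
  by rewrite in_itv /= leey J0.
by rewrite in_itv /= leey lee_fin powR_ge0.
Qed.

Lemma Lp_norm_oo_ae f b : (Lp_norm alpha +oo%E f <= b%:E)%E ->
  {ae wv, forall z, B z -> normc (f z) <= b}.
Proof.
rewrite /Lp_norm unlock; case: ifPn => [_ /ess_supP|].
  apply: filterS => z /= + zB; rewrite patchE mem_set//= lee_fin.
  exact/le_trans/ler_norm.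
rewrite -leNgt measure_le0 => /eqP wv0 _.
by exists setT; split.
Qed.

Lemma integral_le_Lp_norm_oo (P b : R) f : 0 <= P -> 0 <= b -> measurable_fun B f ->
  (Lp_norm alpha +oo%E f <= b%:E)%E ->
  (\int[wv]_(z in B) (normc (f z) `^ P)%:E <= (b `^ P)%:E * wv B)%E.
Proof.
move=> P0 b0 mf /Lp_norm_oo_ae hf.
rewrite -integral_cst//; apply: ae_ge0_le_integral => //.
- by move=> z _; rewrite lee_fin powR_ge0.
- apply/measurable_EFinP; apply: (measurableT_comp (measurable_powR _)).
  exact: measurableT_comp (@measurable_normc R) mf.
- by move=> z _; rewrite lee_fin powR_ge0.
- apply: filterS hf => z h zB; rewrite lee_fin ge0_ler_powR// ?nnegrE ?normc_ge0//.
  exact: h.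
Qed.

(** Asking only for positive bounds b avoids the case of a zero norm; b then decreases to the
    norm. *)
Lemma bounded_Lp_Lq_le (p q : \bar R) M : 0 <= M ->
  (forall f b, measurable_fun B f -> 0 < b -> (Lp_norm alpha p f <= b%:E)%E ->
    (Lp_norm alpha q (K_op n alpha c f) <= (M * b)%:E)%E) ->
  bounded_Lp_Lq alpha p q (K_op n alpha c).
Proof.
move=> M0 h; exists M => f [mf foo].
have f0 : (0 <= Lp_norm alpha p f)%E by exact: Lnorm_ge0.
have ffin : Lp_norm alpha p f \is a fin_num by rewrite ge0_fin_numE.
have f1 : 0 < fine (Lp_norm alpha p f) + 1 by rewrite ltr_wpDl// fine_ge0.
split.
  split; first exact: measurable_K_op.
  apply: le_lt_trans (h f _ mf f1 _) (ltry _).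
  by rewrite EFinD fineK// leeDl.
apply/lee_addgt0Pr => e e0.
have b0 : 0 < fine (Lp_norm alpha p f) + e / (M + 1).
  by rewrite ltr_wpDl ?fine_ge0// divr_gt0//; lra.
apply: le_trans (h f _ mf b0 _) _.
  by rewrite EFinD fineK// leeDl// lee_fin divr_ge0//; lra.
rewrite mulrDr EFinD EFinM fineK// leeD2l// lee_fin mulrCA.
by rewrite -[leRHS]mulr1 ler_wpM2l ?(ltW e0)// ler_pdivrMr; lra.
Qed.

Lemma K_op_bounded (p : \bar R) (q : R) : N < c -> 1 <= q -> (1 <= p)%E ->
  (p^-1 + ((c - N) / (1 + alpha))%:E < (q^-1)%:E)%E ->
  bounded_Lp_Lq alpha p q%:E (K_op n alpha c).
Proof.
move=> Nc q1; have q0 : 0 < q by lra.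
have a1 : 0 < 1 + alpha by have := alpha_gtN1; lra.
case: p => [p| _|//].
  rewrite lee_fin => p1; have p0 : 0 < p by lra.
  rewrite inver gt_eqF// -EFinD lte_fin => hpq.
  have [M M0 hM] := integral_K_op_le Nc q1 hpq p0.
  apply: (@bounded_Lp_Lq_le _ _ (M `^ q^-1)); first exact: powR_ge0.
  move=> f b mf b0 /(Lp_norm_le _ p0 (ltW b0)) hf.
  apply/Lp_norm_le => //; first by rewrite mulr_ge0 ?powR_ge0// ltW.
  apply: le_trans (hM f _ mf (powR_gt0 _ b0) hf) _.
  rewrite lee_fin -powRrM powRM ?powR_ge0 ?(ltW b0)// -powRrM mulVf ?gt_eqF// powRr1//.
  by rewrite [p * _]mulrC divfK ?gt_eqF.
rewrite invey add0e lte_fin => hq.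
(* For p = oo, pass to a finite exponent P: on a finite measure the L^P norm is controlled by the
   L^oo norm. Here 1/P is half of the available gap. *)
pose P := 2 / (q^-1 - (c - N) / (1 + alpha)).
have P0 : 0 < P by rewrite divr_gt0// subr_gt0.
have hPq : P^-1 + (c - N) / (1 + alpha) < q^-1 by rewrite /P invf_div; lra.
have [M M0 hM] := integral_K_op_le Nc q1 hPq P0.
have wvB : wv B \is a fin_num.
  rewrite ge0_fin_numE// -weighted_volume_setT//; exact: weighted_volume_lty.
pose V := fine (wv B) + 1.
have V0 : 0 < V by rewrite ltr_wpDl// fine_ge0.
apply: (@bounded_Lp_Lq_le _ _ (M `^ q^-1 * V `^ P^-1)).
  by rewrite mulr_ge0 ?powR_ge0.
move=> f b mf b0 hf; have bV0 : 0 < b `^ P * V by rewrite mulr_gt0// powR_gt0.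
apply/Lp_norm_le => //; first by rewrite !mulr_ge0 ?powR_ge0// ltW.
apply: le_trans (hM f _ mf bV0 _) _.
  apply: le_trans (integral_le_Lp_norm_oo (ltW P0) (ltW b0) mf hf) _.
  by rewrite EFinM lee_wpmul2l ?lee_fin ?powR_ge0// /V EFinD fineK// leeDl.
rewrite lee_fin !powRM ?mulr_ge0 ?powR_ge0 ?(ltW b0) ?(ltW V0)// -!powRrM.
rewrite mulVf ?gt_eqF// powRr1// [P * _]mulrCA divff ?gt_eqF// mulr1.
by rewrite -!mulrA [P^-1 * q]mulrC [b `^ q * _]mulrC.
Qed.

End sufficiency.

(** * Random signs and cells *)

Section finite_means.
Context {R : realType} {I : finType}.

(** Jensen's inequality for the power q: with m the mean, sum Young's inequality x m^(q-1) <= x^q /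
    q + m^q (1 - 1/q). For q = 1 the conjugate exponent is missing, hence the separate case. *)
Lemma sum_powR_ge (q : R) (x : I -> R) : 1 <= q -> (forall i, 0 <= x i) ->
  #|I|%:R * ((\sum_i x i) / #|I|%:R) `^ q <= \sum_i x i `^ q.
Proof.
move=> q1 x0; have q0 : 0 < q by lra.
have [->|I0] := posnP #|I|; first by rewrite mul0r sumr_ge0// => i _; exact: powR_ge0.
have N0 : 0 < #|I|%:R :> R by rewrite ltr0n.
set N : R := #|I|%:R in N0 *; set m := (\sum_i x i) / N.
have m0 : 0 <= m by rewrite divr_ge0 ?(ltW N0)// sumr_ge0.
have [->|q1'] := eqVneq q 1.
  by rewrite powRr1// mulrC divfK ?gt_eqF//; under [leRHS]eq_bigr do rewrite powRr1//.
have q1'' : 0 < q - 1 by rewrite subr_gt0 lt_neqAle eq_sym q1'.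
have young i : x i * m `^ (q - 1) <= x i `^ q / q + m `^ q * (1 - q^-1).
  have q'0 : 0 < q / (q - 1) by rewrite divr_gt0.
  have := @conjugate_powR _ (x i) (m `^ (q - 1)) q (q / (q - 1)) (x0 i) (powR_ge0 _ _) q0 q'0.
  rewrite -powRrM (_ : (q - 1) * _ = q); last by field; rewrite gt_eqF.
  rewrite (_ : (q / (q - 1))^-1 = (q - 1) / q); last by rewrite invf_div.
  have -> : (q - 1) / q = 1 - q^-1 by field; rewrite gt_eqF.
  by move=> h; apply: h; rewrite addrC subrK.
have : \sum_i x i * m `^ (q - 1) <= \sum_i (x i `^ q / q + m `^ q * (1 - q^-1)).
  by apply: ler_sum => i _; exact: young.
rewrite big_split /= -!mulr_suml sumr_const -mulr_natl -/N.
have -> : \sum_i x i = N * m by rewrite mulrC divfK ?gt_eqF.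
have -> : N * m * m `^ (q - 1) = N * m `^ q.
  rewrite -mulrA -{1}[m]powRr1// -powRD; last by rewrite addrC subrK gt_eqF.
  by rewrite addrC subrK.
move=> h; have {}h : N * m `^ q / q <= (\sum_i x i `^ q) / q.
  by move: h; rewrite mulrBr mulr1; set A := _ / q; set B := _ / q; lra.
by move: h; rewrite ler_pM2r ?invr_gt0.
Qed.

(* Flipping the sign of [j] is an involution, which kills the terms [j != i]. *)
Lemma sum_signs (x : I -> R) (i : I) :
  \sum_(eps : {ffun I -> bool}) (-1) ^+ eps i * (\sum_j (-1) ^+ eps j * x j) =
  #|{ffun I -> bool}|%:R * x i.
Proof.
under eq_bigr do rewrite mulr_sumr; rewrite exchange_big /= (bigD1 i)//=.
rewrite [X in _ + X]big1 ?addr0; last first.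
  move=> j ji; pose flip (eps : {ffun I -> bool}) := [ffun k => eps k (+) (k == j)].
  have flipK : involutive flip.
    by move=> eps; apply/ffunP => k; rewrite !ffunE -addbA addbb addbF.
  set S := \sum_(_ | _) _; suff : S = - S by move=> h; lra.
  rewrite /S [LHS](reindex_inj (inv_inj flipK))/= -sumrN; apply: eq_bigr => eps _.
  by rewrite !ffunE eq_sym (negPf ji) eqxx addbF addbT signrN; ring.
under eq_bigr do rewrite mulrA -expr2 sqrr_sign mul1r.
by rewrite mulr_natl sumr_const.
Qed.

End finite_means.

Section random_signs.
Context {R : realType}.
Variables (n : nat) (alpha c : R).
Hypotheses (n_gt0 : (0 < n)%N) (alpha_gtN1 : -1 < alpha) (c_ge0 : 0 <= c).
Implicit Types (z w : n.-tuple R[i]).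
Local Notation B := (@unit_ball R n).
Local Notation wv := (weighted_volume n alpha).
Local Open Scope complex_scope.

Let mB := @measurable_unit_ball R n.

Lemma weighted_volume_fin_num A : measurable A -> wv A \is a fin_num.
Proof.
move=> mA; rewrite ge0_fin_numE//.
apply: le_lt_trans (weighted_volume_lty n_gt0 alpha_gtN1).
by apply: le_measure; rewrite ?inE.
Qed.

Lemma integrable_pow_re z (g : n.-tuple R[i] -> R) (M : R) : B z ->
  measurable_fun setT g -> (forall w, `|g w| <= M) ->
  wv.-integrable B (fun w => (g w * pow_re c (1 - inner z w))%:E).
Proof.
move=> zB mg gM; have V0 : 0 < 1 - normsq z by rewrite subr_gt0.
apply: (@le_integrable _ _ _ _ _ mB _
   (EFin \o cst (M * ((1 - normsq z) / 2) `^ (- c)))).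
- apply/measurable_EFinP; apply: measurable_funTS; apply: measurable_funM => //.
  apply: (measurableT_comp (measurable_pow_re c)).
  exact: (measurable_fun_pair2 z (@measurable_1B_inner R n)).
- move=> w wB /=; rewrite lee_fin normrM [leRHS]ger0_norm; last first.
    by rewrite mulr_ge0 ?powR_ge0// (le_trans _ (gM w)).
  apply: ler_pM => //; rewrite /pow_re normrM ger0_norm ?powR_ge0//.
  rewrite -[leRHS]mulr1; apply: ler_pM; rewrite ?powR_ge0//.
    apply: powRN_le; rewrite ?divr_gt0//.
    by rewrite ler_pdivrMr// mulrC onemB_normsq_le_normc.
  by rewrite ler_norml cos_geN1 cos_le1.
- apply: measurable_bounded_integrable => //; last exact: bounded_cst.
  by rewrite -ge0_fin_numE// weighted_volume_fin_num.
Qed.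

Section signs.
Context {I : finType}.
Variables (E : I -> set (n.-tuple R[i])) (a : I -> R).
Hypotheses (mE : forall i, measurable (E i)) (EB : forall i, E i `<=` B).
Hypotheses (tE : forall i j z, E i z -> E j z -> i = j).

Let integrable_pow_re_cell i z : B z ->
  wv.-integrable (E i) (fun w => (pow_re c (1 - inner z w))%:E).
Proof.
move=> zB; apply: (integrableS mB (mE i) (EB (i := i))).
rewrite (_ : (fun w => _) = (fun w => (cst 1 w * pow_re c (1 - inner z w))%:E)); last first.
  by apply/funext => w; rewrite mul1r.
by apply: (@integrable_pow_re z _ 1) => // w; rewrite normr1.
Qed.

Definition signed_step (eps : {ffun I -> bool}) z : R :=
  \sum_i (-1) ^+ eps i * (a i * \1_(E i) z).

Lemma measurable_signed_step eps : measurable_fun setT (signed_step eps).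
Proof.
apply: measurable_sum => i; apply: measurable_funM => //.
by apply: measurable_funM => //; exact: measurable_indic.
Qed.

Lemma measurable_signed_stepC eps :
  measurable_fun setT (fun w => (signed_step eps w)%:C).
Proof.
by apply/measurable_complexP => -[]; [exact: (measurable_signed_step eps)|exact: measurable_cst].
Qed.

Lemma signed_step_le eps z : `|signed_step eps z| <= \sum_i `|a i|.
Proof.
apply: le_trans (ler_norm_sum _ _ _) _; apply: ler_sum => i _.
rewrite normrM normr_sign mul1r normrM ler_piMr// ger0_norm// indicE.
Qed.

Lemma signed_step_in eps i z : E i z -> signed_step eps z = (-1) ^+ eps i * a i.
Proof.
move=> iz; rewrite /signed_step (bigD1 i)//= big1 ?addr0.
  by rewrite indicE mem_set// mulr1.
move=> j ji; rewrite indicE memNset ?mulr0// => jz.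
by move: ji; rewrite (tE jz iz) eqxx.
Qed.

Lemma signed_step_out eps z : (forall i, ~ E i z) -> signed_step eps z = 0.
Proof.
by move=> h; apply: big1 => i _; rewrite indicE memNset ?mulr0//; exact: h.
Qed.

Lemma Re_K_op_signed eps z : B z ->
  part true (K_op n alpha c (fun w => (signed_step eps w)%:C) z) =
  (\int[wv]_(w in B) (signed_step eps w * pow_re c (1 - inner z w)))%R.
Proof.
move=> zB; rewrite K_opE; congr fine; apply: eq_integral => w /set_mem wB.
by rewrite inv_cpowR ?Re_1B_inner_gt0//=; congr EFin; ring.
Qed.

(** The operator is linear in the step function, so [sum_signs] applies under the integral and only
    the cell [E i] survives. *)
Lemma sum_signs_K_op i z : B z ->
  \sum_(eps : {ffun I -> bool})
    (-1) ^+ eps i * part true (K_op n alpha c (fun w => (signed_step eps w)%:C) z) =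
  #|{ffun I -> bool}|%:R * a i *
    (\int[wv]_(w in E i) (pow_re c (1 - inner z w)))%R.
Proof.
move=> zB; pose P w := pow_re c (1 - inner z w).
have iP eps := integrable_pow_re zB (measurable_signed_step eps) (signed_step_le eps).
apply: EFin_inj; rewrite -sumEFin.
transitivity (\sum_(eps : {ffun I -> bool})
   \int[wv]_(w in B) (((-1) ^+ eps i)%:E * (signed_step eps w * P w)%:E))%E.
  apply: eq_bigr => eps _; rewrite integralZl// Re_K_op_signed// EFinM.
  by rewrite fineK// integrable_fin_num.
rewrite -integral_sum//; last by move=> eps; exact: integrableZl.
transitivity (\int[wv]_(w in B) ((#|{ffun I -> bool}|%:R * a i)%:E * (\1_(E i) w * P w)%:E))%E.
  apply: eq_integral => w _; under eq_bigr do rewrite -EFinM mulrA.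
  rewrite sumEFin -mulr_suml -EFinM sum_signs; congr EFin; ring.
have i1 : wv.-integrable B (fun w => (\1_(E i) w * P w)%:E).
  apply: (@integrable_pow_re _ _ 1 zB) => [|w]; first exact: measurable_indic.
  by rewrite indicE; case: (_ \in _); rewrite ?normr1 ?normr0.
rewrite integralZl// [RHS]EFinM; congr (_ * _)%E.
transitivity (\int[wv]_(w in E i) (P w)%:E)%E.
  rewrite integral_mkcond [RHS]integral_mkcond; apply: eq_integral => w _.
  rewrite !patchE indicE; case: ifPn => wB; case: ifPn => wE; rewrite ?mul1r ?mul0r//.
  by move: wB; rewrite mem_set//; apply: (EB (i := i)); exact: set_mem.
rewrite /Rintegral fineK// integrable_fin_num//.
exact: integrable_pow_re_cell.
Qed.

Lemma sum_normc_K_op_ge (k : R) i z : 0 <= a i -> E i z ->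
  (forall w, E i w -> k <= pow_re c (1 - inner z w)) ->
  #|{ffun I -> bool}|%:R * (a i * (k * fine (wv (E i)))) <=
  \sum_(eps : {ffun I -> bool})
    normc (K_op n alpha c (fun w => (signed_step eps w)%:C) z).
Proof.
move=> ai0 iz hk; have zB : B z := EB iz.
apply: (@le_trans _ _ (\sum_(eps : {ffun I -> bool})
    (-1) ^+ eps i * part true (K_op n alpha c (fun w => (signed_step eps w)%:C) z))).
  rewrite sum_signs_K_op// -mulrA; apply: ler_wpM2l => //; apply: ler_wpM2l => //.
  rewrite -Rintegral_cst//; apply: le_Rintegral => //.
    apply: measurable_bounded_integrable => //; last exact: bounded_cst.
    by rewrite -ge0_fin_numE// weighted_volume_fin_num.
  exact: integrable_pow_re_cell.
apply: ler_sum => eps _; apply: le_trans (ler_norm _) _.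
by rewrite normrM normr_sign mul1r part_le_normc.
Qed.

(** At a point of the cell [E i], the mean over the signs of |K f| is at least a_i k_i times the
    measure of [E i]. Jensen's inequality over the signs turns this into a bound for the mean of |K
    f|^q, which is then integrated. *)
Lemma sum_signed_le (q b : R) (k : I -> R) : 1 <= q -> 0 <= b ->
  (forall i, 0 <= a i) -> (forall i, 0 <= k i) ->
  (forall i z w, E i z -> E i w -> k i <= pow_re c (1 - inner z w)) ->
  (forall eps, (Lp_norm alpha q%:E
     (K_op n alpha c (fun w => (signed_step eps w)%:C)) <= b%:E)%E) ->
  \sum_i (a i * (k i * fine (wv (E i)))) `^ q * fine (wv (E i)) <= b `^ q.
Proof.
move=> q1 b0 a0 k0 hk hb; have q0 : 0 < q by lra.
pose N : R := #|{ffun I -> bool}|%:R.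
have N0 : 0 < N by rewrite ltr0n card_ffun card_bool expn_gt0.
pose F eps z := normc (K_op n alpha c (fun w => (signed_step eps w)%:C) z).
have F0 eps z : 0 <= F eps z by exact: normc_ge0.
have mF eps : measurable_fun B (fun z => (F eps z `^ q)%:E).
  apply/measurable_EFinP; apply: (measurableT_comp (measurable_powR _)).
  apply: (measurableT_comp (@measurable_normc R)); apply: measurable_K_op => //.
  exact: measurable_funTS (measurable_signed_stepC eps).
pose y i := a i * (k i * fine (wv (E i))).
have y0 i : 0 <= y i by rewrite /y !mulr_ge0// fine_ge0.
have m1 i : measurable_fun B (fun z => (N * y i `^ q)%:E * (\1_(E i) z)%:E)%E.
  apply: measurable_funeM; apply/measurable_EFinP; apply: measurable_funTS.
  exact: measurable_indic.
have g0 i z : (0 <= (N * y i `^ q)%:E * (\1_(E i) z)%:E)%E.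
  by rewrite -EFinM lee_fin mulr_ge0// mulr_ge0 ?powR_ge0// ltW.
suff : ((N * \sum_i y i `^ q * fine (wv (E i)))%:E <= (N * b `^ q)%:E)%E.
  by rewrite lee_fin ler_pM2l.
apply: (@le_trans _ _ (\int[wv]_(z in B) \sum_(eps : {ffun I -> bool}) (F eps z `^ q)%:E)%E).
  apply: (@le_trans _ _ (\int[wv]_(z in B) \sum_i ((N * y i `^ q)%:E * (\1_(E i) z)%:E))%E).
    rewrite ge0_integral_sum// mulr_sumr -sumEFin; apply: lee_sum => i _.
    rewrite ge0_integralZl//; last 2 first.
    - by apply/measurable_EFinP; apply: measurable_funTS; exact: measurable_indic.
    - by rewrite lee_fin mulr_ge0 ?powR_ge0// ltW.
    rewrite integral_indic// setIidl; last exact: EB.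
    by rewrite mulrA EFinM fineK ?weighted_volume_fin_num.
  apply: ge0_le_integral => //.
  - by move=> z _; exact: sume_ge0.
  - exact: emeasurable_sum.
  - exact: emeasurable_sum.
  move=> z zB; have [[i iz]|nz] := pselect (exists i, E i z); last first.
    rewrite big1 => [|i _]; first by apply: sume_ge0 => eps _; rewrite lee_fin powR_ge0.
    by rewrite indicE memNset ?mule0// => iz; apply: nz; exists i.
  rewrite (bigD1 i)//= big1 ?adde0; last first.
    move=> j ji; rewrite indicE memNset ?mule0// => jz.
    by move: ji; rewrite (tE jz iz) eqxx.
  rewrite indicE mem_set// mule1 sumEFin lee_fin.
  apply: le_trans (sum_powR_ge q1 (F0 ^~ z)).
  apply: ler_wpM2l; first exact: ltW.
  apply: ge0_ler_powR; rewrite ?nnegrE ?(ltW q0)// ?divr_ge0 ?sumr_ge0//.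
  rewrite ler_pdivlMr// mulrC.
  by apply: sum_normc_K_op_ge => // w; exact: hk.
rewrite ge0_integral_sum//; last by move=> eps z _; rewrite lee_fin powR_ge0.
apply: (@le_trans _ _ (\sum_(eps : {ffun I -> bool}) (b `^ q)%:E)%E).
  by apply: lee_sum => eps _; apply/Lp_norm_le.
by rewrite sumEFin lee_fin sumr_const mulr_natl.
Qed.

End signs.
End random_signs.

(** * Real coordinates and the phase of 1 - <z, w> on small sets *)

Section cell_geometry.
Context {R : realType}.
Variable n : nat.
Implicit Types (z w a : n.+1.-tuple R[i]) (x : 'I_n.+1 * bool) (h rho : R).

Definition coord x z : R := part x.2 (tnth z x.1).

Definition radial : 'I_n.+1 * bool := (ord0, true).

Lemma card_nonradial : #|predC1 radial| = (n * 2 + 1)%N.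
Proof. by rewrite cardC1 card_prod card_ord card_bool mulSn add2n /= addn1. Qed.

Lemma measurable_coord x : measurable_fun setT (coord x).
Proof. by apply: measurableT_comp (measurable_part x.2) _; exact: measurable_tnth. Qed.

Let sum_coord (F : 'I_n.+1 -> bool -> R) :
  \sum_x F x.1 x.2 = \sum_i (F i true + F i false).
Proof.
rewrite -(pair_bigA _ F)/=; apply: eq_bigr => i _.
by rewrite big_bool.
Qed.

Lemma normsq_coord z : normsq z = \sum_x coord x z ^+ 2.
Proof.
rewrite (sum_coord (fun i b => part b (tnth z i) ^+ 2)).
by apply: eq_bigr => i _; rewrite normc_sqr.
Qed.

Lemma distsq_coord z w : distsq z w = \sum_x (coord x z - coord x w) ^+ 2.
Proof.
rewrite (sum_coord (fun i b => (part b (tnth z i) - part b (tnth w i)) ^+ 2)).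
by apply: eq_bigr => i _; rewrite normc_sqr !partB.
Qed.

Let rot x : 'I_n.+1 * bool := (x.1, ~~ x.2).
Let sgb x : R := if x.2 then -1 else 1.

Lemma Im_inner_coord z w : complex.Im (inner z w) =
  \sum_x sgb x * (coord x z * coord (rot x) w).
Proof.
rewrite (sum_coord (fun i b => sgb (i, b) * (coord (i, b) z * coord (i, ~~ b) w))).
by rewrite Im_inner; apply: eq_bigr => i _; rewrite /sgb /coord /=; ring.
Qed.

Lemma coord_le1 x z : normsq z <= 1 -> `|coord x z| <= 1.
Proof.
move=> z1; rewrite -(ler_pXn2r (n := 2)) ?nnegrE// real_normK ?num_real// expr1n.
exact: le_trans (part_le_normsq _ _ _) z1.
Qed.

Lemma level_set_ball h z : 0 < h -> level_set h z -> normsq z < 1.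
Proof. by move=> h0 [_ /andP[]]; lra. Qed.

(** The Lipschitz constant in [coord_close]: each of the 2n + 1 other coordinates contributes 2 rho
    to the change of the square of the radial one, and the change of |z|^2 contributes rho. *)
Definition cell_cst : R := (n * 4 + 3)%:R.

Lemma cell_cst_ge1 : 1 <= cell_cst.
Proof. by rewrite ler1n addnS. Qed.

(* On a level set the radial coordinate is a Lipschitz function of the others. *)
Lemma coord_close h rho z w x : 0 < h -> h <= rho -> level_set h z -> level_set h w ->
  (forall y, y != radial -> `|coord y z - coord y w| <= rho) ->
  `|coord x z - coord x w| <= cell_cst * rho.
Proof.
move=> h0 hrho zh wh close; have rho0 : 0 < rho := lt_le_trans h0 hrho.
have [->|xr] := eqVneq x radial; last first.
  apply: (le_trans (close x xr)).
  by rewrite -[leLHS]mul1r ler_wpM2r ?(ltW rho0)// cell_cst_ge1.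
have z1 := level_set_ball h0 zh; have w1 := level_set_ball h0 wh.
have sq_close y : y != radial -> `|coord y z ^+ 2 - coord y w ^+ 2| <= 2 * rho.
  move=> yr; rewrite subr_sqr normrM mulrC; apply: ler_pM => //; last exact: close.
  apply: le_trans (ler_normD _ _) _; have := coord_le1 y (ltW z1).
  by have := coord_le1 y (ltW w1); lra.
have e : coord radial z ^+ 2 - coord radial w ^+ 2 = normsq z - normsq w -
    \sum_(y | y != radial) (coord y z ^+ 2 - coord y w ^+ 2).
  have eD u : normsq u = coord radial u ^+ 2 + \sum_(y | y != radial) coord y u ^+ 2.
    by rewrite normsq_coord (bigD1 radial).
  by rewrite !eD sumrB; ring.
have sum_close : `|\sum_(y | y != radial) (coord y z ^+ 2 - coord y w ^+ 2)| <=
    (n * 2 + 1)%:R * (2 * rho).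
  apply: le_trans (ler_norm_sum _ _ _) _.
  apply: (@le_trans _ _ (\sum_(y | y != radial) (2 * rho))); first exact: ler_sum.
  by rewrite sumr_const (eq_card (B := predC1 radial))// card_nonradial [leRHS]mulr_natl.
move: zh wh => [zr /andP[zl zu]] [wr /andP[wl wu]].
have {}zr : 2^-1 <= coord radial z by [].
have {}wr : 2^-1 <= coord radial w by [].
have := congr1 Num.norm e; rewrite subr_sqr normrM => e'.
apply: (@le_trans _ _ (`|coord radial z - coord radial w| * `|coord radial z + coord radial w|)).
  by rewrite -[leLHS]mulr1; apply: ler_wpM2l => //; rewrite ger0_norm; lra.
rewrite e'; apply: le_trans (ler_normB _ _) _.
have : `|normsq z - normsq w| <= rho by rewrite ler_norml; apply/andP; split; lra.
move: sum_close; rewrite /cell_cst !natrD !natrM.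
set A := `|_ - _|; set S := `|\sum_(_ | _) _|; nra.
Qed.

Lemma distsq_close rho z w :
  (forall x, `|coord x z - coord x w| <= cell_cst * rho) ->
  distsq z w <= (2 * n.+1)%:R * (cell_cst * rho) ^+ 2.
Proof.
move=> close; rewrite distsq_coord.
apply: (@le_trans _ _ (\sum_(x : 'I_n.+1 * bool) (cell_cst * rho) ^+ 2)).
  apply: ler_sum => x _; rewrite -[leLHS]real_normK ?num_real//.
  by apply: lerXn2r; rewrite ?nnegrE//; exact: le_trans (close x).
by rewrite sumr_const card_prod card_ord card_bool [(_ * 2)%N]mulnC [leRHS]mulr_natl.
Qed.

(** Since Im <a, a> = 0, Im <z, a> = Im <z - a, a> is of first order in z - a. *)
Lemma Im_inner_close rho z a : normsq a <= 1 ->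
  (forall x, `|coord x z - coord x a| <= cell_cst * rho) ->
  `|complex.Im (inner z a)| <= (2 * n.+1)%:R * (cell_cst * rho).
Proof.
move=> a1 close.
have -> : complex.Im (inner z a) = \sum_x sgb x * ((coord x z - coord x a) * coord (rot x) a).
  rewrite -[LHS]subr0 -[in LHS](_ : complex.Im (inner a a) = 0); last first.
    by rewrite inner_normsq.
  by rewrite !Im_inner_coord -sumrB; apply: eq_bigr => x _; ring.
apply: le_trans (ler_norm_sum _ _ _) _.
apply: (@le_trans _ _ (\sum_(x : 'I_n.+1 * bool) cell_cst * rho)).
  apply: ler_sum => x _; rewrite normrM /sgb (_ : `|if _ then _ else _| = 1); last first.
    by case: ifP; rewrite ?normrN normr1.
  rewrite mul1r normrM -[leRHS]mulr1; apply: ler_pM => //.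
  exact: coord_le1.
by rewrite sumr_const card_prod card_ord card_bool [(_ * 2)%N]mulnC [leRHS]mulr_natl.
Qed.

(** From Im <z, w> = Im <z, a> - Im <w, a> + Im <z - a, w - a>, where the last term is of second
    order. So it is enough to bin the single function Im <., a> to control all pairs in a cell. *)
Lemma Im_inner_close2 rho (delta : R) z w a :
  (forall x, `|coord x z - coord x a| <= cell_cst * rho) ->
  (forall x, `|coord x w - coord x a| <= cell_cst * rho) ->
  `|complex.Im (inner z a) - complex.Im (inner w a)| <= delta ->
  `|complex.Im (inner z w)| <= delta + (2 * n.+1)%:R * (cell_cst * rho) ^+ 2.
Proof.
move=> za wa zwa.
have -> : complex.Im (inner z w) = complex.Im (inner z a) - complex.Im (inner w a) +
    \sum_x sgb x * ((coord x z - coord x a) * (coord (rot x) w - coord (rot x) a)).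
  have -> : complex.Im (inner w a) = - complex.Im (inner a w) by exact: Im_innerC.
  have a0 : complex.Im (inner a a) = 0 by rewrite inner_normsq.
  rewrite opprK -[LHS]addr0 -[X in _ + X = _]a0 !Im_inner_coord -!big_split /=.
  by apply: eq_bigr => x _; ring.
apply: le_trans (ler_normD _ _) _; apply: lerD => //.
apply: le_trans (ler_norm_sum _ _ _) _.
apply: (@le_trans _ _ (\sum_(x : 'I_n.+1 * bool) (cell_cst * rho) ^+ 2)).
  apply: ler_sum => x _; rewrite normrM /sgb (_ : `|if _ then _ else _| = 1); last first.
    by case: ifP; rewrite ?normrN normr1.
  by rewrite mul1r normrM expr2; apply: ler_pM.
by rewrite sumr_const card_prod card_ord card_bool [(_ * 2)%N]mulnC [leRHS]mulr_natl.
Qed.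

(** The real part of 1 - <z, w> lies between h and 5h/2 and the imaginary part is at most eta h.
    Thus the modulus is at most 4h and the tangent of the argument at most eta. *)
Lemma pow_re_ge h eta c z w : 0 < h -> 0 <= c -> eta <= 1 ->
  (forall t, `|t| <= eta -> 2^-1 <= cos (c * atan t)) ->
  level_set h z -> level_set h w -> distsq z w <= h ->
  `|complex.Im (inner z w)| <= eta * h ->
  (4 * h) `^ (- c) / 2 <= pow_re c (1 - inner z w).
Proof.
move=> h0 c0 eta1 hcos [_ /andP[zl zu]] [_ /andP[wl wu]] zw Im_zw.
have Re_u := Re_1B_inner z w; have d0 := distsq_ge0 z w.
have Im_u : complex.Im (1 - inner z w) = - complex.Im (inner z w).
  by rewrite -[LHS]/(part false _) partB /= sub0r.
have Re_ge : h <= complex.Re (1 - inner z w) by lra.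
have Im_le : `|complex.Im (1 - inner z w)| <= h.
  by rewrite Im_u normrN; apply: le_trans Im_zw _; nra.
have Re0 := lt_le_trans h0 Re_ge.
apply: ler_pM; rewrite ?powR_ge0 ?invr_ge0//.
  apply: powRN_le => //; first exact: normc_gt0_Re.
  apply: le_trans (normc_le_part _) _; rewrite /= ger0_norm; lra.
apply: hcos; rewrite powR_inv1 ?(ltW Re0)// normrM normrV ?unitfE ?gt_eqF//.
rewrite [X in _ / X]gtr0_norm// ler_pdivrMr// Im_u normrN.
apply: (le_trans Im_zw); apply: ler_wpM2l => //.
by rewrite -(pmulr_lge0 _ h0) (le_trans _ Im_zw).
Qed.

End cell_geometry.

(** * Decomposition of a shell into cells *)

Section cells.
Context {R : realType}.
Variables (n a m : nat).
Implicit Types (z w : n.+1.-tuple R[i]).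

Local Notation h := ((4 ^+ m)^-1 : R).
Local Notation rho := ((2 ^+ (m + a))^-1 : R).
Local Notation L := (2 * n.+1 * (n * 4 + 3))%N.

(* The real coordinates other than [Re z_0] are binned at scale [rho], which is
   comparable to [sqrt h]; inside such a coarse cell the imaginary part of
   [<z, center>] is binned at the finer scale [2^-a * h]. Hence [O(h^-(n+1))]
   cells, on each of which [1 - <z, w>] is almost a positive number. *)
Definition coarse_label : finType :=
  {ffun {x : 'I_n.+1 * bool | x != radial n} -> 'I_(2 ^ (m + a).+1)}.

(** In a coarse cell |Im <z, center>| <= L rho, which becomes L * 2^m in units of h / 2^a. After the
    shift the values fill the closed interval [0, 2 L 2^m], whence the successor. *)
Definition cell_label : finType := (coarse_label * 'I_(2 * L * 2 ^ m).+1)%type.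

Definition in_bin (k : nat) (t : R) := k%:R <= t < k.+1%:R.

Definition coarse_cell (l : coarse_label) : set (n.+1.-tuple R[i]) :=
  [set z | level_set h z /\ forall x, in_bin (l x) ((coord (val x) z + 1) * 2 ^+ (m + a))].

(** An arbitrary point of the coarse cell; the origin stands in when that cell is empty. *)
Definition cell_center l : n.+1.-tuple R[i] := xget [tuple 0 | i < n.+1] (coarse_cell l).

Definition cell (l : cell_label) : set (n.+1.-tuple R[i]) :=
  [set z | coarse_cell l.1 z /\ in_bin l.2
    (complex.Im (inner z (cell_center l.1)) * (2 ^+ a * 4 ^+ m) + (L * 2 ^ m)%:R)].

Let h_gt0 : 0 < h. Proof. by rewrite invr_gt0 exprn_gt0. Qed.

Let in_bin_uniq k k' t : in_bin k t -> in_bin k' t -> k = k'.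
Proof. by move=> /truncn_def <- /truncn_def. Qed.

Let in_bin_trunc t : 0 <= t -> in_bin (Num.trunc t) t.
Proof. exact: truncn_itv. Qed.

Let in_bin_close k (s t d e : R) : 0 < d ->
  in_bin k (s * d + e) -> in_bin k (t * d + e) -> `|s - t| <= d^-1.
Proof.
move=> d0 /andP[s1 s2] /andP[t1 t2]; rewrite -(ler_pM2r d0) mulVf ?gt_eqF//.
rewrite -[X in _ * X](gtr0_norm d0) -normrM mulrBl ler_norml.
by move: s2 t2; rewrite -natr1; lra.
Qed.

Let measurable_in_bin k (f : n.+1.-tuple R[i] -> R) :
  measurable_fun setT f -> measurable [set z | in_bin k (f z)].
Proof.
move=> mf; rewrite (_ : [set z | _] = f @^-1` `[k%:R, k.+1%:R[).
  by rewrite -[X in measurable X]setTI; exact: mf.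
by apply/seteqP; split => z; rewrite /= in_itv.
Qed.

Lemma measurable_cell l : measurable (cell l).
Proof.
rewrite (_ : cell l = level_set h `&`
    \bigcap_(x in [set: {x : 'I_n.+1 * bool | x != radial n}])
      [set z | in_bin (l.1 x) ((coord (val x) z + 1) * 2 ^+ (m + a))] `&`
    [set z | in_bin l.2
    (complex.Im (inner z (cell_center l.1)) * (2 ^+ a * 4 ^+ m) + (L * 2 ^ m)%:R)]); last first.
  apply/seteqP; split => z [[z1 z2] z3]; do 2!split => //=; last by move=> x; exact: z2.
  by move=> x _; exact: z2.
apply: measurableI; first apply: measurableI.
- exact: measurable_level_set.
- apply: fin_bigcap_measurable => // x _; apply: measurable_in_bin.
  by apply: measurable_funM => //; apply: measurable_funD => //; exact: measurable_coord.
- apply: measurable_in_bin; apply: measurable_funD => //; apply: measurable_funM => //.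
  apply: (measurableT_comp (measurable_part false)).
  exact: (measurable_fun_pair1 _ (@measurable_inner R n.+1)).
Qed.

Lemma cell_level_set l : cell l `<=` level_set h.
Proof. by move=> z [[]]. Qed.

Lemma cell_inj l l' z : cell l z -> cell l' z -> l = l'.
Proof.
move: l l' => [l k] [l' k'] [/= [_ zl] zk] [/= [_ zl'] zk'].
have ll' : l = l'.
  by apply/ffunP => x; apply/val_inj; exact: in_bin_uniq (zl x) (zl' x).
by move: zk'; rewrite -ll' => zk'; congr (_, _); apply/val_inj; exact: in_bin_uniq zk zk'.
Qed.

Lemma coarse_cell_center l z : coarse_cell l z -> coarse_cell l (cell_center l).
Proof. by move=> zl; apply: xgetPex; exists z. Qed.

Hypothesis am : (a <= m)%N.

Let exp4E : 4 ^+ m = 2 ^+ m * 2 ^+ m :> R.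
Proof. by rewrite (_ : 4 = 2 * 2) ?exprMn// -natrM. Qed.

Let h_le_rho : h <= rho.
Proof.
rewrite lef_pV2 ?posrE ?exprn_gt0// (_ : 4 = 2 ^+ 2); last by rewrite -natrX.
by rewrite -exprM ler_weXn2l ?ler1n// mul2n -addnn leq_add2l.
Qed.

Lemma coarse_cell_close l z w (x : 'I_n.+1 * bool) : coarse_cell l z -> coarse_cell l w ->
  `|coord x z - coord x w| <= cell_cst n * rho.
Proof.
move=> [hz zl] [hw wl]; apply: (coord_close x h_gt0 h_le_rho hz hw) => y yr.
have := wl (exist _ y yr); have := zl (exist _ y yr); rewrite !mulrDl.
by apply: in_bin_close; rewrite exprn_gt0.
Qed.

Lemma cell_cover z : level_set h z -> exists l, cell l z.
Proof.
move=> hz; have z1 := level_set_ball h_gt0 hz.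
have coord_lt (x : 'I_n.+1 * bool) : `|coord x z| < 1.
  rewrite -(ltr_pXn2r (n := 2)) ?nnegrE// real_normK ?num_real// expr1n.
  exact: le_lt_trans (part_le_normsq _ _ _) z1.
have trunc_lt (x : 'I_n.+1 * bool) :
    (Num.trunc ((coord x z + 1) * 2 ^+ (m + a)) < 2 ^ (m + a).+1)%N.
  have /andP[x1 x2] : -1 < coord x z < 1 by rewrite -ltr_norml.
  rewrite truncn_lt_nat; last by rewrite mulr_ge0 ?exprn_ge0//; lra.
  by rewrite natrX exprS ltr_pM2r ?exprn_gt0//; lra.
pose l : coarse_label := [ffun x => Ordinal (trunc_lt (val x))].
have zl : coarse_cell l z.
  split=> // x; rewrite ffunE /=; apply: in_bin_trunc.
  have /andP[x1 x2] : -1 < coord (val x) z < 1 by rewrite -ltr_norml.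
  by rewrite mulr_ge0 ?exprn_ge0//; lra.
have al := coarse_cell_center zl; have [ha _] := al.
have a1 := level_set_ball h_gt0 ha.
have := Im_inner_close (ltW a1) (fun x => coarse_cell_close x zl al).
set y := complex.Im _ => hy.
have hy' : `|y * (2 ^+ a * 4 ^+ m)| <= (L * 2 ^ m)%:R.
  rewrite normrM [X in _ * X]gtr0_norm ?mulr_gt0 ?exprn_gt0//.
  rewrite -ler_pdivlMr ?mulr_gt0 ?exprn_gt0//; apply: (le_trans hy).
  have -> : (L * 2 ^ m)%:R = (2 * n.+1)%:R * cell_cst n * 2 ^+ m :> R.
    by rewrite natrM natrX [in LHS]natrM.
  rewrite exp4E exprD le_eqVlt; apply/orP; left; apply/eqP.
  by field; rewrite !gt_eqF// exprn_gt0.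
have y0 : 0 <= y * (2 ^+ a * 4 ^+ m) + (L * 2 ^ m)%:R.
  by move: hy'; rewrite ler_norml => /andP[]; lra.
have trunc_lt' : (Num.trunc (y * (2 ^+ a * 4 ^+ m) + (L * 2 ^ m)%:R) < (2 * L * 2 ^ m).+1)%N.
  rewrite truncn_lt_nat//; move: hy'; rewrite ler_norml => /andP[_].
  have -> : (2 * L * 2 ^ m).+1%:R = 2 * (L * 2 ^ m)%:R + 1 :> R.
    by rewrite -natr1 -[(2 * L * _)%N]mulnA natrM.
  lra.
exists (l, Ordinal trunc_lt'); split => //=.
exact: in_bin_trunc.
Qed.

(** There are 2n + 1 coarse coordinates with O(2^m) bins each and O(2^m) fine bins, and 2^(m (2n +
    1)) * 2^m = 4^(m (n + 1)). *)
Lemma card_cell_label : (#|cell_label| <=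
  2 ^ (a.+1 * (n * 2 + 1)) * (2 * L).+1 * 4 ^ (m * n.+1))%N.
Proof.
rewrite card_prod card_ffun card_ord card_sig card_nonradial card_ord.
set M := (2 * L)%N; set k := (n * 2 + 1)%N.
have -> : (4 ^ (m * n.+1) = 2 ^ (m * k) * 2 ^ m)%N.
  rewrite -expnD (_ : 4 = 2 ^ 2)%N// -expnM; congr (2 ^ _)%N.
  rewrite mulnCA addnC -mulnS; congr (m * _)%N.
  by rewrite /k mulnC mulSn addnC addn1 addn2.
clearbody M k; rewrite -expnM -addnS mulnDl expnD -!mulnA mulnCA leq_mul2l; apply/orP; right.
rewrite [leqRHS]mulnCA leq_mul2l; apply/orP; right.
by rewrite mulSn addnC -[X in (X <= _)%N]addn1 leq_add2l expn_gt0.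
Qed.

(** Since rho^2 = 4^-a h, the second-order term is at most 2^-a h once 2^a exceeds the geometric
    constant. The fine bin adds another 2^-a h, hence the threshold 2 * 2^-a. *)
Lemma pow_re_cell_ge c l z w : 0 <= c ->
  (2 * n.+1)%:R * cell_cst n ^+ 2 <= 2 ^+ a :> R -> (0 < a)%N ->
  (forall t, `|t| <= 2 * (2 ^+ a)^-1 -> 2^-1 <= cos (c * atan t) :> R) ->
  cell l z -> cell l w -> (4 * h) `^ (- c) / 2 <= pow_re c (1 - inner z w).
Proof.
move=> c0 ha a0 hcos [zl zk] [wl wk].
have al := coarse_cell_center zl.
have zw x := coarse_cell_close x zl wl.
set u : R := (2 ^+ a)^-1 in hcos.
have u0 : 0 < u by rewrite invr_gt0 exprn_gt0.
have hu : (2 * n.+1)%:R * cell_cst n ^+ 2 * u <= 1 by rewrite ler_pdivrMr ?exprn_gt0// mul1r.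
have u1 : 2 * u <= 1.
  by rewrite ler_pdivrMr ?exprn_gt0// mul1r -[leLHS]expr1 ler_weXn2l// ler1n.
have rho2 : (2 * n.+1)%:R * (cell_cst n * rho) ^+ 2 <= u * h.
  have -> : (2 * n.+1)%:R * (cell_cst n * rho) ^+ 2 =
      (2 * n.+1)%:R * cell_cst n ^+ 2 * u * (u * h).
    by rewrite exp4E exprD /u; field; rewrite !gt_eqF// exprn_gt0.
  rewrite -[leRHS]mul1r; apply: ler_wpM2r => //.
  by rewrite mulr_ge0// ltW.
have uh : u * h <= h by have := h_gt0; nra.
apply: (pow_re_ge h_gt0 c0 u1 hcos zl.1 wl.1).
  exact: le_trans (distsq_close zw) (le_trans rho2 uh).
have close_a y : coarse_cell l.1 y ->
    forall x, `|coord x y - coord x (cell_center l.1)| <= cell_cst n * rho.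
  by move=> yl x; exact: coarse_cell_close yl al.
have hIm : `|complex.Im (inner z (cell_center l.1)) -
    complex.Im (inner w (cell_center l.1))| <= u * h.
  by rewrite -invfM; apply: in_bin_close zk wk; rewrite mulr_gt0 ?exprn_gt0.
apply: le_trans (Im_inner_close2 (close_a _ zl) (close_a _ wl) hIm) _.
have h0 := h_gt0; lra.
Qed.

End cells.

(** * Weighted measure of a shell *)

Section level_measure.
Context {R : realType}.
Variables (n : nat) (alpha : R).
Hypothesis alpha_gtN1 : -1 < alpha.
Local Notation B := (@unit_ball R n.+1).
Local Notation wv := (weighted_volume n.+1 alpha).

Lemma weighted_volume_level_set : exists2 k : R, 0 < k &
  forall h, 0 < h -> h <= 8^-1 -> (k * h `^ (1 + alpha) <= fine (wv (level_set h))).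
Proof.
have [k k0 hk] := @lebesgue_Cn_level_set R n.
have v0 := @wv_cst_gt0 R n.+1 alpha isT alpha_gtN1.
(* On the shell, V^alpha is at least h^alpha if alpha >= 0 and at least (2h)^alpha otherwise. *)
pose t : R := Num.min 1 (2 `^ alpha).
have t0 : 0 < t by rewrite lt_min ltr01 powR_gt0.
exists (wv_cst n.+1 alpha * t * k); first exact: mulr_gt0 (mulr_gt0 v0 t0) k0.
move=> h h0 h8; have mL := @measurable_level_set R n h.
have mB := @measurable_unit_ball R n.+1.
have LB : level_set h `<=` B by move=> z; exact: level_set_ball.
rewrite -lee_fin fineK; last exact: weighted_volume_fin_num.
have -> : (wv (level_set h) = \int[wv]_(z in level_set h) 1)%E.
  by rewrite integral_cst// mul1e.
rewrite ge0_integral_weighted_volume// setIidl//.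
apply: (@le_trans _ _ (\int[lebesgue_Cn n.+1]_(z in level_set h)
    (wv_cst n.+1 alpha * (t * h `^ alpha))%:E)%E).
  rewrite integral_cst//.
  have c0 : 0 <= wv_cst n.+1 alpha * (t * h `^ alpha).
    by apply: mulr_ge0 (ltW v0) (mulr_ge0 (ltW t0) (powR_ge0 _ _)).
  apply: le_trans (lee_wpmul2l _ (hk h h0 h8)); last by rewrite lee_fin.
  rewrite -EFinM lee_fin powRD; last by rewrite (gt_eqF h0) implybT.
  by rewrite powRr1 ?(ltW h0)//; lra.
apply: ge0_le_integral => //.
- by move=> z _; rewrite lee_fin; apply: mulr_ge0 (ltW v0) (mulr_ge0 (ltW t0) (powR_ge0 _ _)).
- apply: measurable_funTS; apply: emeasurable_funM => //; apply/measurable_EFinP.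
  apply: measurable_funM => //; apply: (measurableT_comp (measurable_powR _)).
  by apply: measurable_funB => //; exact: measurable_normsq.
move=> z [_ /andP[z1 z2]]; rewrite mul1e lee_fin; apply: ler_wpM2l; first exact: ltW.
have V0 : 0 < 1 - normsq z by exact: lt_le_trans z1.
have [a0|a0] := leP 0 alpha.
  apply: (@le_trans _ _ (h `^ alpha)).
    by rewrite -[leRHS]mul1r ler_wpM2r ?powR_ge0// ge_min lexx.
  by apply: ge0_ler_powR; rewrite ?nnegrE ?(ltW h0) ?(ltW V0).
apply: (@le_trans _ _ ((2 * h) `^ alpha)).
  by rewrite powRM ?(ltW h0)// ler_wpM2r ?powR_ge0// ge_min lexx orbT.
rewrite -[alpha]opprK; apply: powRN_le => //; [lra|exact: ltW].
Qed.

End level_measure.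

(** * Test functions on consecutive shells *)

Section level_functions.
Context {R : realType}.
Variables (n : nat) (alpha : R).
Hypothesis alpha_gtN1 : -1 < alpha.
Local Notation B := (@unit_ball R n.+1).
Local Notation wv := (weighted_volume n.+1 alpha).
Local Notation h m := ((4 ^+ m)^-1 : R).
Local Notation mu m := (fine (wv (level_set (h m)))).
Local Open Scope complex_scope.

Let h_gt0 m : 0 < h m. Proof. by rewrite invr_gt0 exprn_gt0. Qed.

(** The heights decrease by factors of 4 while a shell only spans a factor of 2, so the shells are
    disjoint. *)
Let level_set_lt m m' z : (m < m')%N -> level_set (h m) z -> ~ @level_set R n (h m') z.
Proof.
move=> mm' [_ /andP[z1 _]] [_ /andP[_ z2]].
have : 4 * h m' <= h m.
  rewrite -ler_pdivlMl// -invfM -exprS lef_pV2 ?posrE ?exprn_gt0//.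
  by rewrite ler_weXn2l// ler1n.
by have := h_gt0 m'; lra.
Qed.

Lemma level_set_inj m m' z :
  level_set (h m) z -> @level_set R n (h m') z -> m = m'.
Proof.
move=> zm zm'; case: (ltngtP m m') => // mm'; exfalso.
  exact: level_set_lt mm' zm zm'.
exact: level_set_lt mm' zm' zm.
Qed.

Section block.
Variables (a m0 M : nat).
Hypothesis am0 : (a <= m0)%N.

Definition block_label : finType := {m : 'I_M & cell_label n a (m0 + m)}.

Definition block_cell (i : block_label) : set (n.+1.-tuple R[i]) :=
  cell (tagged i).

Lemma block_cell_level i : block_cell i `<=` level_set (h (m0 + tag i)).
Proof. exact: cell_level_set. Qed.

Lemma measurable_block_cell i : measurable (block_cell i).
Proof. exact: measurable_cell. Qed.

Lemma block_cell_ball i : block_cell i `<=` B.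
Proof. by move=> z /block_cell_level; exact: level_set_ball. Qed.

Lemma block_cell_inj i j z : block_cell i z -> block_cell j z -> i = j.
Proof.
case: i j => [m l] [m' l'] zl zl'.
have := level_set_inj (block_cell_level zl) (block_cell_level zl') => /= /addnI /val_inj mm'.
move: mm' l' zl' => <- l' zl'; congr existT; exact: cell_inj zl zl'.
Qed.

Variable b : 'I_M -> R.
Hypothesis b_ge0 : forall m, 0 <= b m.

Definition block_step := signed_step block_cell (fun i => b (tag i)).

Lemma block_step_powR_le (p : R) eps z : 0 < p ->
  `|block_step eps z| `^ p <= \sum_(m < M) b m `^ p * \1_(level_set (h (m0 + m))) z.
Proof.
move=> p0.
have s0 m : 0 <= b m `^ p * \1_(level_set (h (m0 + m))) z by rewrite mulr_ge0 ?powR_ge0.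
have [[i iz]|nz] := pselect (exists i, block_cell i z); last first.
  rewrite /block_step signed_step_out ?normr0 ?powR0 ?gt_eqF ?sumr_ge0// => i iz.
  by apply: nz; exists i.
rewrite /block_step (signed_step_in _ block_cell_inj _ iz) normrM normr_sign mul1r.
rewrite ger0_norm// (bigD1 (tag i))//= indicE mem_set; last exact: block_cell_level.
by rewrite mulr1 lerDl sumr_ge0.
Qed.

Lemma block_step_le1 eps z : (forall m, b m <= 1) -> `|block_step eps z| <= 1.
Proof.
move=> b1; have [[i iz]|nz] := pselect (exists i, block_cell i z); last first.
  rewrite /block_step signed_step_out ?normr0// => i iz.
  by apply: nz; exists i.
rewrite /block_step (signed_step_in _ block_cell_inj _ iz) normrM normr_sign mul1r.
by rewrite ger0_norm.
Qed.

Let normcR (x : R) : normc x%:C = `|x|.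
Proof. by rewrite /= expr0n /= addr0 sqrtr_sqr. Qed.

Lemma Lp_norm_block_step_oo eps : (forall m, b m <= 1) ->
  (Lp_norm alpha +oo%E (fun z => (block_step eps z)%:C) <= 1%:E)%E.
Proof.
move=> b1; rewrite /Lp_norm unlock; case: ifP => _; last by rewrite lee_fin.
apply/ess_supP; apply: nearW => z; rewrite /comp patchE.
case: ifP => _; last by rewrite abse0 lee_fin.
by rewrite normcR abse_EFin lee_fin normr_id block_step_le1.
Qed.

Lemma Lp_norm_block_step (p : R) eps : 0 < p ->
  (forall m, b m `^ p * mu (m0 + m) <= 1) ->
  (Lp_norm alpha p%:E (fun z => (block_step eps z)%:C) <= (M%:R `^ p^-1)%:E)%E.
Proof.
move=> p0 b1; apply/Lp_norm_le => //.
rewrite -powRrM mulVf ?gt_eqF// powRr1//.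
have mB := @measurable_unit_ball R n.+1.
have mL m := @measurable_level_set R n (h m).
have m1 (m : 'I_M) : measurable_fun B (fun z => (\1_(level_set (h (m0 + m))) z)%:E : \bar R).
  by apply/measurable_EFinP; apply: measurable_funTS; exact: measurable_indic.
apply: (@le_trans _ _ (\int[wv]_(z in B)
    \sum_(m < M) ((b m `^ p)%:E * (\1_(level_set (h (m0 + m))) z)%:E))%E).
  apply: ge0_le_integral => //.
  - by move=> z _; rewrite lee_fin powR_ge0.
  - apply/measurable_EFinP; apply: (measurableT_comp (measurable_powR _)).
    apply: (measurableT_comp (@measurable_normc R)); apply: measurable_funTS.
    apply: measurable_signed_stepC => i; exact: measurable_block_cell.
  - by apply: emeasurable_sum => m; exact: measurable_funeM.
  - move=> z _; rewrite normcR.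
    under eq_bigr do rewrite -EFinM; rewrite sumEFin lee_fin; exact: block_step_powR_le.
rewrite ge0_integral_sum//; last 2 first.
- by move=> m; exact: measurable_funeM.
- by move=> m z _; rewrite -EFinM lee_fin mulr_ge0 ?powR_ge0.
apply: (@le_trans _ _ (\sum_(m < M) 1)%E); last first.
  by rewrite sumEFin lee_fin sumr_const card_ord.
apply: lee_sum => m _; rewrite ge0_integralZl//; last by rewrite lee_fin powR_ge0.
rewrite integral_indic// setIidl; last by move=> z; exact: level_set_ball.
rewrite [X in (_ * X)%E](_ : _ = (mu (m0 + m))%:E) -?EFinM ?lee_fin//.
by rewrite fineK// weighted_volume_fin_num.
Qed.

End block.

Lemma level_set_le_cells a m : (a <= m)%N ->
  mu m <= \sum_(l : cell_label n a m) fine (wv (cell l)).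
Proof.
move=> am; have mL := @measurable_level_set R n (h m).
rewrite -lee_fin fineK ?weighted_volume_fin_num//.
have -> : (wv (level_set (h m)) = \int[wv]_(z in level_set (h m)) 1)%E.
  by rewrite integral_cst// mul1e.
have m1 (l : cell_label n a m) :
    measurable_fun (level_set (h m)) (fun z => (\1_(cell l) z)%:E : \bar R).
  apply/measurable_EFinP; apply: measurable_funTS; apply: measurable_indic.
  exact: measurable_cell.
apply: (@le_trans _ _ (\int[wv]_(z in level_set (h m))
    \sum_(l : cell_label n a m) (\1_(cell l) z)%:E)%E).
  apply: ge0_le_integral => //.
    exact: emeasurable_sum.
  move=> z zL; have [l zl] := cell_cover am zL.
  by rewrite sumEFin lee_fin (bigD1 l)//= indicE mem_set// lerDl sumr_ge0.
rewrite ge0_integral_sum// -sumEFin; apply: lee_sum => l _.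
rewrite integral_indic//; last exact: measurable_cell.
rewrite setIidl; last exact: cell_level_set.
by rewrite fineK// weighted_volume_fin_num//; exact: measurable_cell.
Qed.

(* Jensen: the sum is smallest when all the cells have the same measure. *)
Lemma cells_lower_bound (q A : R) a m : 1 <= q -> 0 <= A -> (a <= m)%N ->
  (A * mu m / #|cell_label n a m|%:R) `^ q * mu m <=
  \sum_(l : cell_label n a m) (A * fine (wv (cell l))) `^ q * fine (wv (cell l)).
Proof.
move=> q1 A0 am; have q0 : 0 < q by lra.
have x0 (l : cell_label n a m) : 0 <= fine (wv (cell l)) by exact: fine_ge0.
have mu0 : 0 <= mu m by exact: fine_ge0.
have [->|K0] := posnP #|cell_label n a m|.
  rewrite invr0 mulr0 powR0 ?gt_eqF// mul0r sumr_ge0// => l _.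
  by rewrite mulr_ge0 ?powR_ge0.
have K0' : 0 < #|cell_label n a m|%:R :> R by rewrite ltr0n.
(* Each summand is A^q times the power q + 1 of a cell measure, so Jensen's inequality is used with
   exponent q + 1. *)
have q11 : 1 <= q + 1 by lra.
have := sum_powR_ge q11 x0; have := level_set_le_cells am.
set S := \sum_(l : cell_label n a m) fine (wv (cell l)); set K : R := #|_|%:R => muS hS.
have -> : \sum_(l : cell_label n a m) (A * fine (wv (cell l))) `^ q * fine (wv (cell l)) =
    A `^ q * \sum_(l : cell_label n a m) fine (wv (cell l)) `^ (q + 1).
  rewrite mulr_sumr; apply: eq_bigr => l _.
  rewrite powRM// -mulrA powRD; last by rewrite gt_eqF//; lra.
  by rewrite powRr1.
apply: le_trans (ler_wpM2l (powR_ge0 _ _) hS).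
have S0 : 0 <= S by exact: le_trans muS.
rewrite -mulrA powRM ?divr_ge0 ?(ltW K0')// -mulrA; apply: ler_wpM2l; first exact: powR_ge0.
rewrite powRD; last by rewrite gt_eqF//; lra.
rewrite powRr1 ?divr_ge0 ?(ltW K0')// mulrCA [K * _]mulrC divfK ?gt_eqF//.
apply: ler_pM; rewrite ?powR_ge0//.
apply: ge0_ler_powR; rewrite ?nnegrE ?divr_ge0 ?(ltW K0') ?(ltW q0)//.
by rewrite ler_pM2r ?invr_gt0.
Qed.

End level_functions.

(** * Necessity of the exponent condition *)

Section necessity.
Context {R : realType}.
Variables (n : nat) (alpha c : R).
Hypotheses (alpha_gtN1 : -1 < alpha).
Local Notation B := (@unit_ball R n.+1).
Local Notation wv := (weighted_volume n.+1 alpha).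
Local Notation N := (n.+1%:R + 1 + alpha).
Local Notation h m := ((4 ^+ m)^-1 : R).
Local Notation mu m := (fine (wv (level_set (h m)))).
Local Open Scope complex_scope.

Lemma nat_powR_gt (w X : R) : 0 < w ->
  exists M, forall M', (M <= M')%N -> X < M'%:R `^ w.
Proof.
move=> w0; pose Y := Num.max X 0.
have Y0 : 0 <= Y by rewrite le_max lexx orbT.
exists (Num.trunc (Y `^ w^-1)).+1 => M' hM.
have YM : Y `^ w^-1 < M'%:R.
  have /andP[_ /lt_le_trans] := truncn_itv (powR_ge0 Y w^-1); apply.
  by rewrite ler_nat.
apply: (@le_lt_trans _ _ Y); first by rewrite le_max lexx.
have -> : Y = (Y `^ w^-1) `^ w by rewrite -powRrM mulVf ?gt_eqF// powRr1.
by apply: gt0_ltr_powR; rewrite ?nnegrE ?powR_ge0.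
Qed.

Lemma cos_atan_near0 : exists2 eta : R, 0 < eta &
  forall t, `|t| <= eta -> 2^-1 <= cos (c * atan t).
Proof.
have ct : {for 0, continuous (fun t : R => cos (c * atan t))}.
  apply: (@continuous_comp _ _ _ (fun t : R => c * atan t) (@cos R)).
    by apply: continuousM; [exact: cst_continuous|exact: continuous_atan].
  exact: continuous_cos.
have half : 2^-1 < cos (c * atan 0) by rewrite atan0 mulr0 cos0; lra.
have /nbhs_ballP[e e0 he] : nbhs (0 : R) [set t : R | 2^-1 < cos (c * atan t)].
  exact: ct _ (lt_nbhsr half).
exists (e / 2) => [|t te]; first by rewrite divr_gt0.
apply/ltW/he; rewrite /ball /= sub0r normrN; apply: le_lt_trans te _.
by rewrite ltr_pdivrMr// ltr_pMr// ltr1n.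
Qed.

Section exponents.
Variables (p : \bar R) (pv q : R).
Hypotheses (hp : p = +oo%E /\ pv = 0 \/ exists2 r, 1 <= r & p = r%:E /\ pv = r^-1).
Hypothesis (q1 : 1 <= q).

Let pv0 : 0 <= pv.
Proof. by case: hp => [[_ ->]//|[r r1 [_ ->]]]; rewrite invr_ge0; lra. Qed.

Let pv1 : pv <= 1.
Proof. by case: hp => [[_ ->]//|[r r1 [_ ->]]]; rewrite invf_le1//; lra. Qed.

(** With [pv] = 1/p this gives each shell L^p norm at most 1; for p = oo it is the constant 1. *)
Definition level_weight m0 M (m : 'I_M) : R := mu (m0 + m) `^ (- pv).

Lemma Lp_norm_normalized_block_step (a m0 M : nat) eps :
  (forall m, (m0 <= m)%N -> 0 < mu m) ->
  (Lp_norm alpha p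
    (fun z => (@block_step R n a m0 M (@level_weight m0 M) eps z)%:C)
   <= (M%:R `^ pv)%:E)%E.
Proof.
have w0 m : 0 <= level_weight m0 m by exact: powR_ge0.
move=> mu0; case: hp w0 => [[-> pv_eq]|[r r1 [-> pvE]]] w0.
  rewrite pv_eq powRr0; apply: Lp_norm_block_step_oo => // m.
  by rewrite /level_weight pv_eq oppr0 powRr0.
have r0 : 0 < r by lra.
rewrite pvE; apply: Lp_norm_block_step => // m.
have m1 := mu0 (m0 + m)%N (leq_addr _ _).
by rewrite /level_weight pvE -powRrM mulNr mulVf ?gt_eqF// powR_inv1 ?(ltW m1)// mulVf ?gt_eqF.
Qed.

Let u := pv * (1 + alpha) + (c - N) - (1 + alpha) / q.

Let kappa m : R := (4 * h m) `^ (- c) / 2.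

Let h_gt0 m : 0 < h m. Proof. by rewrite invr_gt0 exprn_gt0. Qed.

Let mu_gt0 m : (2 <= m)%N -> 0 < mu m.
Proof.
move=> m2; have [k k0 hk] := @weighted_volume_level_set R n alpha alpha_gtN1.
apply: lt_le_trans (hk _ (h_gt0 m) _); first by rewrite mulr_gt0 ?powR_gt0.
rewrite lef_pV2 ?posrE ?exprn_gt0// (@le_trans _ _ (4 ^+ 2))//; first lra.
by rewrite ler_weXn2l// ler1n.
Qed.

(** The shell has measure at least of order h^(1+alpha), the kernel is of order h^-c, and there are
    O(h^-(n+1)) cells. The exponents add up to -u. Only a lower bound on the measure is at hand, so
    its total exponent e = 1 + 1/q - pv must be nonnegative. *)
Lemma level_lower_bound a : exists2 k : R, 0 < k &
  forall m, (a <= m)%N -> (2 <= m)%N ->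
  (k * h m `^ (- u)) `^ q <=
  (mu m `^ (- pv) * kappa m * mu m / #|cell_label n a m|%:R) `^ q * mu m.
Proof.
have q0 : 0 < q by have := q1; lra.
have [k k0 hk] := @weighted_volume_level_set R n alpha alpha_gtN1.
pose e := 1 + q^-1 - pv.
have qV0 : 0 < q^-1 by rewrite invr_gt0.
have e0 : 0 <= e by have := pv1; rewrite /e; lra.
pose Kc := (2 ^ (a.+1 * (n * 2 + 1)) * (2 * (2 * n.+1 * (n * 4 + 3))).+1)%N.
have Kc0 : 0 < Kc%:R :> R by rewrite ltr0n muln_gt0 expn_gt0.
exists ((4 `^ (- c) / 2) * (k `^ e) * Kc%:R^-1).
  by rewrite mulr_gt0 ?invr_gt0// mulr_gt0 ?powR_gt0// divr_gt0 ?powR_gt0.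
move=> m am m2; have m0 := mu_gt0 m2; have hm := h_gt0 m.
set K : R := #|_|%:R.
have K0 : 0 < K.
  rewrite ltr0n lt0n; apply/eqP => K0.
  have := @level_set_le_cells R n alpha alpha_gtN1 a m am.
  rewrite big_pred0 ?leNgt ?m0// => l; apply/negbTE.
  by have /card0_eq/(_ l) := K0; rewrite inE.
have KV : h m ^+ n.+1 / Kc%:R <= K^-1.
  rewrite exprVn -exprM -invfM lef_pV2 ?posrE ?mulr_gt0 ?exprn_gt0//.
  rewrite -natrX -natrM ler_nat; apply: leq_trans (card_cell_label _ _ _) _.
  by rewrite mulnC.
have -> : (mu m `^ (- pv) * kappa m * mu m / K) `^ q * mu m =
    (kappa m * K^-1 * mu m `^ e) `^ q.
  have -> : mu m `^ e = mu m * mu m `^ q^-1 * mu m `^ (- pv).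
    rewrite /e powRD ?(gt_eqF m0) ?implybT// powRD ?(gt_eqF m0) ?implybT//.
    by rewrite powRr1// ltW.
  have {3}-> : mu m = (mu m `^ q^-1) `^ q.
    by rewrite -powRrM mulVf ?gt_eqF// powRr1 ?ltW.
  have kap0 : 0 <= kappa m by rewrite divr_ge0 ?powR_ge0.
  rewrite -powRM ?powR_ge0//; last first.
    by rewrite divr_ge0 ?(ltW K0)// mulr_ge0 ?(ltW m0)// mulr_ge0 ?powR_ge0.
  by congr (_ `^ _); ring.
apply: ge0_ler_powR; rewrite ?nnegrE ?(ltW q0)//.
- by rewrite !mulr_ge0 ?powR_ge0// invr_ge0 ltW.
- by rewrite !mulr_ge0 ?powR_ge0// invr_ge0 ltW.
have mue : k `^ e * h m `^ ((1 + alpha) * e) <= mu m `^ e.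
  rewrite powRrM -powRM ?powR_ge0 ?(ltW k0)//.
  apply: ge0_ler_powR; rewrite ?nnegrE ?(ltW m0) ?mulr_ge0 ?powR_ge0 ?(ltW k0)//.
  apply: hk => //; rewrite lef_pV2 ?posrE ?exprn_gt0// (@le_trans _ _ (4 ^+ 2))//; first lra.
  by rewrite ler_weXn2l// ler1n.
have -> : h m `^ (- u) = h m `^ (- c) * h m `^ ((1 + alpha) * e) * h m ^+ n.+1.
  rewrite -powR_mulrn ?(ltW hm)// -!powRD ?(gt_eqF hm) ?implybT//.
  by congr (_ `^ _); rewrite /u /e; ring.
rewrite /kappa powRM ?(ltW hm)//.
have -> : 4 `^ (- c) / 2 * k `^ e * Kc%:R^-1 *
    (h m `^ (- c) * h m `^ ((1 + alpha) * e) * h m ^+ n.+1) =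
    4 `^ (- c) * h m `^ (- c) / 2 * (h m ^+ n.+1 / Kc%:R) *
    (k `^ e * h m `^ ((1 + alpha) * e)) by ring.
apply: ler_pM => //.
- by rewrite !mulr_ge0 ?powR_ge0 ?exprn_ge0 ?invr_ge0// ltW.
- by apply: ler_wpM2l => //; rewrite !mulr_ge0 ?powR_ge0.
Qed.

Lemma block_bound : N < c -> 0 <= u ->
  bounded_Lp_Lq alpha p q%:E (K_op n.+1 alpha c) ->
  exists k C m1, [/\ 0 < k, 0 <= C & forall m0 M, (m1 <= m0)%N ->
    M%:R * (k * h m0 `^ (- u)) `^ q <= (C * M%:R `^ pv) `^ q].
Proof.
move=> Nc u0 [C hC]; have q0 : 0 < q by have := q1; lra.
have c0 : 0 <= c.
  have : 0 <= n.+1%:R :> R by [].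
  by have := alpha_gtN1; lra.
have [eta eta0 heta] := cos_atan_near0.
(* [a] depends only on the dimension and on c, through [eta], and is fixed before the shells; so [k]
   and [C] depend neither on [m0] nor on [M]. *)
pose X := Num.max ((2 * n.+1)%:R * cell_cst n ^+ 2) (2 / eta).
pose a := (Num.trunc X).+1.
have Xa : X <= 2 ^+ a.
  have X0 : 0 <= X by rewrite le_max mulr_ge0 ?sqr_ge0.
  have /andP[_ /ltW/le_trans] := truncn_itv X0; apply.
  by rewrite -natrX ler_nat ltnW// ltn_expl.
have Xa1 : (2 * n.+1)%:R * cell_cst n ^+ 2 <= 2 ^+ a :> R.
  by apply: le_trans Xa; rewrite le_max lexx.
have Xa2 t : `|t| <= 2 * (2 ^+ a)^-1 -> 2^-1 <= cos (c * atan t).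
  move=> ht; apply: heta; apply: le_trans ht _.
  rewrite ler_pdivrMr ?exprn_gt0// mulrC -ler_pdivrMr//.
  by apply: le_trans Xa; rewrite le_max lexx orbT.
have [k k0 hk] := level_lower_bound a.
exists k, `|C|, (maxn a 2); split => // m0 M; rewrite geq_max => /andP[am0 m02].
have mle (m : 'I_M) : (a <= m0 + m)%N /\ (2 <= m0 + m)%N.
  by split; [exact: leq_trans am0 (leq_addr _ _)|exact: leq_trans m02 (leq_addr _ _)].
have kap0 m : 0 <= kappa m by rewrite divr_ge0 ?powR_ge0.
(* As u >= 0, h^-u can only grow on the later, thinner shells, so each of the M terms is at least
   the one of [m0]. *)
apply: (@le_trans _ _ (\sum_(m < M) (k * h (m0 + m) `^ (- u)) `^ q)).
  rewrite mulr_natl -[in leLHS](card_ord M) -sumr_const; apply: ler_sum => m _.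
  apply: ge0_ler_powR; rewrite ?nnegrE ?(ltW q0)//.
  - by rewrite mulr_ge0 ?powR_ge0// ltW.
  - by rewrite mulr_ge0 ?powR_ge0// ltW.
  apply: ler_wpM2l; first exact: ltW.
  apply: powRN_le => //.
  by rewrite lef_pV2 ?posrE ?exprn_gt0// ler_weXn2l ?ler1n// leq_addr.
apply: (@le_trans _ _ (\sum_(m < M) \sum_(l : cell_label n a (m0 + m))
    (mu (m0 + m) `^ (- pv) * kappa (m0 + m) * fine (wv (cell l))) `^ q * fine (wv (cell l)))).
  apply: ler_sum => m _; have [am m2] := mle m.
  apply: le_trans (hk _ am m2) _.
  by apply: cells_lower_bound => //; rewrite mulr_ge0 ?powR_ge0.
have mE := @measurable_block_cell R n a m0 M.
have EB := @block_cell_ball R n a m0 M.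
have tE := @block_cell_inj R n a m0 M.
rewrite sig_big_dep /=.
pose w (i : block_label n a m0 M) := level_weight m0 (tag i).
have w0 i : 0 <= w i by exact: powR_ge0.
have CM0 : 0 <= `|C| * M%:R `^ pv by rewrite mulr_ge0 ?powR_ge0.
have mf eps := measurable_signed_stepC w mE eps.
have signed_norm eps :
    (Lp_norm alpha p (fun z => (signed_step (@block_cell R n a m0 M) w eps z)%:C) <=
     (M%:R `^ pv)%:E)%E.
  apply: Lp_norm_normalized_block_step => m mm0.
  by apply: mu_gt0; exact: leq_trans m02 mm0.
apply: le_trans (@sum_signed_le R n.+1 alpha c isT alpha_gtN1 c0 _ _ w mE EB tE q
  (`|C| * M%:R `^ pv) (fun i => kappa (m0 + tag i)) q1 CM0 w0 _ _ _).
- by apply: ler_sum => i _; rewrite mulrA.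
- by move=> i; exact: kap0.
- move=> i z z' iz iz'; apply: (pow_re_cell_ge _ c0 Xa1 _ Xa2 iz iz') => //.
  exact: (mle (tag i)).1.
- move=> eps.
  have flty : in_Lp alpha p (fun z => (signed_step (@block_cell R n a m0 M) w eps z)%:C).
    split; first exact: measurable_funTS (mf eps).
    exact: le_lt_trans (signed_norm eps) (ltry _).
  have [_ /le_trans] := hC _ flty; apply; rewrite EFinM.
  have f0 : (0 <= Lp_norm alpha p (fun z => (signed_step (@block_cell R n a m0 M) w eps z)%:C))%E.
    exact: Lnorm_ge0.
  apply: (@le_trans _ _ (`|C|%:E *
      Lp_norm alpha p (fun z => (signed_step (@block_cell R n a m0 M) w eps z)%:C))%E).
    by apply: lee_wpmul2r => //; rewrite lee_fin ler_norm.
  by apply: lee_wpmul2l; [rewrite lee_fin|exact: signed_norm].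
Qed.

Lemma bounded_exponents : N < c ->
  bounded_Lp_Lq alpha p q%:E (K_op n.+1 alpha c) ->
  pv + (c - N) / (1 + alpha) < q^-1.
Proof.
move=> Nc bd; have a1 : 0 < 1 + alpha by have := alpha_gtN1; lra.
have q0 : 0 < q by have := q1; lra.
rewrite ltNge; apply/negP => hu.
have uE : u = (1 + alpha) * (pv + (c - N) / (1 + alpha) - q^-1).
  by rewrite /u; field; rewrite !gt_eqF.
have u0 : 0 <= u by rewrite uE mulr_ge0 ?subr_ge0// ltW.
have [k [C [m1 [k0 C0 hk]]]] := block_bound Nc u0 bd.
have [u_gt0|u_le0] := ltP 0 u.
  have [M hM] := nat_powR_gt (C / k) u_gt0.
  pose m := maxn m1 M.
  have := hk m 1%N (leq_maxl _ _); rewrite mul1r powR1 mulr1 leNgt => /negP; apply.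
  have hm : C < k * h m `^ (- u).
    rewrite mulrC -ltr_pdivrMr//.
    have := hM m (leq_maxr _ _) => /lt_le_trans; apply.
    rewrite -powR_inv1 ?exprn_ge0// -powRrM mulrNN mul1r.
    apply: ge0_ler_powR; rewrite ?nnegrE ?exprn_ge0//.
    by rewrite -natrX ler_nat ltnW// ltn_expl.
  by apply: gt0_ltr_powR; rewrite ?nnegrE// (le_trans C0)// ltW.
have {}u0 : u = 0 by apply/eqP; rewrite eq_le u0 u_le0.
have pvq : 0 < 1 - pv * q.
  have s0 : 0 < (c - N) / (1 + alpha) by rewrite divr_gt0// subr_gt0.
  have pvq : pv < q^-1.
    move: u0; rewrite uE => /eqP; rewrite mulf_eq0 gt_eqF//= => /eqP; lra.
  by rewrite subr_gt0 -ltr_pdivlMr// mul1r.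
have [M hM] := nat_powR_gt ((C / k) `^ q) pvq.
have := hk m1 M.+1 (leqnn _); have := hM M.+1 (leqnSn M).
have M0 : 0 < M.+1%:R :> R by rewrite ltr0n.
rewrite u0 oppr0 powRr0 mulr1 !powRM ?powR_ge0 ?invr_ge0 ?(ltW k0)// -!powRrM.
rewrite powRB ?(gt_eqF M0) ?implybT// powRr1 ?(ltW M0)//.
set Mpv := M.+1%:R `^ (pv * q); set X := C `^ q.
have Mpv0 : 0 < Mpv by exact: powR_gt0.
have kq0 : 0 < k `^ q by exact: powR_gt0.
have -> : k^-1 `^ q = (k `^ q)^-1.
  by rewrite -[k^-1](powR_inv1 (ltW k0)) -powRrM mulN1r powRN.
rewrite ltr_pdivlMr// mulrAC ltr_pdivrMr// => h1 h2; lra.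
Qed.

End exponents.
End necessity.

Lemma bounded_Lp_Lq_oo (R : realType) (n : nat) (alpha : R) (p : \bar R) (Q : R)
    (T : (n.-tuple R[i] -> R[i]) -> n.-tuple R[i] -> R[i]) :
  (0 < n)%N -> -1 < alpha -> 0 < Q ->
  bounded_Lp_Lq alpha p +oo%E T -> bounded_Lp_Lq alpha p Q%:E T.
Proof.
move=> n0 alpha1 Q0 [C hC].
have mB := @measurable_unit_ball R n.
have wvB := weighted_volume_fin_num n0 alpha1 mB.
pose V := fine (weighted_volume n alpha (unit_ball n)).
have V0 : 0 <= V by exact: fine_ge0.
exists (V `^ Q^-1 * `|C|) => f hf; have [[mTf Tfoo] hle] := hC f hf.
have Tf0 : (0 <= Lp_norm alpha +oo%E (T f))%E by exact: Lnorm_ge0.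
have [t t0 tE] : exists2 t, 0 <= t & Lp_norm alpha +oo%E (T f) = t%:E.
  exists (fine (Lp_norm alpha +oo%E (T f))); first exact: fine_ge0.
  by rewrite fineK// ge0_fin_numE.
have h : (Lp_norm alpha Q%:E (T f) <= (V `^ Q^-1 * t)%:E)%E.
  apply/Lp_norm_le => //; first by rewrite mulr_ge0 ?powR_ge0.
  have Tft : (Lp_norm alpha +oo%E (T f) <= t%:E)%E by rewrite tE.
  apply: le_trans (integral_le_Lp_norm_oo (ltW Q0) t0 mTf Tft) _.
  rewrite -(fineK wvB) -EFinM lee_fin powRM ?powR_ge0// -powRrM mulVf ?gt_eqF//.
  by rewrite powRr1// mulrC.
split; first by split=> //; exact: le_lt_trans h (ltry _).
apply: (le_trans h); rewrite EFinM -tE EFinM -muleA; apply: lee_wpmul2l.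
  by rewrite lee_fin powR_ge0.
apply: (le_trans hle); apply: lee_wpmul2r; first exact: Lnorm_ge0.
by rewrite lee_fin ler_norm.
Qed.

(* The inverse on extended reals satisfies (+oo)^-1 = 0. *)
Theorem corollary5p3 (R : realType) (n : nat) (alpha c : R) (p q : \bar R)
    (n_ge1 : (1 <= n)%N) (alpha_gtN1 : -1 < alpha)
    (c_gt : n%:R + 1 + alpha < c) (c_lt : c < n%:R + 2 * (1 + alpha))
    (p_ge1 : (1 <= p)%E) (q_ge1 : (1 <= q)%E) :
  bounded_Lp_Lq alpha p q (K_op n alpha c) <->
  (((1 + alpha) / (n%:R + 2 * (1 + alpha) - c))%:E < p <= +oo)%E /\
  (p^-1 + ((c - (n%:R + 1 + alpha)) / (1 + alpha))%:E < q^-1)%E.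
Proof.
case: n n_ge1 c_gt c_lt => // n _ c_gt c_lt.
have a1 : 0 < 1 + alpha by lra.
set s := (c - _) / _.
have s0 : 0 < s by rewrite divr_gt0// subr_gt0.
have [pv [pE hp]] : exists pv : R, p^-1%E = pv%:E /\
    (p = +oo%E /\ pv = 0 \/ exists2 r, 1 <= r & p = r%:E /\ pv = r^-1).
  case: p p_ge1 => [r| |//]; last by exists 0; rewrite invey; split => //; left.
  rewrite lee_fin => r1; exists r^-1; rewrite inver gt_eqF; last lra.
  by split=> //; right; exists r.
have pv0 : 0 <= pv by case: hp => [[_ ->]//|[r r1 [_ ->]]]; rewrite invr_ge0; lra.
rewrite pE; split=> [bd|[_ hpq]]; last first.
  (* For q = oo the condition would read 1/p + s < 0, which is impossible. *)
  case: q q_ge1 hpq => [q| |//]; last by rewrite invey lte_fin => _; lra.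
  rewrite lee_fin => q1; rewrite inver gt_eqF; last lra.
  by rewrite -pE => hpq; exact: K_op_bounded.
have key : (pv%:E + s%:E < q^-1)%E.
  case: q q_ge1 bd => [q| |//].
    rewrite lee_fin => q1 bd; rewrite inver gt_eqF; last lra.
    by rewrite lte_fin; exact: bounded_exponents hp q1 c_gt bd.
  (* Boundedness into L^oo gives boundedness into L^Q, hence 1/p + s < 1/Q; but this [Q] satisfies
     1/Q <= s. *)
  move=> _ bd; pose Q := Num.max 1 s^-1.
  have Q1 : 1 <= Q by rewrite le_max lexx.
  have Q0 : 0 < Q by lra.
  have := bounded_exponents alpha_gtN1 hp Q1 c_gt (bounded_Lp_Lq_oo _ alpha_gtN1 Q0 bd).
  have : Q^-1 <= s by rewrite -[s]invrK lef_pV2 ?posrE ?invr_gt0// le_max lexx orbT.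
  by rewrite -/s => ? /(_ isT) ?; exfalso; lra.
split=> //; rewrite leey andbT.
have pvs : pv + s < 1.
  rewrite -lte_fin; apply: lt_le_trans key _.
  case: q q_ge1 bd => [q| |//] => [|_ _]; last by rewrite invey lee_fin.
  rewrite lee_fin => q1 _; rewrite inver gt_eqF; last lra.
  by rewrite lee_fin invf_le1//; lra.
case: hp => [[-> _]|[r r1 [-> pvE]]]; first exact: ltry.
have r0 : 0 < r by lra.
have d0 : 0 < n.+1%:R + 2 * (1 + alpha) - c by rewrite subr_gt0.
rewrite lte_fin ltr_pdivrMr//.
have : (1 + alpha) * (r^-1 + s) < 1 + alpha by rewrite -pvE -[ltRHS]mulr1 ltr_pM2l.
rewrite mulrDr /s mulrCA divff ?gt_eqF// mulr1 => h.
have : (1 + alpha) / r < n.+1%:R + 2 * (1 + alpha) - c by move: h; lra.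
by rewrite ltr_pdivrMr// mulrC.
Qed.
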